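(* Let $M$ be a smooth manifold of dimension $5$ or $6$. Then the complete $C^0$-close $h$-principle holds for maximally non-involutive rank-$3$ distributions on $M$, i.e. for the differential relation $\mathcal{R}^{\mathrm{step2}}\subset J^1(\mathrm{Gr}_3(TM))$.
   Context: A rank-$3$ distribution $\xi\subset TM$ is a section of the Grassmann bundle $\mathrm{Gr}_3(TM)\to M$. Its curvature is the bundle map $\Omega^\xi:\wedge^2\xi\to TM/\xi$ induced by the Lie bracket, $(u,v)\mapsto[u,v]\bmod\xi$. In dimensions $5$ and $6$ a rank-$3$ distribution is called maximally non-involutive if it is bracket-generating of step $2$, i.e. $\Omega^\xi$ is an epimorphism. Since the curvature depends only on first derivatives, every $F\in J^1(\mathrm{Gr}_3(TM))$ over $p$ has an underlying $3$-plane $j^0F\subset T_pM$ and a curvature $\Omega^F:\wedge^2 j^0F\to T_pM/j^0F$. The relation $\mathcal{R}^{\mathrm{step2}}$ consists of those $F$ for which $\Omega^F$ is an epimorphism. A formal solution of a first-order relation $\mathcal{R}\subset J^1(X)$ is a section $F:M\to\mathcal{R}$; it is a solution if it is holonomic, i.e. $F=j^1f$ for a section $f$ of $X$. Complete (= full) $C^0$-close $h$-principle for $\mathcal{R}\subset J^1(X)$: for every compact manifold $K$, every smooth family $(F_k)_{k\in K}$ of formal solutions, all closed $M'\subset M$, $K'\subset K$ such that $F_k$ is a solution near $M'$ for all $k$ and is a solution on $M$ for all $k$ near $K'$, and every (positive, continuous) $\varepsilon$, there is a homotopy of families of formal solutions $(F_{k,s})_{s\in[0,1]}$ with $F_{k,0}=F_k$,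 every $F_{k,1}$ a solution, $F_{k,s}=F_k$ near $M'$ and for $k$ near $K'$, and the underlying sections $j^0F_{k,s}$ of $X$ being $\varepsilon$-close in $C^0$ to $j^0F_k$. *)

(* Defs.v *)
From HB Require Import structures.
From mathcomp Require Export all_boot all_order all_algebra.
From mathcomp Require Export all_classical all_reals all_analysis.
Export Order.TTheory GRing.Theory Num.Theory.
Export numFieldNormedType.Exports.

Set Implicit Arguments.
Unset Strict Implicit.
Unset Printing Implicit Defensive.

Local Open Scope classical_set_scope.
Local Open Scope ring_scope.

(* On an open set of a finite-dimensional space this is the usual class C^k:
   f is Frechet differentiable k times, with continuous k-th derivative. *)
Fixpoint Ck (R : realType) (V W : normedModType R) (k : nat) (U : set V)
    (f : V -> W) {struct k} : Prop :=
  if k is k'.+1 then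
    (forall x, U x -> differentiable f x) /\
    (forall v, Ck k' U (fun x => 'D_v f x))
  else forall x, U x -> {for x, continuous f}.

(* On an arbitrary set A (half-space, product with `[0, 1], ...), smooth means
   locally the restriction of a map which is smooth on an open set. *)
Definition smooth_on (R : realType) (V W : normedModType R) (A : set V)
    (f : V -> W) : Prop :=
  forall x, A x -> exists (U : set V) (h : V -> W),
    [/\ open U, U x, forall k, Ck k U h & forall y, A y -> U y -> f y = h y].

(* A chart is a partial bijection; [cfun] is only meaningful on [cdom], and
   [cinv] on the image of [cdom]. *)
Record chart (R : realType) (n : nat) (T : Type) := Chart {
  cdom : set T;
  cfun : T -> 'rV[R]_n;
  cinv : 'rV[R]_n -> T }.

Definition cimg (R : realType) (n : nat) (T : Type) (c : chart R n T) :
  set 'rV[R]_n := cfun c @` cdom c.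

(* n-manifolds modelled on the subset H of R^n: H = setT gives manifolds without
   boundary, H = halfspace R n manifolds with possibly empty boundary. The atlas
   need not be maximal. [chart_at p] is a preferred chart around p. *)
Record manifold (R : realType) (n : nat) (H : set 'rV[R]_n) := Manifold {
  msort :> topologicalType;
  atlas : set (chart R n msort);
  chart_at : msort -> chart R n msort;
  manifold_hausdorff : hausdorff_space msort;
  manifold_second_countable : @second_countable msort;
  chart_at_atlas : forall p, atlas (chart_at p);
  chart_at_dom : forall p, cdom (chart_at p) p;
  chart_open : forall c, atlas c -> open (cdom c);
  chart_img : forall c, atlas c -> exists2 O, open O & cimg c = O `&` H;
  chart_cancel : forall c, atlas c -> {in cdom c, cancel (cfun c) (cinv c)};
  chart_continuous : forall c, atlas c -> {within cdom c, continuous (cfun c)};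
  chart_inv_continuous :
    forall c, atlas c -> {within cimg c, continuous (cinv c)};
  chart_smooth : forall c d, atlas c -> atlas d ->
    smooth_on (cfun c @` (cdom c `&` cdom d)) (cfun d \o cinv c) }.

(* For m = 0 this is the whole (one-point) space. *)
Definition halfspace (R : realType) (m : nat) : set 'rV[R]_m :=
  [set x | forall i : 'I_m, nat_of_ord i = 0%N -> 0 <= x 0 i].

Section Distributions.
Variables (R : realType) (n : nat) (M : @manifold R n setT).

(* T_pM is 'rV[R]_n, read in the chart [chart_at p]. The differential of the
   change of coordinates to the chart c is v |-> v *m tcoord c p. *)
Definition tcoord (c : chart R n M) (p : M) : 'M[R]_n :=
  'J (cfun c \o cinv (chart_at p)) (cfun (chart_at p) p).

(* A field of tangent planes: the plane at p is the row space of [xi p]; only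
   this row space is ever used. *)
Definition plane_field := M -> 'M[R]_n.

(* The orthogonal projection of R^n (acting on row vectors) onto the row space
   of A. It embeds the Grassmannian of R^n as a closed submanifold of 'M_n, and
   this defines the smooth structure, and the 1-jets, used below. *)
Definition orthoproj (A : 'M[R]_n) : 'M[R]_n := proj_mx A (kermx A^T).

(* The map to the Grassmannian which represents xi in the chart c. *)
Definition grcoord (xi : plane_field) (c : chart R n M) (x : 'rV[R]_n) :
    'M[R]_n :=
  orthoproj (xi (cinv c x) *m tcoord c (cinv c x)).

Definition distribution_on (r : nat) (U : set M) (xi : plane_field) : Prop :=
  (forall p, U p -> \rank (xi p) = r) /\
  (forall c, atlas c -> smooth_on (cfun c @` (cdom c `&` U)) (grcoord xi c)).

Definition distribution_near (r : nat) (p : M) (xi : plane_field) : Prop :=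
  exists U : set M, [/\ open U, U p & distribution_on r U xi].

Definition dgrcoord (xi : plane_field) (c : chart R n M) (i : 'I_n)
    (x : 'rV[R]_n) : 'M[R]_n :=
  'D_(delta_mx 0 i : 'rV[R]_n) (grcoord xi c) x.

(* A 1-jet is an equivalence class of germs of distributions. *)
Definition jet := set plane_field.

Definition j1 (r : nat) (xi : plane_field) (p : M) : jet :=
  [set eta | distribution_near r p eta /\
     forall c, atlas c -> cdom c p ->
       grcoord eta c (cfun c p) = grcoord xi c (cfun c p) /\
       forall i, dgrcoord eta c i (cfun c p) = dgrcoord xi c i (cfun c p)].

Definition J1 (r : nat) (p : M) : set jet :=
  [set J | exists2 xi, distribution_near r p xi & J = j1 r xi p].

(* A family of sections of J^1, indexed by A, is smooth if its coordinates
   (the point P of the Grassmannian and the first derivatives L i) depend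
   smoothly on the parameter y and the point x. *)
Definition smooth_jets (E : normedModType R) (A : set E) (F : E -> M -> jet) :
    Prop :=
  forall c, atlas c ->
    exists (P : E * 'rV[R]_n -> 'M[R]_n) (L : 'I_n -> E * 'rV[R]_n -> 'M[R]_n),
      [/\ smooth_on (A `*` cimg c) P,
          forall i, smooth_on (A `*` cimg c) (L i)
        & forall y x, A y -> cimg c x -> forall xi, F y (cinv c x) xi ->
            P (y, x) = grcoord xi c x /\
            forall i, L i (y, x) = dgrcoord xi c i x].

Definition solution_on (r : nat) (U : set M) (F : M -> jet) : Prop :=
  exists2 xi, distribution_on r U xi & forall p, U p -> F p = j1 r xi p.

Definition lie_bracket (X Y : 'rV[R]_n -> 'rV[R]_n) (x : 'rV[R]_n) : 'rV[R]_n :=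
  'D_(X x) Y x - 'D_(Y x) X x.

(* A representative in T_pM of the curvature Omega(u, v) in T_pM / xi_p, for u
   and v in xi_p: the bracket of the sections of xi obtained by projecting the
   constant vector fields u and v to xi. Modulo xi_p it does not depend on the
   choice of the sections that extend u and v. *)
Definition curvature (xi : plane_field) (p : M) (u v : 'rV[R]_n) : 'rV[R]_n :=
  let c := chart_at p in
  lie_bracket (fun x => u *m grcoord xi c x) (fun x => v *m grcoord xi c x)
    (cfun c p).

(* The elements of wedge^2 xi_p are the finite sums of u /\ v. *)
Definition curvature_epi (xi : plane_field) (p : M) : Prop :=
  forall w : 'rV[R]_n, exists s : seq ('rV[R]_n * 'rV[R]_n),
    (forall uv, uv \in s -> (uv.1 <= xi p)%MS /\ (uv.2 <= xi p)%MS) /\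
    (\sum_(uv <- s) curvature xi p uv.1 uv.2 - w <= xi p)%MS.

(* Omega only depends on the 1-jet, so all representatives xi of J agree. *)
Definition step2 (r : nat) (p : M) : set jet :=
  [set J | J1 r p J /\ forall xi, J xi -> curvature_epi xi p].

(* g p is the Gram matrix on T_pM; the last clause reads g in the chart c. *)
Definition riemannian_metric (g : M -> 'M[R]_n) : Prop :=
  [/\ forall p, (g p)^T = g p,
      forall p (u : 'rV[R]_n), u != 0 -> 0 < (u *m g p *m u^T) 0 0
    & forall c, atlas c -> smooth_on (cimg c) (fun x =>
        let B := invmx (tcoord c (cinv c x)) in
        B *m g (cinv c x) *m B^T)].

Definition gnorm (G : 'M[R]_n) (u : 'rV[R]_n) : R :=
  Num.sqrt ((u *m G *m u^T) 0 0).

(* For planes V, W of the same dimension, this says that the operator norm of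
   the difference of the G-orthogonal projections onto V and W is < e. *)
Definition planes_close (G : 'M[R]_n) (e : R) (V W : 'M[R]_n) : Prop :=
  forall u : 'rV[R]_n, (u <= V)%MS -> u != 0 ->
    exists2 w : 'rV[R]_n, (w <= W)%MS & gnorm G (u - w) < e * gnorm G u.

Definition C0_close (g : M -> 'M[R]_n) (eps : M -> R) (F F' : M -> jet) : Prop :=
  forall p xi eta, F p xi -> F' p eta ->
    planes_close (g p) (eps p) (xi p) (eta p).

End Distributions.

Section HPrinciple.
Variables (R : realType) (n : nat) (M : @manifold R n setT) (r : nat).
Variable Rel : M -> set (jet M).

Section Families.
Variables (m : nat) (K : manifold (@halfspace R m)).

Definition formal_family (F : K -> M -> jet M) : Prop :=
  (forall d, atlas d -> smooth_jets (cimg d) (fun y => F (cinv d y))) /\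
  (forall k p, Rel p (F k p)).

Definition formal_homotopy (G : R -> K -> M -> jet M) : Prop :=
  (forall d, @atlas _ _ _ K d ->
     smooth_jets (E := (R * 'rV[R]_m)%type) (`[0, 1] `*` cimg d)
       (fun sy => G sy.1 (cinv d sy.2))) /\
  (forall s k p, s \in `[0, 1] -> Rel p (G s k p)).

End Families.

Definition complete_C0_close_hprinciple : Prop :=
  forall (m : nat) (K : manifold (@halfspace R m)) (F : K -> M -> jet M)
    (M' : set M) (K' : set K) (g : M -> 'M[R]_n) (eps : M -> R),
  compact [set: K] ->
  formal_family F ->
  closed M' -> closed K' ->
  (exists U : set M,
     [/\ open U, M' `<=` U & forall k, solution_on r U (F k)]) ->
  (exists W : set K,
     [/\ open W, K' `<=` W & forall k, W k -> solution_on r setT (F k)]) ->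
  riemannian_metric g ->
  continuous eps -> (forall p, 0 < eps p) ->
  exists G : R -> K -> M -> jet M,
    [/\ formal_homotopy G,
        forall k p, G 0 k p = F k p,
        forall k, solution_on r setT (G 1 k),
        (exists U : set M, [/\ open U, M' `<=` U &
           forall s k p, s \in `[0, 1] -> U p -> G s k p = F k p]) /\
        (exists W : set K, [/\ open W, K' `<=` W &
           forall s k p, s \in `[0, 1] -> W k -> G s k p = F k p])
      & forall s k, s \in `[0, 1] -> C0_close g eps (G s k) (F k)].

End HPrinciple.

(* Main.v *)
(* Near a point a rank-3 distribution is spanned by the rows of a frame A, and a
   formal 1-jet is a pair (A, B) where B_i = d_i A + E_i is the formal i-th
   derivative. The curvature is onto iff the rows of A and of the 3 x n matrix
   W = sum_i [a_i]_x B_i, whose rows are the brackets of the frame fields,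
   together span R^n; here a_i is the i-th column of A.

   The defects E_i are removed one direction at a time by an explicit
   corrugation. In direction x_i, with l = a_i, add to A the rapidly oscillating
   e S (sin t cos t [l]_x W + 2 sin t W), t = x_i / e. It is C^0-small, but its
   derivative S (cos 2t [l]_x W + 2 cos t W) multiplies W by
   N = 1 + S [l]_x (cos 2t [l]_x + 2 cos t). N is invertible for all t and l, and
   N^-1 [l]_x -> 0 uniformly as S grows, so the formal derivative in the
   direction x_i may be replaced by the actual one at every instant of a linear
   homotopy: the bracket matrix becomes N (W - tau N^-1 [l]_x E_i), which is
   harmless for S large, up to terms of size e. Cutoff functions in the homotopy
   parameter, in K and in M make the construction local and relative. Finitely
   many patches treat a compact set, and a compact exhaustion of M gives a
   locally finite, hence convergent, sequence of modifications. *)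
From HB Require Import structures.
Require Import Defs.
From mathcomp Require Import ring lra.

Set Implicit Arguments.
Unset Strict Implicit.
Unset Printing Implicit Defensive.

Local Open Scope classical_set_scope.
Local Open Scope ring_scope.

(** * Smooth maps between finite-dimensional spaces *)

Section CkTheory.
Variable R : realType.
Implicit Types V W Z : normedModType R.

(** The formal derivative in the direction x_i enters the bracket matrix only through left
    multiplication by [cross l], which is singular and is zero where the plane lies in the kernel of
    dx_i. Along a family l may vanish and reappear, so everything rests on an estimate uniform in l,
    l = 0 included ([Delta_bound], [damp_bound]). Rank 3 matters because wedge^2 of the plane is
    again 3-dimensional, which turns brackets into cross products.

    Homotopies are never concatenated. What is modified is always a whole homotopy in s, at first
    the constant one; a step keeps its value at s = 0 and improves the one at s = 1. Closeness is a
    strict inequality relative to the unchanged value at s = 0, an open condition which short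
    wavelengths preserve, so errors do not add up. With a tolerance of at most 1, projecting a frame
    given at s = 0 yields a frame at every s, so patches stay usable after each modification.
    Holonomy is tracked direction by direction in the chart of a patch, since a corrugation leaves
    the defects in the other directions as they are. *)

Lemma differentiable_near0 V W (h : V -> W) x :
  (\forall y \near x, h y = 0) -> differentiable h x.
Proof.
move=> h0.
have E : h \o shift x = cst (h x) + (\0 : V -> W) +o_ 0 id.
  apply/eqaddoP => e e0; near=> y.
  rewrite !fctE /= (nbhs_singleton h0) addr0 subr0.
  have -> : h (y + x) = 0; last by rewrite normr0 mulr_ge0 // ltW.
  near: y.
  move: h0; rewrite (near_shift 0 x) /=.
  by apply: filterS => y /=; rewrite subr0.
have c0 : continuous (\0 : {linear V -> W}) by move=> ?; exact: cvg_cst.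
by apply/diff_locallyP; rewrite (diff_unique c0 E).
Unshelve. all: by end_near. Qed.

Lemma differentiable_near V W (f g : V -> W) x :
  (\forall y \near x, f y = g y) -> differentiable f x -> differentiable g x.
Proof.
move=> fg df.
have -> : g = f + (g - f) by rewrite addrC subrK.
apply: differentiableD => //; apply: differentiable_near0.
by apply: filterS fg => y /= fgy; rewrite !fctE fgy subrr.
Qed.

(** The rules of calculus give a derivative only at the points of [U]. The inductions on [k] below
    therefore need that [Ck] ignores values outside the open set [U]. *)
Lemma Ck_ext V W k (U : set V) (f g : V -> W) : open U ->
  (forall x, U x -> f x = g x) -> Ck k U f -> Ck k U g.
Proof.
elim: k f g => [|k IH] f g oU fg /=.
  move=> cf x Ux; rewrite /prop_for /continuous_at -(fg x Ux).
  have /near_eq_cvg H : \forall y \near x, f y = g y.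
    by apply: filterS (open_nbhs_nbhs (conj oU Ux)).
  exact: cvg_trans H (cf x Ux).
move=> [df Df].
have fgn x : U x -> \forall y \near x, f y = g y.
  by move=> Ux; apply: filterS (open_nbhs_nbhs (conj oU Ux)).
split=> [x Ux|v].
  exact: differentiable_near (fgn x Ux) (df x Ux).
apply: IH (Df v) => // x Ux; exact: near_eq_derive (fgn x Ux).
Qed.

Lemma CkW V W k (U : set V) (f : V -> W) : Ck k.+1 U f -> Ck k U f.
Proof.
elim: k f => [|k IH] f.
  by move=> [df _] x Ux; exact: differentiable_continuous (df x Ux).
by move=> [df Df]; split => // v; apply: IH; exact: Df.
Qed.

Lemma Ck_subset V W k (U U' : set V) (f : V -> W) : U' `<=` U ->
  Ck k U f -> Ck k U' f.
Proof.
elim: k f => [|k IH] f UU /=; first by move=> H x /UU; exact: H.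
by move=> [df Df]; split => [x /UU|v]; [exact: df|exact: IH].
Qed.

Lemma Ck_cst V W k (U : set V) (w : W) : Ck k U (fun=> w).
Proof.
elim: k w => [|k IH] w /=; first by move=> x _; exact: cvg_cst.
split=> [x _|v]; first exact: differentiable_cst.
rewrite (_ : 'D_v _ = fun=> 0); first exact: IH.
by apply/funext => x; rewrite derive_cst.
Qed.

Lemma Ck_linear V W k (U : set V) (f : {linear V -> W}) :
  continuous f -> Ck k U f.
Proof.
case: k => [|k] cf /=; first by move=> x _; exact: cf.
split=> [x _|v]; first exact: linear_differentiable.
rewrite (_ : (fun _ => _) = fun=> f v); first exact: Ck_cst.
apply/funext => x; rewrite deriveE ?diff_lin //; exact: linear_differentiable.
Qed.

Lemma CkD V W k (U : set V) (f g : V -> W) : open U ->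
  Ck k U f -> Ck k U g -> Ck k U (fun x => f x + g x).
Proof.
move=> oU; elim: k f g => [|k IH] f g /=.
  by move=> cf cg x Ux; apply: cvgD; [exact: cf|exact: cg].
move=> [df Df] [dg Dg]; split=> [x Ux|v].
  by apply: differentiableD; [exact: df|exact: dg].
apply: Ck_ext (IH _ _ (Df v) (Dg v)) => // x Ux.
by rewrite -deriveD //; apply: diff_derivable; [exact: df|exact: dg].
Qed.

Lemma Ck_sum V W (I : Type) (r : seq I) k (U : set V) (f : I -> V -> W) :
  open U -> (forall i, Ck k U (f i)) -> Ck k U (fun x => \sum_(i <- r) f i x).
Proof.
move=> oU Hf; elim: r => [|i r IH].
  apply: Ck_ext (Ck_cst k U 0) => // x _; by rewrite big_nil.
apply: Ck_ext (CkD oU (Hf i) IH) => // x _; by rewrite big_cons.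
Qed.

Lemma CkM V k (U : set V) (f g : V -> R) : open U ->
  Ck k U f -> Ck k U g -> Ck k U (fun x => f x * g x).
Proof.
move=> oU; elim: k f g => [|k IH] f g.
  by move=> /= cf cg x Ux; apply: cvgM; [exact: cf|exact: cg].
move=> Hf Hg; have Hf' := CkW Hf; have Hg' := CkW Hg.
move: Hf Hg => /= [df Df] [dg Dg]; split=> [x Ux|v].
  by apply: differentiableM; [exact: df|exact: dg].
apply: Ck_ext (CkD oU (IH _ _ Hf' (Dg v)) (IH _ _ Hg' (Df v))) => // x Ux.
by rewrite -deriveM //; apply: diff_derivable; [exact: df|exact: dg].
Qed.

Lemma CkZl V W k (U : set V) (f : V -> R) (w : W) : open U ->
  Ck k U f -> Ck k U (fun x => f x *: w).
Proof.
move=> oU; elim: k f => [|k IH] f /=.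
  by move=> cf x Ux; apply: cvgZr_tmp; exact: cf.
move=> [df Df]; split=> [x Ux|v]; first by apply: differentiableZl; exact: df.
apply: Ck_ext (IH _ (Df v)) => // x Ux.
by rewrite !deriveE ?diffZl //; [exact: df|apply: differentiableZl; exact: df|exact: df].
Qed.

Lemma CkV V k (U : set V) (f : V -> R) : open U ->
  (forall x, U x -> f x != 0) ->
  Ck k U f -> Ck k U (fun x => (f x)^-1).
Proof.
move=> oU f0; elim: k f f0 => [|k IH] f f0.
  by move=> /= cf x Ux; apply: cvgV; [exact: f0|exact: cf].
move=> Hf; have Hf' := IH _ f0 (CkW Hf).
move: Hf => /= [df Df]; split=> [x Ux|v].
  by apply: differentiableV; [exact: df|exact: f0].
have H := CkM oU (Ck_cst k U (-1 : R)) (CkM oU (CkM oU Hf' Hf') (Df v)).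
apply: Ck_ext H => // x Ux.
rewrite (@deriveV _ _ f) //; [|exact: f0|apply: diff_derivable; exact: df].
by rewrite mulN1r /GRing.scale /= mulNr -invfM -expr2.
Qed.

(** Finite dimension as explicit data, for the sake of the chain rule: [Ck] speaks of derivatives in
    constant directions, whereas the chain rule differentiates [g] along the varying direction
    ['D_v f x], which has to be expanded in fixed vectors. *)
Record fdbasis V := Fdbasis {
  fdidx : finType;
  fdvec : fdidx -> V;
  fdcoord : fdidx -> {linear V -> R};
  fdcoord_cont : forall i, continuous (fdcoord i);
  fdE : forall v, v = \sum_i fdcoord i v *: fdvec i }.

Arguments fdvec {V} _ _.
Arguments fdcoord {V} _ _.
Arguments fdcoord_cont {V} _ _.

Lemma Ck_coord V W (b : fdbasis W) k (U : set V) (f : V -> W) : open U ->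
  (forall i, Ck k U (fun x => fdcoord b i (f x))) -> Ck k U f.
Proof.
move=> oU H.
apply: Ck_ext (Ck_sum (index_enum _) oU (fun i => CkZl (fdvec b i) oU (H i))) => //.
by move=> x _; rewrite [RHS](fdE b).
Qed.

Lemma Ck_linear_comp V W Z k (U : set V) (f : V -> W) (l : {linear W -> Z}) :
  open U -> continuous l -> Ck k U f -> Ck k U (fun x => l (f x)).
Proof.
move=> oU cl; elim: k f => [|k IH] f /=.
  by move=> cf x Ux; apply: (@continuous_comp _ _ _ f l); [exact: cf|exact: cl].
move=> [df Df]; have dl y : differentiable l y by exact: linear_differentiable.
split=> [x Ux|v].
  by apply: (@differentiable_comp _ _ _ _ f l); [exact: df|exact: dl].
apply: Ck_ext (IH _ (Df v)) => // x Ux.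
have dlf : differentiable (l \o f) x by apply: differentiable_comp; [exact: df|exact: dl].
rewrite (deriveE _ (df x Ux)) (deriveE _ dlf) (diff_comp (df x Ux)) //=.
by rewrite (diff_lin _ cl).
Qed.

Lemma derive_comp V W Z (b : fdbasis W) (f : V -> W) (g : W -> Z) x v :
  differentiable f x -> differentiable g (f x) ->
  'D_v (g \o f) x = \sum_i fdcoord b i ('D_v f x) *: 'D_(fdvec b i) g (f x).
Proof.
move=> df dg; rewrite deriveE; last exact: differentiable_comp.
rewrite diff_comp //= (deriveE _ df) [in LHS](fdE b ('d f x v)) linear_sum /=.
by apply: eq_bigr => i _; rewrite linearZ /= deriveE.
Qed.

Lemma Ck_comp_scalar V W (b : fdbasis W) k (U : set V) (U' : set W)
    (f : V -> W) (g : W -> R) : open U -> open U' ->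
  (forall x, U x -> U' (f x)) ->
  Ck k U f -> Ck k U' g -> Ck k U (fun x => g (f x)).
Proof.
move=> oU oU' UU'; elim: k f g UU' => [|k IH] f g UU'.
  move=> /= cf cg x Ux; apply: (@continuous_comp _ _ _ f g); first exact: cf.
  by apply: cg; exact: UU'.
move=> Hf Hg; have Hf' := CkW Hf; have Hg' := CkW Hg.
move: Hf Hg => /= [df Df] [dg Dg]; split=> [x Ux|v].
  by apply: (@differentiable_comp _ _ _ _ f g); [exact: df|apply: dg; exact: UU'].
have H := Ck_sum (index_enum _) oU (fun i => CkM oU
  (Ck_linear_comp oU (fdcoord_cont b i) (Df v)) (IH _ _ UU' Hf' (Dg (fdvec b i)))).
apply: Ck_ext H => // x Ux.
exact/esym/(derive_comp b v (df _ Ux) (dg _ (UU' _ Ux))).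
Qed.

Lemma Ck_comp V W Z (b : fdbasis W) (b' : fdbasis Z) k (U : set V) (U' : set W)
    (f : V -> W) (g : W -> Z) : open U -> open U' ->
  (forall x, U x -> U' (f x)) ->
  Ck k U f -> Ck k U' g -> Ck k U (fun x => g (f x)).
Proof.
move=> oU oU' UU' Hf Hg; apply: (Ck_coord (b := b')) => // i.
apply: (Ck_comp_scalar b oU oU' UU' Hf (g := fun y => fdcoord b' i (g y))).
exact: Ck_linear_comp (fdcoord_cont b' i) Hg.
Qed.

End CkTheory.
Arguments fdvec {R V} _ _.
Arguments fdcoord {R V} _ _.
Arguments fdcoord_cont {R V} _ _.

Section Bases.
Variable R : realType.

Lemma sum_delta_scalar (v : R) : v = \sum_(i : 'I_1) (idfun v : R) *: (1 : R).
Proof. by rewrite big_ord1 /= [_ *: _]mulr1. Qed.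

Definition fdR : fdbasis R :=
  @Fdbasis R R 'I_1 (fun=> 1) (fun=> idfun) (fun _ _ => cvg_id) sum_delta_scalar.

Definition mxcoord m n (ij : 'I_m * 'I_n) (N : 'M[R]_(m, n)) : R := N ij.1 ij.2.

Lemma mxcoord_linear m n ij : linear (@mxcoord m n ij).
Proof. by move=> a u v; rewrite /mxcoord !mxE. Qed.
HB.instance Definition _ m n ij :=
  GRing.isLinear.Build R 'M[R]_(m, n) R _ (@mxcoord m n ij) (@mxcoord_linear m n ij).

Lemma mxcoord_cont m n ij : continuous (@mxcoord m n ij).
Proof. by move=> N; exact: coord_continuous. Qed.

Lemma mxcoordE m n (N : 'M[R]_(m, n)) :
  N = \sum_ij mxcoord ij N *: delta_mx ij.1 ij.2.
Proof. by rewrite [LHS]matrix_sum_delta pair_bigA. Qed.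

Definition fdmx m n : fdbasis 'M[R]_(m, n) :=
  @Fdbasis R _ _ _ (fun ij => @mxcoord m n ij) (@mxcoord_cont m n) (@mxcoordE m n).

Variables (V W : normedModType R) (b : fdbasis V) (b' : fdbasis W).

Definition pairvec (i : fdidx b + fdidx b') : V * W :=
  match i with inl i => (fdvec b i, 0) | inr i => (0, fdvec b' i) end.
Definition paircoord (i : fdidx b + fdidx b') (v : V * W) : R :=
  match i with inl i => fdcoord b i v.1 | inr i => fdcoord b' i v.2 end.

Lemma paircoord_linear i : linear (paircoord i).
Proof. by case: i => i a u v /=; rewrite linearP. Qed.
HB.instance Definition _ i :=
  GRing.isLinear.Build R (V * W)%type R _ (paircoord i) (paircoord_linear i).

Lemma paircoord_cont i : continuous (paircoord i).
Proof.
case: i => i v /=.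
  apply: (@continuous_comp _ _ _ fst (fdcoord b i)); first exact: cvg_fst.
  exact: fdcoord_cont.
apply: (@continuous_comp _ _ _ snd (fdcoord b' i)); first exact: cvg_snd.
exact: fdcoord_cont.
Qed.

Lemma paircoordE v : v = \sum_i paircoord i v *: pairvec i.
Proof.
rewrite big_sumType /=; case: v => v w /=.
rewrite [in LHS](fdE b v) [in LHS](fdE b' w).
have E1 : \sum_i fdcoord b i v *: (fdvec b i, 0 : W) =
  (\sum_i fdcoord b i v *: fdvec b i, 0).
  by elim/big_rec2 : _ => // i x y _ ->; congr pair; rewrite /= scaler0 addr0.
have E2 : \sum_i fdcoord b' i w *: (0 : V, fdvec b' i) =
  (0, \sum_i fdcoord b' i w *: fdvec b' i).
  by elim/big_rec2 : _ => // i x y _ ->; congr pair; rewrite /= scaler0 addr0.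
by rewrite E1 E2; congr pair; rewrite /= ?addr0 ?add0r.
Qed.

Definition fdpair : fdbasis (V * W)%type :=
  @Fdbasis R _ _ pairvec (fun i => paircoord i) paircoord_cont paircoordE.

End Bases.

(** * Smoothness at a point, relative to a subset *)

Section SmoothAt.
Variable R : realType.
Implicit Types V W Z : normedModType R.

Lemma nbhs_exists_open (T : topologicalType) (z : T) (P : set T) :
  nbhs z P -> exists Q : set T, [/\ open Q, Q z & Q `<=` P].
Proof. by rewrite nbhsE => -[Q [oQ Qz] QP]; exists Q. Qed.

(** The condition that [smooth_on] imposes at a single point. The set [A] stays fixed while the
    point varies, so interior points, boundary points of a half-space and the ends of the time
    interval obey the same rules. *)
Definition smooth_at V W (A : set V) (z : V) (f : V -> W) : Prop :=
  exists (U : set V) (h : V -> W),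
    [/\ open U, U z, forall k, Ck k U h & forall y, A y -> U y -> f y = h y].

Lemma smooth_at_ext V W (A : set V) z (f g : V -> W) :
  (\forall y \near z, A y -> f y = g y) -> smooth_at A z f -> smooth_at A z g.
Proof.
move=> /nbhs_exists_open[Q [oQ Qz fg]] [U [h [oU Uz Ch fh]]].
exists (U `&` Q), h; split=> //; first exact: openI.
  by move=> k; apply: Ck_subset (Ch k) => y [].
by move=> y Ay [Uy Qy]; rewrite -fg ?fh.
Qed.

Lemma smooth_at_near V W (A : set V) z (f : V -> W) :
  smooth_at A z f -> \forall y \near z, smooth_at A y f.
Proof.
move=> [U [h [oU Uz Ch fh]]]; apply: filterS (open_nbhs_nbhs (conj oU Uz)).
by move=> y Uy; exists U, h.
Qed.

Lemma smooth_at_sub V W (A B : set V) z (f : V -> W) :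
  (\forall y \near z, B y -> A y) -> smooth_at A z f -> smooth_at B z f.
Proof.
move=> /nbhs_exists_open[Q [oQ Qz BA]] [U [h [oU Uz Ch fh]]].
exists (U `&` Q), h; split=> //; first exact: openI.
  by move=> k; apply: Ck_subset (Ch k) => y [].
by move=> y By [Uy Qy]; rewrite fh //; exact: BA.
Qed.

Lemma smooth_at_cst V W (A : set V) z (w : W) : smooth_at A z (fun=> w).
Proof. by exists setT, (fun=> w); split=> // [|k]; [exact: openT|exact: Ck_cst]. Qed.

Lemma smooth_at_linear V W (A : set V) z (l : {linear V -> W}) :
  continuous l -> smooth_at A z l.
Proof. by move=> cl; exists setT, l; split=> // [|k]; [exact: openT|exact: Ck_linear]. Qed.

Lemma smooth_at2 V W1 W2 W (A : set V) z (f : V -> W1) (g : V -> W2)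
    (op : W1 -> W2 -> W) :
  (forall k (U : set V) f g, open U -> Ck k U f -> Ck k U g ->
    Ck k U (fun x => op (f x) (g x))) ->
  smooth_at A z f -> smooth_at A z g -> smooth_at A z (fun x => op (f x) (g x)).
Proof.
move=> H [U [h [oU Uz Ch fh]]] [U' [h' [oU' Uz' Ch' fh']]].
exists (U `&` U'), (fun x => op (h x) (h' x)); split=> //; first exact: openI.
  move=> k; apply: H => //; first exact: openI.
    by apply: Ck_subset (Ch k) => y [].
  by apply: Ck_subset (Ch' k) => y [].
by move=> y Ay [Uy Uy']; rewrite fh ?fh'.
Qed.

Lemma smooth_atD V W (A : set V) z (f g : V -> W) :
  smooth_at A z f -> smooth_at A z g -> smooth_at A z (fun x => f x + g x).
Proof. by apply: smooth_at2 => *; exact: CkD. Qed.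

Lemma smooth_atM V (A : set V) z (f g : V -> R) :
  smooth_at A z f -> smooth_at A z g -> smooth_at A z (fun x => f x * g x).
Proof. by apply: smooth_at2 => *; exact: CkM. Qed.

Lemma smooth_at_lincomp V W Z (A : set V) z (f : V -> W) (l : {linear W -> Z}) :
  continuous l -> smooth_at A z f -> smooth_at A z (fun x => l (f x)).
Proof.
move=> cl [U [h [oU Uz Ch fh]]]; exists U, (fun x => l (h x)).
split=> // [k|y Ay Uy]; first exact: Ck_linear_comp.
by rewrite fh.
Qed.

Lemma smooth_atN V W (A : set V) z (f : V -> W) :
  smooth_at A z f -> smooth_at A z (fun x => - f x).
Proof.
move=> [U [h [oU Uz Ch fh]]]; exists U, (fun x => - h x).
split=> // [k|y Ay Uy]; last by rewrite fh.
by apply: (Ck_linear_comp (l := -%R)) => //; exact: opp_continuous.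
Qed.

Lemma smooth_atB V W (A : set V) z (f g : V -> W) :
  smooth_at A z f -> smooth_at A z g -> smooth_at A z (fun x => f x - g x).
Proof. by move=> sf sg; apply: smooth_atD => //; exact: smooth_atN. Qed.

Lemma smooth_at_sum V W (I : Type) (r : seq I) (A : set V) z (f : I -> V -> W) :
  (forall i, smooth_at A z (f i)) -> smooth_at A z (fun x => \sum_(i <- r) f i x).
Proof.
move=> H; elim: r => [|i r IH].
  apply: smooth_at_ext (smooth_at_cst A z 0); by near=> y; rewrite big_nil.
apply: smooth_at_ext (smooth_atD (H i) IH); by near=> y; rewrite big_cons.
Unshelve. all: by end_near. Qed.

Lemma smooth_at_prod V (I : Type) (r : seq I) (A : set V) z (f : I -> V -> R) :
  (forall i, smooth_at A z (f i)) -> smooth_at A z (fun x => \prod_(i <- r) f i x).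
Proof.
move=> H; elim: r => [|i r IH].
  apply: smooth_at_ext (smooth_at_cst A z (1 : R)); by near=> y; rewrite big_nil.
apply: smooth_at_ext (smooth_atM (H i) IH); by near=> y; rewrite big_cons.
Unshelve. all: by end_near. Qed.

Lemma smooth_at_cvg V W (A : set V) z (f : V -> W) : A z ->
  smooth_at A z f -> exists2 h : V -> W, {for z, continuous h} &
    h z = f z /\ \forall y \near z, A y -> f y = h y.
Proof.
move=> Az [U [h [oU Uz Ch fh]]]; exists h; first exact: (Ch 0%N).
split; first by rewrite fh.
by apply: filterS (open_nbhs_nbhs (conj oU Uz)) => y Uy Ay; exact: fh.
Qed.

Lemma smooth_at_nearP V W (A : set V) z (f : V -> W) (P : set W) : A z ->
  smooth_at A z f -> nbhs (f z) P -> \forall y \near z, A y -> P (f y).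
Proof.
move=> Az /(smooth_at_cvg Az)[h ch [hz fh]]; rewrite -hz => /ch.
by rewrite nbhs_simpl; apply: filterS2 fh => y fhy /= Phy /fhy ->.
Qed.

Lemma smooth_atV V (A : set V) z (f : V -> R) : A z -> f z != 0 ->
  smooth_at A z f -> smooth_at A z (fun x => (f x)^-1).
Proof.
move=> Az fz [U [h [oU Uz Ch fh]]].
have ch x : U x -> {for x, continuous h} by exact: (Ch 0%N).
pose U' := U `&` h @^-1` [set r | r != 0].
have oU' : open U'.
  rewrite openE => x [Ux hx] /=; apply: filterI.
    exact: (open_nbhs_nbhs (conj oU Ux)).
  apply: (ch x Ux); apply: open_nbhs_nbhs; split=> //; exact: open_neq.
exists U', (fun x => (h x)^-1); split=> //.
- by split=> //=; rewrite -fh.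
- move=> k; apply: CkV => // [x []//|].
  by apply: Ck_subset (Ch k) => y [].
- by move=> y Ay [Uy _]; rewrite fh.
Qed.

Lemma smooth_at_comp V W Z (b : fdbasis W) (b' : fdbasis Z) (A : set V) (B : set W) z
    (f : V -> W) (g : W -> Z) : A z ->
  (\forall y \near z, A y -> B (f y)) ->
  smooth_at A z f -> smooth_at B (f z) g -> smooth_at A z (fun x => g (f x)).
Proof.
move=> Az /nbhs_exists_open[Q [oQ Qz AB]] [U [h [oU Uz Ch fh]]] [U' [h' [oU' Uz' Ch' fh']]].
have ch x : U x -> {for x, continuous h} by exact: (Ch 0%N).
pose U2 := U `&` h @^-1` U' `&` Q.
have oU2 : open U2.
  apply: openI => //; rewrite openE => x [Ux hx] /=; apply: filterI.
    exact: (open_nbhs_nbhs (conj oU Ux)).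
  by apply: (ch x Ux); apply: open_nbhs_nbhs; split.
exists U2, (fun x => h' (h x)); split=> //.
- by split=> //; split=> //=; rewrite -fh.
- move=> k; apply: (Ck_comp b b' oU2 oU') => [x [[]]//||//].
  by apply: Ck_subset (Ch k) => y [[]].
- move=> y Ay [[Uy /= Uy'] Qy]; rewrite -(fh y) //; apply: fh'; first exact: AB.
  by rewrite fh.
Qed.

Lemma smooth_at_coord V W (b : fdbasis W) (A : set V) z (f : V -> W) :
  (forall i, smooth_at A z (fun x => fdcoord b i (f x))) -> smooth_at A z f.
Proof.
move=> /(_ _)/cid H; pose U i := sval (H i).
have H' i : exists h : V -> R, [/\ open (U i), U i z, forall k, Ck k (U i) h &
    forall y, A y -> U i y -> fdcoord b i (f y) = h y] by exact: svalP (H i).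
have [h Hh] := choice H'.
pose U0 := interior (\bigcap_i U i).
have U0z : U0 z.
  apply: (@filterS _ (nbhs z) _ [set y | forall i, U i y]) => [y Uy i _//|].
  apply: filter_forall => i; have [oU Uz _ _] := Hh i.
  exact: (open_nbhs_nbhs (conj oU Uz)).
have sU i y : U0 y -> U i y by move=> /interior_subset; exact.
exists U0, (fun y => \sum_i h i y *: fdvec b i); split=> //.
- exact: open_interior.
- move=> k; apply: Ck_sum => [|i]; first exact: open_interior.
  apply: CkZl; first exact: open_interior.
  by have [_ _ Ch _] := Hh i; apply: Ck_subset (Ch k); exact: sU.
- move=> y Ay Uy; rewrite [LHS](fdE b); apply: eq_bigr => i _.
  by have [_ _ _ ->] := Hh i => //; exact: sU.
Qed.

Lemma smooth_at_mx V m n (A : set V) z (F : V -> 'M[R]_(m, n)) :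
  (forall i j, smooth_at A z (fun x => F x i j)) -> smooth_at A z F.
Proof. by move=> H; apply: (smooth_at_coord (b := fdmx R m n)) => -[i j]; exact: H. Qed.

Lemma smooth_at_entry V m n (A : set V) z (F : V -> 'M[R]_(m, n)) i j :
  smooth_at A z F -> smooth_at A z (fun x => F x i j).
Proof. exact: (smooth_at_lincomp (@mxcoord_cont R m n (i, j))). Qed.

Lemma smooth_at_mulmx V m n p (A : set V) z (F : V -> 'M[R]_(m, n))
    (G : V -> 'M[R]_(n, p)) :
  smooth_at A z F -> smooth_at A z G -> smooth_at A z (fun x => F x *m G x).
Proof.
move=> sF sG; apply: smooth_at_mx => i j.
apply: smooth_at_ext (_ : smooth_at A z (fun x => \sum_k F x i k * G x k j)).
  by near=> y; rewrite mxE.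
by apply: smooth_at_sum => k; apply: smooth_atM; exact: smooth_at_entry.
Unshelve. all: by end_near. Qed.

Lemma smooth_at_trmx V m n (A : set V) z (F : V -> 'M[R]_(m, n)) :
  smooth_at A z F -> smooth_at A z (fun x => (F x)^T).
Proof.
move=> sF; apply: smooth_at_mx => i j.
apply: smooth_at_ext (smooth_at_entry j i sF); by near=> y; rewrite mxE.
Unshelve. all: by end_near. Qed.

Lemma smooth_atZ V m n (A : set V) z (f : V -> R) (F : V -> 'M[R]_(m, n)) :
  smooth_at A z f -> smooth_at A z F -> smooth_at A z (fun x => f x *: F x).
Proof.
move=> sf sF; apply: smooth_at_mx => i j.
apply: smooth_at_ext (smooth_atM sf (smooth_at_entry i j sF)).
by near=> y; rewrite mxE.
Unshelve. all: by end_near. Qed.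

Lemma smooth_at_det V n (A : set V) z (F : V -> 'M[R]_n) :
  smooth_at A z F -> smooth_at A z (fun x => \det (F x)).
Proof.
move=> sF; rewrite /determinant; apply: smooth_at_sum => s.
apply: smooth_atM; first exact: smooth_at_cst.
by apply: smooth_at_prod => i; exact: smooth_at_entry.
Qed.

Lemma smooth_at_mxsub V m n m' n' (A : set V) z (F : V -> 'M[R]_(m, n))
    (f : 'I_m' -> 'I_m) (g : 'I_n' -> 'I_n) :
  smooth_at A z F -> smooth_at A z (fun x => mxsub f g (F x)).
Proof.
move=> sF; apply: smooth_at_mx => i j.
apply: smooth_at_ext (smooth_at_entry (f i) (g j) sF); by near=> y; rewrite mxE.
Unshelve. all: by end_near. Qed.

(** By Cramer's rule: near [z] the inverse is the adjugate divided by the determinant, both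
    polynomial in the entries. *)
Lemma smooth_at_invmx V n (A : set V) z (F : V -> 'M[R]_n) : A z ->
  F z \in unitmx -> smooth_at A z F -> smooth_at A z (fun x => invmx (F x)).
Proof.
move=> Az Fz sF; have sd := smooth_at_det sF.
have dz : \det (F z) != 0 by move: Fz; rewrite unitmxE unitfE.
apply: (@smooth_at_ext _ _ _ _ (fun x => (\det (F x))^-1 *: \adj (F x))).
  have := smooth_at_nearP Az sd (open_nbhs_nbhs (conj (@open_neq _ 0) dz)).
  apply: filterS => y H Ay; have /= dy := H Ay.
  by rewrite /invmx unitmxE unitfE dy.
apply: smooth_atZ; first exact: smooth_atV.
apply: smooth_at_mx => i j.
apply: (@smooth_at_ext _ _ _ _ (fun x => (-1) ^+ (j + i) * \det (row' j (col' i (F x))))).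
  by near=> y; rewrite mxE.
apply: smooth_atM; first exact: smooth_at_cst.
apply: smooth_at_det.
apply: smooth_at_ext (smooth_at_mxsub (lift j) (lift i) sF).
by near=> y => Ay; apply/matrixP => a c; rewrite !mxE.
Unshelve. all: by end_near. Qed.

Lemma smooth_at_pair V W Z (A : set V) z (f : V -> W) (g : V -> Z) (b : fdbasis W)
    (b' : fdbasis Z) :
  smooth_at A z f -> smooth_at A z g -> smooth_at A z (fun x => (f x, g x)).
Proof.
move=> sf sg; apply: (smooth_at_coord (b := fdpair b b')) => -[i|i] /=.
  exact: smooth_at_lincomp (fdcoord_cont b i) sf.
exact: smooth_at_lincomp (fdcoord_cont b' i) sg.
Qed.

Lemma smooth_at_fst V W (A : set (V * W)) z : smooth_at A z fst.
Proof. by apply: (@smooth_at_linear (V * W)%type V A z fst) => x; exact: cvg_fst. Qed.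

Lemma smooth_at_snd V W (A : set (V * W)) z : smooth_at A z snd.
Proof. by apply: (@smooth_at_linear (V * W)%type W A z snd) => x; exact: cvg_snd. Qed.

Lemma smooth_at_id V (A : set V) z : smooth_at A z id.
Proof. by apply: (@smooth_at_linear V V A z idfun) => x. Qed.

Lemma smooth_at_differentiable V W (A : set V) z (f : V -> W) : nbhs z A ->
  smooth_at A z f -> differentiable f z.
Proof.
move=> nA [U [h [oU Uz Ch fh]]].
apply: (@differentiable_near _ _ _ h); last by have [dh _] := Ch 1%N; exact: dh.
by apply: filterS2 nA (open_nbhs_nbhs (conj oU Uz)) => y Ay Uy; rewrite fh.
Qed.

Lemma smooth_at_derive V W (A : set V) z (f : V -> W) v : nbhs z A ->
  smooth_at A z f -> smooth_at A z (fun x => 'D_v f x).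
Proof.
move=> /nbhs_exists_open[Q [oQ Qz QA]] [U [h [oU Uz Ch fh]]].
exists (U `&` Q), (fun x => 'D_v h x); split=> //; first exact: openI.
  by move=> k; have [_ /(_ v)] := Ch k.+1; apply: Ck_subset => y [].
move=> y Ay [Uy Qy]; apply: near_eq_derive.
near=> x; apply: fh; first by apply: QA; near: x; exact: (open_nbhs_nbhs (conj oQ Qy)).
by near: x; exact: (open_nbhs_nbhs (conj oU Uy)).
Unshelve. all: by end_near. Qed.

Lemma smooth_at_derive_along V W Z (b : fdbasis W) (b' : fdbasis Z) (A : set V) (B : set W) z (f v : V -> W)
    (g : W -> Z) : A z -> nbhs (f z) B ->
  (\forall y \near z, A y -> nbhs (f y) B) ->
  smooth_at A z f -> smooth_at A z v -> smooth_at B (f z) g ->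
  smooth_at A z (fun x => 'D_(v x) g (f x)).
Proof.
move=> Az nB AB sf sv sg.
pose g' x := \sum_i fdcoord b i (v x) *: 'D_(fdvec b i) g (f x).
have sgn : \forall y \near z, A y -> smooth_at B (f y) g.
  exact: (smooth_at_nearP Az sf (smooth_at_near sg)).
apply: (@smooth_at_ext _ _ _ _ g').
  apply: filterS2 AB sgn => y ABy /[swap] Ay /(_ Ay) sgy.
  have dg := smooth_at_differentiable (ABy Ay) sgy.
  rewrite /g' deriveE // [in RHS](fdE b (v y)) linear_sum.
  by apply: eq_bigr => i _; rewrite linearZ /= deriveE.
apply: smooth_at_sum => i.
have s1 := smooth_at_derive (fdvec b i) nB sg.
have s2 : smooth_at A z (fun x => 'D_(fdvec b i) g (f x)).
  apply: (smooth_at_comp b b' Az _ sf s1).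
  by apply: filterS AB => y H /H; exact: nbhs_singleton.
apply: (smooth_at_coord (b := b')) => j.
have s3 := smooth_atM (smooth_at_lincomp (fdcoord_cont b i) sv)
  (smooth_at_lincomp (fdcoord_cont b' j) s2).
by apply: smooth_at_ext s3; near=> y; rewrite linearZ.
Unshelve. all: by end_near. Qed.

Section Slices.
Variables (E V W : normedModType R).
Variables (B : set E) (O : set V).
Hypothesis oO : open O.

Lemma slice_derive (h : E * V -> W) (q : E * V) v :
  'D_v (fun x => h (q.1, x)) q.2 = 'D_((0, v) : E * V) h q.
Proof.
rewrite /derive; set F := (fun t => _); set G := (fun t => _).
suff -> : F = G by []; apply/funext => t; rewrite /F /G /=.
by case: q {F G} => q1 q2 /=; congr (_ *: (h _ - _)); congr pair; rewrite /= scaler0 add0r.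
Qed.

Lemma smooth_at_slice (f : E * V -> W) (q : E * V) (b : fdbasis E) (b' : fdbasis V)
    (b'' : fdbasis W) : B q.1 -> O q.2 ->
  smooth_at (B `*` O) q f -> smooth_at O q.2 (fun x => f (q.1, x)).
Proof.
case: q => y x /= By Ox sf.
apply: (@smooth_at_comp _ _ _ (fdpair b b') b'' O (B `*` O) x (fun x => (y, x)) f) => //.
  by near=> z.
apply: smooth_at_pair => //; [exact: smooth_at_cst|exact: smooth_at_id].
Unshelve. all: by end_near. Qed.

(** The parameter set [B] need not be open: it will be the time interval times the image of a
    boundary chart. Only directions tangent to the open factor [O] are differentiated, and along
    these [f] agrees with its smooth local extension. *)
Lemma smooth_at_slice_derive (f : E * V -> W) (q : E * V) v : B q.1 -> O q.2 ->
  smooth_at (B `*` O) q f ->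
  smooth_at (B `*` O) q (fun q => 'D_v (fun x => f (q.1, x)) q.2).
Proof.
move=> By Ox [U [h [oU Uz Ch fh]]].
exists U, (fun q => 'D_((0, v) : E * V) h q); split=> //.
  by move=> k; have [_ /(_ (0, v))] := Ch k.+1.
move=> [y' x'] [/= By' Ox'] Uq; rewrite -slice_derive; apply: near_eq_derive.
have c : (y', x) @[x --> x'] --> (y', x') by apply: cvg_pair => /=; [exact: cvg_cst|exact: cvg_id].
have nU := c _ (open_nbhs_nbhs (conj oU Uq)).
rewrite /= in nU; near=> x; apply: fh.
  by split=> //=; near: x; exact: (open_nbhs_nbhs (conj oO Ox')).
by near: x; exact: nU.
Unshelve. all: by end_near. Qed.

End Slices.
End SmoothAt.

(** * Cutoff functions *)

Section OneVariable.
Variable R : realType.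

Lemma CkS_is_derive (f f' : R -> R) k :
  (forall x : R, is_derive x (1 : R) f (f' x)) -> Ck k setT f' -> Ck k.+1 setT f.
Proof.
move=> df Hf'; have dif x : differentiable f x.
  by apply/derivable1_diffP; case: (df x).
split=> [x _|v]; first exact: dif.
apply: Ck_ext (CkM openT (Ck_cst k setT (v : R)) Hf') => [|x _]; first exact: openT.
rewrite deriveE //.
have -> : v = v *: (1 : R) by rewrite /GRing.scale /= mulr1.
by rewrite linearZ /= -deriveE // (@derive_val _ _ _ _ _ _ _ (df x)) /GRing.scale /= mulr1.
Qed.

Lemma Ck_sin_cos k : Ck k setT (@sin R) /\ Ck k setT (@cos R).
Proof.
elim: k => [|k [IHs IHc]].
  by split=> x _; [exact: continuous_sin|exact: continuous_cos].
split; first exact: (CkS_is_derive _ IHc).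
apply: (CkS_is_derive (f' := fun x => - sin x)) => //.
by apply: (Ck_linear_comp (l := -%R)) => //; [exact: openT|exact: opp_continuous].
Qed.

(** The usual flat function exp (-1/x) is the case [n = 0]. Up to linear combinations the family
    with all powers is closed under differentiation, so smoothness becomes an induction on [k] for
    all [n] at once. *)
Definition flat (n : nat) (x : R) : R :=
  if 0 < x then x ^- n * expR (- x^-1) else 0.

Lemma flat_ge0 n x : 0 <= flat n x.
Proof.
by rewrite /flat; case: ifP => // x0; rewrite mulr_ge0 ?expR_ge0 // invr_ge0 exprn_ge0 // ltW.
Qed.

Lemma flat_gt0 n x : 0 < x -> 0 < flat n x.
Proof.
by move=> x0; rewrite /flat x0 mulr_gt0 ?expR_gt0 // invr_gt0 exprn_gt0.
Qed.

Lemma flat_le0 n x : x <= 0 -> flat n x = 0.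
Proof. by rewrite /flat leNgt => /negbTE ->. Qed.

(** One term of the exponential series, (1/x)^(n+2) / (n+2)!, bounds exp (1/x) from below. The
    resulting quadratic bound gives derivative 0 at the origin. *)
Lemma flat_bound n x : flat n x <= (n.+2)`!%:R * x ^+ 2.
Proof.
rewrite /flat; case: ifP => x0; last by rewrite mulr_ge0 ?sqr_ge0.
have xi0 : 0 < x^-1 by rewrite invr_gt0.
have E : (x^-1) ^+ n.+2 / (n.+2)`!%:R <= expR (x^-1).
  by apply: le_trans (expR_ge1Dxn n.+1 (ltW xi0)); rewrite lerDr.
have F0 : 0 < (n.+2)`!%:R :> R by rewrite ltr0n fact_gt0.
rewrite expRN -invfM -[leLHS]mul1r ler_pdivrMr; last first.
  by rewrite mulr_gt0 ?exprn_gt0 ?expR_gt0.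
apply: le_trans (_ : (n.+2)`!%:R * x ^+ 2 * (x ^+ n * (x^-1 ^+ n.+2 / (n.+2)`!%:R)) <= _).
  rewrite -(addn2 n) exprVn exprD.
  have xn0 : x ^+ n != 0 by rewrite expf_neq0 // gt_eqF.
  have xn1 : x != 0 by rewrite gt_eqF.
  have xn2 : (n + 2)`!%:R != 0 :> R by rewrite addn2 gt_eqF.
  by rewrite le_eqVlt; apply/orP; left; apply/eqP; field; rewrite xn0 xn1 xn2.
rewrite ler_pM2l; last by rewrite mulr_gt0 // exprn_gt0.
by rewrite ler_pM2l // exprn_gt0.
Qed.

Lemma is_derive_quadratic_bound (f : R -> R) C : 0 <= C ->
  (forall x, `|f x| <= C * x ^+ 2) -> is_derive (0 : R) 1 f 0.
Proof.
move=> C0 Hf.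
have f0 : f 0 = 0.
  by apply/eqP; rewrite -normr_le0; have := Hf 0; rewrite expr0n mulr0.
have L : h^-1 *: ((f \o shift 0) (h *: (1 : R)) - f 0) @[h --> 0^'] --> (0 : R).
  apply/cvgrPdist_le => e e0; near=> h.
  have h0 : h != 0 by near: h; exact: nbhs_dnbhs_neq.
  rewrite sub0r normrN /= f0 subr0 addr0 [h *: _]mulr1 normrZ normfV.
  rewrite ler_pdivrMl ?normr_gt0 //; apply: le_trans (Hf h) _.
  rewrite -[h ^+ 2]ger0_norm ?sqr_ge0 // normrX expr2 mulrCA.
  rewrite ler_pM2l ?normr_gt0 //.
  have : `|h| <= e / (C + 1).
    by near: h; apply: dnbhs0_le; rewrite divr_gt0 // ltr_wpDl.
  rewrite ler_pdivlMr ?ltr_wpDl // => H; apply: le_trans H.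
  by rewrite mulrC ler_wpM2l // lerDl.
by apply: DeriveDef; [apply/cvg_ex; exists 0|exact: cvg_lim L].
Unshelve. all: by end_near. Qed.

Lemma is_derive_flat n (x : R) :
  is_derive x (1 : R) (flat n) (flat n.+2 x - n%:R * flat n.+1 x).
Proof.
have [x0|x0|->] := ltgtP x 0.
- rewrite !flat_le0 1?ltW // mulr0 subrr.
  apply: near_eq_is_derive (is_derive_cst 0 x 1).
  near=> y; rewrite flat_le0 //; apply: ltW; near: y.
  by apply: open_nbhs_nbhs; split=> //; exact: open_lt.
- pose g y := y ^- n * expR (- y^-1) : R.
  have xn : x != 0 by rewrite gt_eqF.
  apply: (@near_eq_is_derive _ _ _ g).
    near=> y; rewrite /flat ifT //; near: y.
    by apply: open_nbhs_nbhs; split=> //; exact: open_gt.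
  rewrite /flat x0.
  have d1 : is_derive x 1 (fun y : R => y^-1) (- x ^- 2).
    have := @is_deriveV R id x 1 1 xn (is_derive_id _ _).
    by rewrite /GRing.scale /= mulr1.
  have d2 : is_derive x 1 (fun y : R => expR (- y^-1)) (expR (- x^-1) * x ^- 2).
    have d3 : is_derive x 1 (fun y : R => - y^-1) (x ^- 2).
      by rewrite -[x ^- 2]opprK; exact: is_deriveN.
    exact: (@is_derive1_comp _ expR (fun y : R => - y^-1) x _ _ (is_derive_expR _) d3).
  have d4 : is_derive x 1 (fun y : R => (y^-1) ^+ n) (n%:R * (x^-1) ^+ n.-1 * (- x ^- 2)).
    have := @is_deriveX R R (fun y : R => y^-1) n x 1 _ d1.
    have -> : (fun y : R => y^-1) ^+ n = (fun y : R => y^-1 ^+ n).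
      by apply/funext => y; elim: n {g} => [|n IH] //; rewrite !exprS -IH.
    by [].
  have := is_deriveM d4 d2.
  have -> : (fun y : R => y^-1 ^+ n) * (fun y => expR (- y^-1)) = g.
    by apply/funext => y; rewrite /g fctE exprVn.
  move/is_derive_eq; apply; rewrite /GRing.scale /= !exprVn.
  case: n {g d4} => [|n] /=; first by rewrite expr0; field.
  rewrite !exprS -natr1; have xn0 : x ^+ n != 0 by rewrite expf_neq0.
  by field; rewrite xn xn0.
- rewrite !flat_le0 // mulr0 subrr.
  apply: (@is_derive_quadratic_bound _ (n.+2)`!%:R) => // x'.
  by rewrite ger0_norm ?flat_ge0 //; exact: flat_bound.
Unshelve. all: by end_near. Qed.

Lemma Ck_flat k n : Ck k setT (flat n).
Proof.
elim: k n => [|k IH] n.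
  by move=> x _; apply/differentiable_continuous/derivable1_diffP/ex_derive/is_derive_flat.
apply: (CkS_is_derive (is_derive_flat n)).
apply: Ck_ext (CkD openT (IH n.+2) (CkM openT (Ck_cst k setT (- n%:R : R)) (IH n.+1))).
  exact: openT.
by move=> x _; rewrite mulNr.
Qed.

Definition smoothstep (t : R) := flat 0 (2 - t) / (flat 0 (2 - t) + flat 0 (t - 1)).

Lemma smoothstep_den t : 0 < flat 0 (2 - t) + flat 0 (t - 1).
Proof.
have [t2|t2] := ltP t 2; first by rewrite ltr_wpDr ?flat_ge0 // flat_gt0 // subr_gt0.
by rewrite ltr_wpDl ?flat_ge0 // flat_gt0 // subr_gt0 (lt_le_trans _ t2) // ltr1n.
Qed.

Definition bump1 (t : R) := smoothstep t * smoothstep (- t).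

Lemma bump1_ge0 t : 0 <= bump1 t.
Proof.
by rewrite mulr_ge0 // divr_ge0 ?flat_ge0 // ltW // smoothstep_den.
Qed.

Lemma bump1_eq1 t : `|t| <= 1 -> bump1 t = 1.
Proof.
have H s : s <= 1 -> smoothstep s = 1.
  move=> s1; have := smoothstep_den s; rewrite /smoothstep (@flat_le0 _ (s - 1)).
    by rewrite addr0 => /gt_eqF/negbT/divff.
  by rewrite subr_le0.
by rewrite ler_norml => /andP[t1 t2]; rewrite /bump1 !H ?mulr1 // lerNl.
Qed.

Lemma bump1_eq0 t : 2 <= `|t| -> bump1 t = 0.
Proof.
have H s : 2 <= s -> smoothstep s = 0.
  by move=> s2; rewrite /smoothstep flat_le0 ?mul0r // subr_le0.
rewrite ler_normr => /orP[] t2; rewrite /bump1; first by rewrite H ?mul0r.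
by rewrite (H (- t)) ?mulr0.
Qed.

Lemma smooth_bump1 (V : normedModType R) (A : set V) z (f : V -> R) : A z ->
  smooth_at A z f -> smooth_at A z (fun x => bump1 (f x)).
Proof.
move=> Az sf.
have F g : smooth_at A z g -> smooth_at A z (fun x => flat 0 (g x)).
  move=> sg; apply: (@smooth_at_comp _ _ _ _ (fdR R) (fdR R) A setT z) => //.
    by near=> y.
  exists setT, (flat 0); split=> //; [exact: openT|move=> k; exact: Ck_flat].
have H g : smooth_at A z g -> smooth_at A z (fun x => smoothstep (g x)).
  move=> sg; have s2 : smooth_at A z (fun x => flat 0 (2 - g x)).
    by apply: F; apply: smooth_atB => //; exact: smooth_at_cst.
  apply: smooth_atM => //; apply: smooth_atV => //.
    by rewrite gt_eqF // smoothstep_den.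
  apply: smooth_atD => //; apply: F; apply: smooth_atB => //; exact: smooth_at_cst.
by apply: smooth_atM; apply: H => //; exact: smooth_atN.
Unshelve. all: by end_near. Qed.

Lemma smooth_sin (V : normedModType R) (A : set V) z (f : V -> R) : A z ->
  smooth_at A z f -> smooth_at A z (fun x => sin (f x)).
Proof.
move=> Az sf; apply: (@smooth_at_comp _ _ _ _ (fdR R) (fdR R) A setT z) => //.
  by near=> y.
by exists setT, (@sin R); split=> [|//|k|//]; [exact: openT|exact: (Ck_sin_cos k).1].
Unshelve. all: by end_near. Qed.

Lemma smooth_cos (V : normedModType R) (A : set V) z (f : V -> R) : A z ->
  smooth_at A z f -> smooth_at A z (fun x => cos (f x)).
Proof.
move=> Az sf; apply: (@smooth_at_comp _ _ _ _ (fdR R) (fdR R) A setT z) => //.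
  by near=> y.
by exists setT, (@cos R); split=> [|//|k|//]; [exact: openT|exact: (Ck_sin_cos k).2].
Unshelve. all: by end_near. Qed.

(** A product over coordinates instead of a function of the norm: the norm here is the maximum norm,
    which is not smooth, while the product is constant on balls of exactly this norm. *)
Definition bump n (a : 'rV[R]_n) (r : R) (x : 'rV[R]_n) : R :=
  \prod_(i < n) bump1 ((x 0 i - a 0 i) / r).

Lemma bump_ge0 n (a : 'rV[R]_n) r x : 0 <= bump a r x.
Proof. by apply: prodr_ge0 => i _; exact: bump1_ge0. Qed.

Lemma entry_le_norm m n (N : 'M[R]_(m, n)) i j : `|N i j| <= `|N|.
Proof.
rewrite [leRHS]/Num.Def.normr /= mx_normrE.
exact: (le_bigmax _ (fun ij : 'I_m * 'I_n => `|N ij.1 ij.2|) (i, j)).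
Qed.

Lemma bump_eq1 n (a : 'rV[R]_n) r x : 0 < r -> `|x - a| <= r -> bump a r x = 1.
Proof.
move=> r0 xa; rewrite /bump big1 // => i _; apply: bump1_eq1.
rewrite normrM normfV (gtr0_norm r0) ler_pdivrMr // mul1r; apply: le_trans xa.
by have := entry_le_norm (x - a) 0 i; rewrite !mxE.
Qed.

Lemma bump_eq0 n (a : 'rV[R]_n) r x : 0 < r -> 2 * r <= `|x - a| -> bump a r x = 0.
Proof.
move=> r0 xa.
have xa0 : mx_norm (x - a) != 0 by apply/lt0r_neq0/(lt_le_trans _ xa); rewrite mulr_gt0.
have [[i0 i] /= E] := mx_norm_neq0 xa0; rewrite !mxE ord1 in E.
rewrite /bump (bigD1 i) //= bump1_eq0 ?mul0r //.
by rewrite normrM normfV (gtr0_norm r0) ler_pdivlMr // -E.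
Qed.

Lemma smooth_bump (V : normedModType R) (A : set V) z n (a : 'rV[R]_n) r (f : V -> 'rV[R]_n) :
  A z -> smooth_at A z f -> smooth_at A z (fun x => bump a r (f x)).
Proof.
move=> Az sf; apply: smooth_at_prod => i; apply: smooth_bump1 => //.
apply: smooth_atM; last exact: smooth_at_cst.
by apply: smooth_atB; [exact: smooth_at_entry|exact: smooth_at_cst].
Qed.

End OneVariable.

(** * Symmetry of second derivatives *)

Section Schwarz.
Variables (R : realType) (V : normedModType R).

Lemma is_derive_line (W : normedModType R) (f : V -> W) (u y : V) (s : R) :
  differentiable f (s *: u + y) ->
  is_derive s 1 (fun s => f (s *: u + y)) ('D_u f (s *: u + y)).
Proof.
move=> df.
have E : (fun h => h^-1 *: (((fun s : R => f (s *: u + y)) \o shift s) (h *: (1 : R)) - f (s *: u + y))) =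
    (fun h => h^-1 *: ((f \o shift (s *: u + y)) (h *: u) - f (s *: u + y))).
  apply/funext => h /=; congr (_ *: (f _ - _)).
  by rewrite [h *: (1 : R)]mulr1 scalerDl addrA.
apply: DeriveDef; first by rewrite /derivable E; exact: diff_derivable df.
by rewrite /derive E.
Qed.

(** Two mean value theorems: one along [u] for the difference in the direction [v], then one along
    [v] for [g]. They express the second difference over a parallelogram by a single value of the
    mixed derivative. *)
Lemma mean_value_square (f g h : V -> R) (U : set V) x (u v : V) (t : R) : 0 < t ->
  (forall y, U y -> differentiable f y) -> (forall y, U y -> 'D_u f y = g y) ->
  (forall y, U y -> differentiable g y) -> (forall y, U y -> 'D_v g y = h y) ->
  (forall a b, 0 <= a <= t -> 0 <= b <= t -> U (a *: u + (b *: v + x))) ->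
  exists a b, [/\ 0 <= a <= t, 0 <= b <= t &
    f (t *: u + (t *: v + x)) - f (t *: u + x) - f (t *: v + x) + f x =
    h (a *: u + (b *: v + x)) * t * t].
Proof.
move=> t0 df fg dg gh Ut.
have t00 : 0 <= (0 : R) <= t by rewrite lexx ltW.
have U0 a : 0 <= a <= t -> U (a *: u + x).
  by move=> /Ut/(_ t00); rewrite scale0r add0r.
pose p s := f (s *: u + (t *: v + x)) - f (s *: u + x).
have tt : 0 <= t <= t by rewrite lexx ltW.
have dp s : 0 <= s <= t ->
    is_derive s 1 p (g (s *: u + (t *: v + x)) - g (s *: u + x)).
  move=> st; have U1 := Ut _ _ st tt; have U2 := U0 _ st.
  by rewrite -!fg //; apply: is_deriveB; apply: is_derive_line; exact: df.
have itvE s : s \in `]0, t[%R -> 0 <= s <= t.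
  by rewrite in_itv /= => /andP[a b]; rewrite !ltW.
have cp : {within `[0, t], continuous p}.
  apply: derivable_within_continuous => s; rewrite in_itv /= => st.
  by case: (dp s st).
have [a /itvE at_ Ea] := MVT t0 (fun s st => dp s (itvE s st)) cp.
pose q b := g (b *: v + (a *: u + x)).
have dq b : 0 <= b <= t -> is_derive b (1 : R) q (h (b *: v + (a *: u + x))).
  move=> bt; have U1 : U (b *: v + (a *: u + x)) by rewrite addrCA; exact: Ut.
  by rewrite -gh //; apply: is_derive_line; exact: dg.
have cq : {within `[0, t], continuous q}.
  apply: derivable_within_continuous => s; rewrite in_itv /= => st.
  by case: (dq s st).
have [b /itvE bt Eb] := MVT t0 (fun s st => dq s (itvE s st)) cq.
exists a, b; split=> //.
have Ep : f (t *: u + (t *: v + x)) - f (t *: u + x) - f (t *: v + x) + f x = p t - p 0.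
  by rewrite /p !scale0r !add0r; ring.
rewrite Ep Ea subr0; congr (_ * _).
move: Eb; rewrite /q subr0 scale0r add0r => Eb.
by rewrite (addrCA (a *: u) (t *: v)) Eb (addrCA (a *: u)).
Qed.

Lemma near_two (f g : V -> R) (U : set V) x e : open U -> U x -> 0 < e ->
  {for x, continuous f} -> {for x, continuous g} ->
  nbhs x [set y | [/\ U y, `|f x - f y| < e & `|g x - g y| < e]].
Proof.
move=> oU Ux e0 /cvgrPdist_lt/(_ _ e0) n1 /cvgrPdist_lt/(_ _ e0) n2.
by apply: filterS3 (open_nbhs_nbhs (conj oU Ux)) n1 n2 => y Uy H1 H2; split.
Qed.

Lemma square_quotient_eq (S1 S2 D1 D2 t : R) : 0 < t ->
  S1 = D1 * t * t -> S2 = D2 * t * t -> S1 = S2 -> D1 = D2.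
Proof.
move=> t0 -> -> H; have tn : t != 0 by rewrite gt_eqF.
exact: (mulIf tn (mulIf tn H)).
Qed.

Lemma close_pair (A B D1 D2 e : R) : `|A - D1| < e / 2 -> `|B - D2| < e / 2 ->
  D1 = D2 -> `|A - B| <= e.
Proof.
move=> L1 L2 E; rewrite -(subrK D1 A) -addrA; apply: le_trans (ler_normD _ _) _.
by rewrite [leRHS]splitr lerD ?ltW // E distrC.
Qed.

(** The second difference is symmetric in [u] and [v]. Hence the two mixed derivatives agree at two,
    possibly different, points of an arbitrarily small parallelogram, and continuity brings both to
    [x]. *)
Lemma mixed_derivatives_eq (f gu gv huv hvu : V -> R) (U : set V) x (u v : V) :
  open U -> U x -> (forall y, U y -> differentiable f y) ->
  (forall y, U y -> 'D_u f y = gu y) -> (forall y, U y -> differentiable gu y) ->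
  (forall y, U y -> 'D_v gu y = huv y) ->
  (forall y, U y -> 'D_v f y = gv y) -> (forall y, U y -> differentiable gv y) ->
  (forall y, U y -> 'D_u gv y = hvu y) ->
  {for x, continuous huv} -> {for x, continuous hvu} -> huv x = hvu x.
Proof.
move=> oU Ux df fgu dgu guh fgv dgv gvh c1 c2.
apply/eqP; rewrite -subr_eq0 -normr_le0; apply/ler_addgt0Pr => e e0; rewrite add0r.
have e2 : 0 < e / 2 by rewrite divr_gt0.
have nx := near_two oU Ux e2 c1 c2.
have /nbhs_ballP[r /= r0 Hr] := nx.
(* The side [t] keeps the parallelogram inside the ball of radius [r]; the summand 1 makes [s]
   positive and the inclusion strict. *)
pose s := `|u| + `|v| + 1; have s0 : 0 < s by rewrite ltr_wpDl // addr_ge0.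
pose t := r / s; have t0 : 0 < t by rewrite divr_gt0.
have Ht a b : 0 <= a <= t -> 0 <= b <= t -> ball x r (a *: u + (b *: v + x)).
  move=> /andP[a0 at_] /andP[b0 bt]; rewrite -ball_normE /= addrA opprD addrCA subrr addr0 normrN.
  apply: le_lt_trans (ler_normD _ _) _; rewrite !normrZ !ger0_norm //.
  apply: (@le_lt_trans _ _ (t * (`|u| + `|v|))).
    by rewrite mulrDr lerD // ler_wpM2r.
  by rewrite /t mulrAC -mulrA gtr_pMr // ltr_pdivrMr // mul1r ltrDl.
have Ut a b : 0 <= a <= t -> 0 <= b <= t -> U (a *: u + (b *: v + x)).
  by move=> Ha Hb; have [] := Hr _ (Ht _ _ Ha Hb).
have Ut' b a : 0 <= b <= t -> 0 <= a <= t -> U (b *: v + (a *: u + x)).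
  by move=> Hb Ha; rewrite addrCA; exact: Ut.
have [a [b [Ha Hb E1]]] := mean_value_square t0 df fgu dgu guh Ut.
have [b' [a' [Hb' Ha' E2]]] := mean_value_square t0 df fgv dgv gvh Ut'.
have [_ L1 _] := Hr _ (Ht _ _ Ha Hb).
have [_ _ L2] := Hr _ (Ht _ _ Ha' Hb').
rewrite (addrCA (b' *: v)) in E2.
apply: (close_pair L1 L2 (square_quotient_eq t0 E1 E2 _)).
by rewrite (addrCA (t *: u)); ring.
Qed.

Lemma Schwarz_scalar (f : V -> R) (U : set V) x (u v : V) :
  open U -> U x -> Ck 2 U f -> 'D_v ('D_u f) x = 'D_u ('D_v f) x.
Proof.
move=> oU Ux [df Df]; have [d1 D1] := Df u; have [d2 D2] := Df v.
exact: (mixed_derivatives_eq oU Ux df (fun _ _ => erefl) d1 (fun _ _ => erefl)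
  (fun _ _ => erefl) d2 (fun _ _ => erefl) (D1 v x Ux) (D2 u x Ux)).
Qed.

Lemma derivable_entry m n (f : V -> 'M[R]_(m, n)) x v i j :
  derivable f x v -> ('D_v f x) i j = 'D_v (fun y => f y i j) x.
Proof. by move=> df; rewrite derive_mx // mxE. Qed.

Lemma Schwarz m n (f : V -> 'M[R]_(m, n)) (U : set V) x (u v : V) :
  open U -> U x -> Ck 2 U f -> 'D_v ('D_u f) x = 'D_u ('D_v f) x.
Proof.
move=> oU Ux Cf; apply/matrixP => i j.
have [df Df] := Cf; have d1 w y : U y -> derivable f y w.
  by move=> Uy; apply: diff_derivable; exact: df.
have d2 w w' y : U y -> derivable ('D_w f) y w'.
  by move=> Uy; apply: diff_derivable; have [H _] := Df w; exact: H.
apply: (etrans (derivable_entry i j (d2 u v x Ux))); apply: esym.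
apply: (etrans (derivable_entry i j (d2 v u x Ux))); apply: esym.
have E w w' : 'D_w' (fun y => 'D_w f y i j) x = 'D_w' ('D_w (fun y => f y i j)) x.
  apply: near_eq_derive; near=> y; apply: derivable_entry; apply: d1.
  near: y; exact: (open_nbhs_nbhs (conj oU Ux)).
apply: (etrans (E u v)); apply: esym; apply: (etrans (E v u)); apply: esym.
apply: (@Schwarz_scalar _ U) => //.
exact: Ck_linear_comp oU (@mxcoord_cont R m n (i, j)) Cf.
Unshelve. all: by end_near. Qed.

End Schwarz.

(** * Projectors and the algebra of the corrugation *)

(* Locked, like several definitions below: unfolding it makes failing
   unifications expensive. *)
HB.lock Definition pr (R : realType) k n (A : 'M[R]_(k, n)) : 'M[R]_n :=
  A^T *m invmx (A *m A^T) *m A.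

Section Projectors.
Variable R : realType.

Lemma rV_norm2_eq0 n (u : 'rV[R]_n) : u *m u^T = 0 -> u = 0.
Proof.
move=> /matrixP/(_ 0 0); rewrite !mxE => H.
have {}H : \sum_j u 0 j ^+ 2 = 0.
  by rewrite -[RHS]H; apply: eq_bigr => j _; rewrite mxE expr2.
apply/rowP => j; rewrite mxE; apply/eqP; rewrite -sqrf_eq0; apply/eqP.
by apply: (psumr_eq0P _ H) => // i _; exact: sqr_ge0.
Qed.

(** If u A A^T = 0 then u A has zero Euclidean norm. Rank conditions thereby become the nonvanishing
    of a determinant, which is an open condition on smoothly varying matrices. *)
Lemma gram_unit k n (A : 'M[R]_(k, n)) : (A *m A^T \in unitmx) = row_free A.
Proof.
apply/idP/idP => [U|/row_freeP[X AX]].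
  by apply/row_freeP; exists (A^T *m invmx (A *m A^T)); rewrite mulmxA mulmxV.
rewrite -row_free_unit -kermx_eq0; apply/eqP/row_matrixP => i.
rewrite row0; set u := row i _.
have uA : u *m (A *m A^T) = 0.
  by apply/sub_kermxP; exact: row_sub.
have : u *m A = 0.
  by apply: rV_norm2_eq0; rewrite trmx_mul mulmxA -(mulmxA u) uA mul0mx.
by move=> /(congr1 (mulmx^~ X)); rewrite -mulmxA AX mulmx1 mul0mx.
Qed.

Lemma row_full_gram k n (A : 'M[R]_(k, n)) : row_full A = (A^T *m A \in unitmx).
Proof.
have -> : row_full A = row_free A^T by rewrite /row_full /row_free mxrank_tr.
by rewrite -gram_unit trmxK.
Qed.

Lemma mul_pr k n (A : 'M[R]_(k, n)) : row_free A -> A *m pr A = A.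
Proof. by rewrite -gram_unit => U; rewrite pr.unlock !mulmxA mulmxV // mul1mx. Qed.

Lemma pr_eqmx k n (A : 'M[R]_(k, n)) : row_free A -> (pr A :=: A)%MS.
Proof.
move=> fA; apply/eqmxP; apply/andP; split; first by rewrite pr.unlock submxMl.
by rewrite -{1}(mul_pr fA) submxMl.
Qed.

(** Replaces the projector of the definitions by A^T (A A^T)^-1 A, which is visibly smooth in the
    frame and does not depend on the choice of a frame. *)
Lemma orthoprojE n k (X : 'M[R]_n) (A : 'M[R]_(k, n)) :
  (X :=: A)%MS -> row_free A -> orthoproj X = pr A.
Proof.
move=> XA fA.
have cap0 : (X :&: kermx X^T = 0)%MS.
  apply/eqP; rewrite -submx0; apply/rV_subP => u; rewrite sub_capmx => /andP[uX].
  move=> /sub_kermxP uXt; have /submxP[D uD] := uX.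
  have -> : u = 0; last exact: sub0mx.
  by apply: rV_norm2_eq0; rewrite {2}uD trmx_mul mulmxA uXt mul0mx.
(* Decompose 1 as (1 - pr A) + pr A: the first summand lies in the orthogonal complement and is
   killed by the projection, the second lies in the plane and is fixed. *)
rewrite -[LHS]mul1mx -{1}(subrK (pr A) 1%:M) mulmxDl.
rewrite /orthoproj proj_mx_0 ?add0r //; last first.
  have /submxP[D ->] : (X <= A)%MS by rewrite XA.
  apply/sub_kermxP; rewrite trmx_mul mulmxA mulmxBl mul1mx -[X in X - _]mulmx1.
  have -> : pr A *m A^T = A^T.
    by rewrite pr.unlock -mulmxA mulmxKV // gram_unit.
  by rewrite mulmx1 subrr mul0mx.
by rewrite proj_mx_id // XA pr_eqmx.
Qed.

Lemma orthoproj_row_base n (X : 'M[R]_n) : orthoproj X = pr (row_base X).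
Proof. by apply: orthoprojE (row_base_free X); apply: eqmx_sym; exact: eq_row_base. Qed.

Lemma orthoproj_eqmx n (X : 'M[R]_n) : (orthoproj X :=: X)%MS.
Proof.
rewrite orthoproj_row_base; apply: eqmx_trans (eq_row_base X).
exact: pr_eqmx (row_base_free X).
Qed.

Lemma sub_orthoproj k n (u : 'M[R]_(k, n)) (X : 'M[R]_n) : (u <= X)%MS -> u *m orthoproj X = u.
Proof.
rewrite orthoproj_row_base -(eq_row_base X) => /submxP[D ->].
by rewrite -mulmxA mul_pr // row_base_free.
Qed.

Lemma orthoproj_idem n (X : 'M[R]_n) : orthoproj X *m orthoproj X = orthoproj X.
Proof. by apply: sub_orthoproj; rewrite orthoproj_eqmx. Qed.

Lemma pr_sym k n (A : 'M[R]_(k, n)) : (pr A)^T = pr A.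
Proof. by rewrite pr.unlock !trmx_mul trmxK mulmxA trmx_inv trmx_mul trmxK. Qed.

Lemma orthoproj_sym n (X : 'M[R]_n) : (orthoproj X)^T = orthoproj X.
Proof. by rewrite orthoproj_row_base pr_sym. Qed.

Lemma smooth_at_pr (V : normedModType R) k n (D : set V) z (F : V -> 'M[R]_(k, n)) :
  D z -> row_free (F z) -> smooth_at D z F -> smooth_at D z (fun x => pr (F x)).
Proof.
move=> Dz fF sF.
have -> : (fun x => pr (F x)) = (fun x => (F x)^T *m invmx (F x *m (F x)^T) *m F x).
  by rewrite pr.unlock.
apply: smooth_at_mulmx => //; apply: smooth_at_mulmx.
  exact: smooth_at_trmx.
apply: smooth_at_invmx => //; first by rewrite gram_unit.
by apply: smooth_at_mulmx => //; exact: smooth_at_trmx.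
Qed.

Lemma row_free_near k n (A : 'M[R]_(k, n)) : row_free A -> \forall B \near A, row_free B.
Proof.
rewrite -gram_unit unitmxE unitfE => dA.
have s : smooth_at [set: 'M[R]_(k, n)] A (fun B => \det (B *m B^T)).
  apply: smooth_at_det; apply: smooth_at_mulmx; first exact: smooth_at_id.
  by apply: smooth_at_trmx; exact: smooth_at_id.
have := smooth_at_nearP I s (open_nbhs_nbhs (conj (@open_neq _ 0) dA)).
by apply: filterS => B /(_ I) /= dB; rewrite -gram_unit unitmxE unitfE.
Qed.

End Projectors.

(** * Cross products and uniform bounds for the corrugation matrix *)

Section Cross.
Variable R : realType.

Definition i30 : 'I_3 := @Ordinal 3 0 isT.
Definition i31 : 'I_3 := @Ordinal 3 1 isT.
Definition i32 : 'I_3 := @Ordinal 3 2 isT.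

Definition mx3 (a b c d e f g h i : R) : 'M[R]_3 := \matrix_(r, s)
  match nat_of_ord r, nat_of_ord s with
  | 0, 0 => a | 0, 1 => b | 0, _ => c
  | 1, 0 => d | 1, 1 => e | 1, _ => f
  | _, 0 => g | _, 1 => h | _, _ => i end.

Definition cross (l : 'cV[R]_3) : 'M[R]_3 :=
  let x := l i30 0 in let y := l i31 0 in let z := l i32 0 in
  mx3 0 (- z) y z 0 (- x) (- y) x 0.

Lemma ord3P (P : 'I_3 -> Prop) : P i30 -> P i31 -> P i32 -> forall i, P i.
Proof.
move=> P0 P1 P2 [[|[|[|//]]] H].
- by rewrite (_ : Ordinal H = i30) //; exact: val_inj.
- by rewrite (_ : Ordinal H = i31) //; exact: val_inj.
- by rewrite (_ : Ordinal H = i32) //; exact: val_inj.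
Qed.

Lemma sum3 (V : nmodType) (F : 'I_3 -> V) : \sum_i F i = F i30 + F i31 + F i32.
Proof.
rewrite !big_ord_recr big_ord0 /= add0r; congr (F _ + F _ + F _); exact: val_inj.
Qed.

Definition sqnorm (l : 'cV[R]_3) : R := l i30 0 ^+ 2 + l i31 0 ^+ 2 + l i32 0 ^+ 2.

Lemma sqnorm_ge0 l : 0 <= sqnorm l.
Proof. by rewrite !addr_ge0 // sqr_ge0. Qed.

(* With u = cos t, the derivative of the corrugation is 2 u^2 - 1 = cos (2 t)
   times cross l plus 2 u. *)
Definition corr (l : 'cV[R]_3) (u : R) : 'M[R]_3 := (2 * u ^+ 2 - 1) *: cross l + (2 * u)%:M.

(** The determinant of 1 + s [l]_x (corr l u). Since [l]_x has the eigenvalues 0 and plus or minus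
    i|l|, it is the squared modulus of the complex number 1 - s (2 u^2 - 1) |l|^2 + 2 i s u |l|. *)
Definition Delta (l : 'cV[R]_3) (u s : R) : R :=
  (1 - s * (2 * u ^+ 2 - 1) * sqnorm l) ^+ 2 + 4 * s ^+ 2 * u ^+ 2 * sqnorm l.

(** The two summands cannot vanish together: for s |l| nonzero the second vanishes only at u = 0,
    where the first is (1 + s |l|^2)^2; for s |l| = 0 the first is 1. *)
Lemma Delta_gt0 l u s : 0 <= s -> 0 < Delta l u s.
Proof.
move=> s0; have L0 := sqnorm_ge0 l; rewrite /Delta; set L := sqnorm l in L0 *.
have B0 : 0 <= 4 * s ^+ 2 * u ^+ 2 * L by rewrite mulr_ge0 // mulr_ge0 ?sqr_ge0 // mulr_ge0 ?sqr_ge0.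
have [x0|x0] := eqVneq (1 - s * (2 * u ^+ 2 - 1) * L) 0; last first.
  by rewrite ltr_pwDl // exprn_even_gt0.
have sn : 0 < s.
  rewrite lt_neqAle s0 andbT; apply/eqP => E; move: x0.
  by rewrite -E !mul0r subr0 => /eqP; rewrite oner_eq0.
have Ln : 0 < L.
  rewrite lt_neqAle L0 andbT; apply/eqP => E; move: x0.
  by rewrite -E mulr0 subr0 => /eqP; rewrite oner_eq0.
have un : u != 0.
  apply/eqP => E; move: x0; rewrite E expr0n mulr0 sub0r mulrN1 mulNr opprK => H.
  by have : 0 < 1 + s * L; [rewrite ltr_wpDr // mulr_ge0|rewrite H ltxx].
rewrite ltr_wpDl ?sqr_ge0 // mulr_gt0 // mulr_gt0 ?exprn_even_gt0 //.
by rewrite mulr_gt0 // exprn_gt0.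
Qed.

Lemma Delta_bound l u s : 2 <= s -> 2 * s * sqnorm l <= Delta l u s.
Proof.
move=> s2; have L0 := sqnorm_ge0 l; rewrite /Delta; set L := sqnorm l in L0 *.
have t0 := sqr_ge0 u; set t := u ^+ 2 in t0 *.
have s0 : 0 <= s by rewrite (le_trans _ s2).
have m0 : 0 <= s * L by rewrite mulr_ge0.
(* For u^2 at most 1/4 one has 1 - 2 u^2 >= 1/2, so the first square is at least (1 + sL/2)^2 >=
   2sL. Beyond 1/4 the second summand is at least s^2 L, which is where s >= 2 enters. *)
have [t1|t1] := leP t (4^-1).
  have : 0 <= s ^+ 2 * t * L by rewrite mulr_ge0 // mulr_ge0 // sqr_ge0.
  have H : 1 + s * L / 2 <= 1 - s * (2 * t - 1) * L by nra.
  have := sqr_ge0 (1 - s * L / 2).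
  have : (1 + s * L / 2) ^+ 2 <= (1 - s * (2 * t - 1) * L) ^+ 2.
    by rewrite ler_sqr ?nnegrE //; lra.
  nra.
have := sqr_ge0 (1 - s * (2 * t - 1) * L).
have : 2 * s * L <= s ^+ 2 * L by rewrite expr2 ler_wpM2r // ler_wpM2r.
have : s ^+ 2 * L <= 4 * s ^+ 2 * t * L.
  by rewrite ler_wpM2r // mulrAC ler_peMl ?sqr_ge0 //; lra.
lra.
Qed.

(** [Delta] times the inverse: a polynomial in X = [cross l], computed modulo the relation X^3 = -
    |l|^2 X. *)
Definition corr_inv (l : 'cV[R]_3) (u s : R) : 'M[R]_3 :=
  let a := 1 - s * (2 * u ^+ 2 - 1) * sqnorm l in
  (Delta l u s)%:M - (2 * s * u) *: cross l
    + (4 * s ^+ 2 * u ^+ 2 - a * s * (2 * u ^+ 2 - 1)) *: (cross l *m cross l).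

Lemma corr_unitE l u s :
  (1%:M + s *: (cross l *m corr l u)) *m corr_inv l u s = (Delta l u s)%:M.
Proof.
apply/matrixP => i j; rewrite /corr_inv /corr /Delta /sqnorm.
rewrite !mxE !sum3 !mxE !sum3 !mxE.
by elim/ord3P: i; elim/ord3P: j; rewrite /= ?mulr1n ?mulr0n; ring.
Qed.

Lemma corr_unit l u s : 0 <= s -> 1%:M + s *: (cross l *m corr l u) \in unitmx.
Proof.
move=> s0; have D0 := Delta_gt0 l u s0.
have : (1%:M + s *: (cross l *m corr l u)) *m ((Delta l u s)^-1 *: corr_inv l u s) = 1%:M.
  by rewrite -scalemxAr corr_unitE scale_scalar_mx mulVf // gt_eqF.
by move=> /mulmx1_unit[].
Qed.

(* (1 + s cross l corr l u)^-1 cross l, which tends to 0 uniformly in l and u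
   as s tends to infinity. *)
Definition damp (l : 'cV[R]_3) (u s : R) : 'M[R]_3 :=
  (Delta l u s)^-1 *: (((1 - s * (2 * u ^+ 2 - 1) * sqnorm l)%:M
    - (2 * s * u) *: cross l) *m cross l).

Lemma dampE l u s : 0 <= s ->
  (1%:M + s *: (cross l *m corr l u)) *m damp l u s = cross l.
Proof.
move=> s0; have D0 : Delta l u s != 0 by rewrite gt_eqF // Delta_gt0.
rewrite /damp -scalemxAr; apply: (scalerI D0); rewrite scalerA divff // scale1r.
apply/matrixP => i j; rewrite /corr /Delta /sqnorm.
rewrite !mxE !sum3 !mxE !sum3 !mxE.
by elim/ord3P: i; elim/ord3P: j; rewrite /= ?mulr1n ?mulr0n; ring.
Qed.

(** With [a] and [b] as in the proof and L = |l|^2, [Delta] is a^2 + b^2 L. The squared entries of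
    [l]_x and of its square are at most L and L^2, so a squared entry of the numerator is at most 2
    L Delta. Then [Delta_bound] gives 2 L / Delta <= 1/s, without any lower bound on |l|. *)
Lemma damp_bound l u s i j : 2 <= s -> (damp l u s i j) ^+ 2 <= s^-1.
Proof.
move=> s2; have s0 : 0 <= s by rewrite (le_trans _ s2).
have sp : 0 < s by rewrite (lt_le_trans _ s2).
have D0 := Delta_gt0 l u s0; have DB := Delta_bound l u s2.
have L0 := sqnorm_ge0 l.
rewrite /damp; set a := 1 - _; set b := 2 * s * u.
have Da : Delta l u s = a ^+ 2 + b ^+ 2 * sqnorm l by rewrite /Delta /a /b; ring.
rewrite mxE.
have E : (((a%:M - b *: cross l) *m cross l) i j) ^+ 2 <= 2 * sqnorm l * Delta l u s.
  have -> : ((a%:M - b *: cross l) *m cross l) i j =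
      a * cross l i j - b * (cross l *m cross l) i j.
    by rewrite mulmxBl mul_scalar_mx -scalemxAl !mxE.
  have Hc : (cross l i j) ^+ 2 <= sqnorm l.
    rewrite /sqnorm; elim/ord3P: i; elim/ord3P: j; rewrite !mxE /= ?sqrrN ?expr0n /=;
      have := sqr_ge0 (l i30 0); have := sqr_ge0 (l i31 0);
      have := sqr_ge0 (l i32 0); lra.
  have Hcc : ((cross l *m cross l) i j) ^+ 2 <= (sqnorm l) ^+ 2.
    rewrite -ler_sqrt ?sqr_ge0 // !sqrtr_sqr (ger0_norm L0) ler_norml.
    rewrite /sqnorm; elim/ord3P: i {Hc}; elim/ord3P: j; rewrite !mxE !sum3 !mxE /=;
      set x := l i30 0; set y := l i31 0; set z := l i32 0;
      have := sqr_ge0 x; have := sqr_ge0 y; have := sqr_ge0 z;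
      have := sqr_ge0 (x + y); have := sqr_ge0 (x - y);
      have := sqr_ge0 (z + y); have := sqr_ge0 (z - y);
      have := sqr_ge0 (x + z); have := sqr_ge0 (x - z);
      move=> *; apply/andP; split; nra.
  set c := cross l i j in Hc *; set d := (_ *m _) i j in Hcc *.
  rewrite Da; set L := sqnorm l in Hc Hcc L0 *.
  apply: (@le_trans _ _ (2 * (a ^+ 2 * c ^+ 2 + b ^+ 2 * d ^+ 2))).
    by have := sqr_ge0 (a * c + b * d); nra.
  rewrite -mulrA ler_pM2l // mulrDr lerD //.
    by rewrite mulrC ler_wpM2r ?sqr_ge0.
  by apply: (le_trans (ler_wpM2l (sqr_ge0 b) Hcc)); rewrite expr2 mulrCA.
rewrite exprMn.
apply: le_trans (ler_wpM2l _ E) _; first by rewrite sqr_ge0.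
set D := Delta l u s in D0 DB *; have Dn : D != 0 by rewrite gt_eqF.
have -> : D^-1 ^+ 2 * (2 * sqnorm l * D) = 2 * sqnorm l / D by field.
rewrite ler_pdivrMr // ler_pdivlMl //; lra.
Qed.

Variable n : nat.

(* Rows: the brackets [a_1, a_2], [a_2, a_0], [a_0, a_1] of the frame fields
   whose value is A and whose i-th partial derivative is B i. *)
Definition brackets (A : 'M[R]_(3, n)) (B : 'I_n -> 'M[R]_(3, n)) : 'M[R]_(3, n) :=
  \sum_i cross (col i A) *m B i.

Definition step2_frame (A : 'M[R]_(3, n)) (B : 'I_n -> 'M[R]_(3, n)) : bool :=
  row_full (col_mx A (brackets A B)).

Lemma row_full_corr (A V : 'M[R]_(3, n)) (G : 'M[R]_3) : G \in unitmx ->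
  row_full (col_mx A (G *m V)) = row_full (col_mx A V).
Proof.
move=> GU; have -> : col_mx A (G *m V) = block_mx 1%:M 0 0 G *m col_mx A V.
  by rewrite mul_block_col !mul1mx !mul0mx addr0 add0r.
rewrite /row_full eqmxMfull // -col_leq_rank.
have : (block_mx 1%:M 0 0 G : 'M[R]_(3 + 3)) \in unitmx.
  by rewrite unitmxE det_ublock det1 mul1r.
by rewrite -row_full_unit /row_full => /eqP ->.
Qed.

End Cross.

Local Opaque derive jacobian diff.

(** * Charts and frames *)

Section FirstOrder.
Variable R : realType.

Lemma derive_compE (V W Z : normedModType R) (f : V -> W) (g : W -> Z) x v :
  differentiable f x -> differentiable g (f x) ->
  'D_v (g \o f) x = 'D_('D_v f x) g (f x).
Proof.
move=> df dg; rewrite deriveE; last exact: differentiable_comp.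
by rewrite diff_comp //= (deriveE _ df) (deriveE _ dg).
Qed.

Lemma derive_mulmx (V : normedModType R) m n p (F : V -> 'M[R]_(m, n))
    (G : V -> 'M[R]_(n, p)) x v : derivable F x v -> derivable G x v ->
  'D_v (fun y => F y *m G y) x = 'D_v F x *m G x + F x *m 'D_v G x.
Proof.
move=> dF dG.
have dF' i j := (derivable_mxP F x v).1 dF i j.
have dG' i j := (derivable_mxP G x v).1 dG i j.
have E : is_derive x v (fun y => F y *m G y) ('D_v F x *m G x + F x *m 'D_v G x).
  have H i j : is_derive x v (fun y => (F y *m G y) i j)
      (('D_v F x *m G x + F x *m 'D_v G x) i j).
    have -> : (fun y => (F y *m G y) i j) = \sum_k ((fun y => F y i k) * (fun y => G y k j)).
      by apply/funext => y; rewrite mxE fct_sumE.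
    rewrite !mxE -big_split /=.
    apply: is_derive_sum => k.
    have := is_deriveM (derivableP (dF' i k)) (derivableP (dG' k j)).
    move/is_derive_eq; apply; rewrite addrC /GRing.scale /=.
    by rewrite (derivable_entry i k dF) (derivable_entry k j dG) [X in _ + X]mulrC.
  have dm : derivable (fun y => F y *m G y) x v.
    by apply/derivable_mxP => i j; case: (H i j).
  apply: DeriveDef => //; apply/matrixP => i j.
  by rewrite (derivable_entry _ _ dm); case: (H i j).
by case: E.
Qed.

Lemma derive_mulmxl (V : normedModType R) m n p (S : 'M[R]_(m, n))
    (G : V -> 'M[R]_(n, p)) x v : derivable G x v ->
  'D_v (fun y => S *m G y) x = S *m 'D_v G x.
Proof.
move=> dG; rewrite derive_mulmx //.
by rewrite derive_cst mul0mx add0r.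
Qed.

Lemma smooth_at_derivable (V W : normedModType R) (f : V -> W) x v :
  smooth_at setT x f -> derivable f x v.
Proof.
by move=> sf; apply/diff_derivable; apply: (@smooth_at_differentiable _ _ _ setT) => //; exact: filterT.
Qed.

Lemma smooth_at_diff (V W : normedModType R) (f : V -> W) x :
  smooth_at setT x f -> differentiable f x.
Proof. by apply: smooth_at_differentiable; exact: filterT. Qed.

Lemma derive_rV n (W : normedModType R) (f : 'rV[R]_n -> W) x v : differentiable f x ->
  'D_v f x = \sum_i v 0 i *: 'D_(delta_mx 0 i) f x.
Proof.
move=> df; rewrite deriveE // [in LHS](row_sum_delta v) linear_sum.
by apply: eq_bigr => i _; rewrite linearZ /= -deriveE.
Qed.

Lemma row_jacobian m n (f : 'rV[R]_m -> 'rV[R]_n) x i : differentiable f x ->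
  row i ('J f x) = 'D_(delta_mx 0 i) f x.
Proof. by move=> df; rewrite (deriveEjacobian _ df) -rowE. Qed.

Lemma nbhs_setT_sub (T : topologicalType) (x : T) (A B : set T) :
  nbhs x A -> \forall y \near x, B y -> A y.
Proof. by apply: filterS => y Ay _. Qed.

End FirstOrder.

Definition trans (R : realType) (n : nat) (M : @manifold R n setT)
  (c d : chart R n M) : 'rV[R]_n -> 'rV[R]_n := cfun d \o cinv c.

HB.lock Definition tjac (R : realType) (n : nat) (M : @manifold R n setT)
  (c d : chart R n M) (x : 'rV[R]_n) : 'M[R]_n := 'J (trans c d) x.

HB.lock Definition tco (R : realType) (n : nat) (M : @manifold R n setT)
  (c : chart R n M) (p : M) : 'M[R]_n := tcoord c p.

HB.lock Definition gr (R : realType) (n : nat) (M : @manifold R n setT)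
  (xi : plane_field M) (c : chart R n M) (x : 'rV[R]_n) : 'M[R]_n := grcoord xi c x.

Section ChartsWithin.
Variables (R : realType) (n : nat) (H : set 'rV[R]_n) (M : manifold H).
Implicit Types (c d : chart R n M) (p q : M).

Lemma cfunK c p : atlas c -> cdom c p -> cinv c (cfun c p) = p.
Proof. by move=> ac cp; apply: (chart_cancel ac); rewrite inE. Qed.

Lemma cinvK c x : atlas c -> cimg c x -> cfun c (cinv c x) = x.
Proof. by move=> ac [p cp <-]; rewrite cfunK. Qed.

Lemma cinv_dom c x : atlas c -> cimg c x -> cdom c (cinv c x).
Proof. by move=> ac [p cp <-]; rewrite cfunK. Qed.

Lemma cimg_cfun c p : cdom c p -> cimg c (cfun c p).
Proof. by move=> cp; exists p. Qed.

Lemma cdom_nbhs c p : atlas c -> cdom c p -> nbhs p (cdom c).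
Proof. by move=> ac cp; apply: open_nbhs_nbhs; split=> //; exact: chart_open. Qed.

Lemma cfun_cvg c p : atlas c -> cdom c p -> cfun c q @[q --> p] --> cfun c p.
Proof.
move=> ac cp; have := chart_continuous ac.
by rewrite continuous_open_subspace; [apply; rewrite inE|exact: chart_open].
Qed.

Lemma near_cinv_within c p (P : set M) : atlas c -> cdom c p -> nbhs p P ->
  \forall x \near cfun c p, cimg c x -> P (cinv c x).
Proof.
move=> ac cp Pp.
have L : cinv c x @[x --> within (cimg c) (nbhs (cfun c p))] --> cinv c (cfun c p).
  move/subspace_continuousP : (chart_inv_continuous ac) => /(_ _ (cimg_cfun cp)) L.
  exact: L.
by rewrite cfunK // in L; exact: L Pp.
Qed.

Lemma trans_smooth_within c d p : atlas c -> atlas d -> cdom c p -> cdom d p ->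
  smooth_at (cimg c) (cfun c p) (cfun d \o cinv c).
Proof.
move=> ac ad cp dp.
have S : smooth_at (cfun c @` (cdom c `&` cdom d)) (cfun c p) (cfun d \o cinv c).
  by apply: (chart_smooth ac ad); exists p.
apply: smooth_at_sub S; apply: filterS (near_cinv_within ac cp (cdom_nbhs ad dp)) => x Hx cx.
by exists (cinv c x); [split; [exact: cinv_dom|exact: Hx]|exact: cinvK].
Qed.

End ChartsWithin.

Section Charts.
Variables (R : realType) (n : nat) (M : @manifold R n setT).
Implicit Types (c d e : chart R n M) (p q : M).
Local Notation rV := 'rV[R]_n.

Lemma cimg_open c : atlas c -> open (cimg c).
Proof. by move=> /chart_img[Q oQ ->]; rewrite setIT. Qed.

Lemma cimg_nbhs c x : atlas c -> cimg c x -> nbhs x (cimg c).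
Proof. by move=> ac cx; apply: open_nbhs_nbhs; split=> //; exact: cimg_open. Qed.

Lemma cinv_cvg c x : atlas c -> cimg c x -> cinv c y @[y --> x] --> cinv c x.
Proof.
move=> ac cx; have := chart_inv_continuous ac.
by rewrite continuous_open_subspace; [apply; rewrite inE|exact: cimg_open].
Qed.

Lemma near_cinv c p (P : set M) : atlas c -> cdom c p -> nbhs p P ->
  \forall x \near cfun c p, cimg c x /\ P (cinv c x).
Proof.
move=> ac cp Pp; apply: filterI; first by apply: cimg_nbhs => //; exact: cimg_cfun.
by apply: (cinv_cvg ac (cimg_cfun cp)); rewrite cfunK.
Qed.

Lemma trans_cfun c d p : atlas c -> cdom c p -> trans c d (cfun c p) = cfun d p.
Proof. by move=> ac cp; rewrite /trans /= cfunK. Qed.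

Lemma trans_smooth c d p : atlas c -> atlas d -> cdom c p -> cdom d p ->
  smooth_at setT (cfun c p) (trans c d).
Proof.
move=> ac ad cp dp; apply: smooth_at_sub (trans_smooth_within ac ad cp dp).
by apply: nbhs_setT_sub; apply: cimg_nbhs => //; exact: cimg_cfun.
Qed.

Lemma trans_near c d e p : atlas c -> atlas d -> cdom c p -> cdom d p ->
  \forall x \near cfun c p, trans d e (trans c d x) = trans c e x.
Proof.
move=> ac ad cp dp; have := near_cinv ac cp (cdom_nbhs ad dp).
by apply: filterS => x [cx dx]; rewrite /trans /= cfunK.
Qed.

Lemma jac_trans c d e p : atlas c -> atlas d -> atlas e ->
  cdom c p -> cdom d p -> cdom e p ->
  tjac c e (cfun c p) = tjac c d (cfun c p) *m tjac d e (cfun d p).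
Proof.
move=> ac ad ae cp dp ep; apply/row_matrixP => i; rewrite row_mul tjac.unlock.
have s1 := smooth_at_diff (trans_smooth ac ad cp dp).
have s2 := smooth_at_diff (trans_smooth ad ae dp ep).
have s3 := smooth_at_diff (trans_smooth ac ae cp ep).
apply: (etrans (row_jacobian i s3)).
apply: (etrans (esym (near_eq_derive _ (trans_near e ac ad cp dp)))).
have s2' : differentiable (trans d e) (trans c d (cfun c p)) by rewrite trans_cfun.
apply: (etrans (derive_compE _ s1 s2')).
apply: (etrans (deriveEjacobian _ s2')).
by rewrite -(row_jacobian i s1) trans_cfun.
Qed.

Lemma jac_trans_id c p : atlas c -> cdom c p -> tjac c c (cfun c p) = 1%:M.
Proof.
move=> ac cp; apply/row_matrixP => i; rewrite row1 tjac.unlock.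
rewrite (row_jacobian i (smooth_at_diff (trans_smooth ac ac cp cp))).
rewrite -(@near_eq_derive _ _ _ id) ?derive_id //.
have := cimg_nbhs ac (cimg_cfun cp).
by apply: filterS => x cx; rewrite /trans /= cinvK.
Qed.

Lemma jac_transK c d p : atlas c -> atlas d -> cdom c p -> cdom d p ->
  tjac c d (cfun c p) *m tjac d c (cfun d p) = 1%:M.
Proof. by move=> ac ad cp dp; rewrite -jac_trans // jac_trans_id. Qed.

Lemma tjac_unit c d p : atlas c -> atlas d -> cdom c p -> cdom d p ->
  tjac c d (cfun c p) \in unitmx.
Proof. by move=> ac ad cp dp; exact: (mulmx1_unit (jac_transK ac ad cp dp)).1. Qed.

Lemma tco_tjac c p : tco c p = tjac (chart_at p) c (cfun (chart_at p) p).
Proof. by rewrite tco.unlock tjac.unlock. Qed.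

Lemma tcoE c d p : atlas c -> atlas d -> cdom c p -> cdom d p ->
  tco d p = tco c p *m tjac c d (cfun c p).
Proof.
move=> ac ad cp dp; rewrite !tco_tjac.
by apply: jac_trans => //; [exact: chart_at_atlas|exact: chart_at_dom].
Qed.

Lemma tco_unit c p : atlas c -> cdom c p -> tco c p \in unitmx.
Proof.
move=> ac cp; rewrite tco_tjac; apply: tjac_unit => //.
  exact: chart_at_atlas.
exact: chart_at_dom.
Qed.

Lemma tco_chart_at p : tco (chart_at p) p = 1%:M.
Proof.
rewrite tco_tjac; apply: jac_trans_id; [exact: chart_at_atlas|exact: chart_at_dom].
Qed.

Lemma smooth_jac (f : rV -> rV) x : smooth_at setT x f ->
  smooth_at setT x (fun y => 'J f y).
Proof.
move=> sf; have df : \forall y \near x, differentiable f y.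
  by have := smooth_at_near sf; apply: filterS => y; exact: smooth_at_diff.
apply: (@smooth_at_ext _ _ _ _ _ (fun y => \matrix_(i, j) ('D_(delta_mx 0 i) f y) 0 j)).
  apply: filterS df => y dy _; apply/row_matrixP => i.
  by rewrite (row_jacobian i dy); apply/rowP => j; rewrite !mxE.
apply: smooth_at_mx => i j.
have s : smooth_at setT x (fun y => ('D_(delta_mx 0 i) f y) 0 j).
  apply: smooth_at_entry; apply: smooth_at_derive => //; exact: filterT.
by apply: smooth_at_ext s; near=> y; rewrite mxE.
Unshelve. all: by end_near. Qed.

Lemma tjac_smooth c d p : atlas c -> atlas d -> cdom c p -> cdom d p ->
  smooth_at setT (cfun c p) (tjac c d).
Proof.
move=> ac ad cp dp; have -> : tjac c d = (fun x => 'J (trans c d) x).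
  by rewrite tjac.unlock.
by apply: smooth_jac; exact: trans_smooth.
Qed.

Definition frame_near (xi : plane_field M) c p (a : rV -> 'M[R]_(3, n)) : Prop :=
  smooth_at setT (cfun c p) a /\
  \forall x \near cfun c p, row_free (a x) /\
    (a x :=: xi (cinv c x) *m tco c (cinv c x))%MS.

Lemma projector_frame (P : 'M[R]_n) k : \rank P = k -> P *m P = P ->
  exists S : 'M[R]_(k, n), row_free (S *m P).
Proof.
move=> <- PP; exists (row_base P).
have /submxP[D rb] : (row_base P <= P)%MS by rewrite eq_row_base.
by rewrite {1}rb -mulmxA PP -rb row_base_free.
Qed.

Lemma gr_eqmx xi c x :
  (gr xi c x :=: xi (cinv c x) *m tco c (cinv c x))%MS.
Proof. by rewrite gr.unlock tco.unlock; exact: orthoproj_eqmx. Qed.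

Lemma frame_gr xi c p a : frame_near xi c p a ->
  \forall x \near cfun c p, gr xi c x = pr (a x).
Proof.
move=> [sa]; apply: filterS => x [fa ax]; rewrite gr.unlock.
by apply: orthoprojE fa; rewrite tco.unlock in ax; exact: eqmx_sym.
Qed.

Lemma distribution_near_smooth p xi c : atlas c -> cdom c p ->
  distribution_near 3 p xi -> smooth_at setT (cfun c p) (gr xi c).
Proof.
move=> ac cp; rewrite gr.unlock => -[U [oU Up [rk sm]]].
have S : smooth_at (cfun c @` (cdom c `&` U)) (cfun c p) (grcoord xi c).
  by apply: sm => //; exists p.
apply: smooth_at_sub S; apply: nbhs_setT_sub.
have := near_cinv ac cp (open_nbhs_nbhs (conj oU Up)).
apply: filterS => x [cx Ux]; exists (cinv c x); last exact: cinvK.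
by split=> //; exact: cinv_dom.
Qed.

Lemma distribution_near_rank p xi c : atlas c -> cdom c p ->
  distribution_near 3 p xi -> \forall x \near cfun c p, \rank (gr xi c x) = 3%N.
Proof.
move=> ac cp [U [oU Up [rk sm]]].
have := near_cinv ac cp (open_nbhs_nbhs (conj oU Up)).
apply: filterS => x [cx Ux]; rewrite gr_eqmx mxrankMfree; first exact: rk.
by rewrite row_free_unit; apply: tco_unit => //; exact: cinv_dom.
Qed.

(** Projecting the rows of [T] to the planes gives vectors of the planes; independence at one point
    persists nearby, and equality of ranks upgrades the inclusion of row spaces to an equality. *)
Lemma frame_exists p xi c (T : rV -> 'M[R]_(3, n)) : atlas c -> cdom c p ->
  distribution_near 3 p xi -> smooth_at setT (cfun c p) T ->
  row_free (T (cfun c p) *m gr xi c (cfun c p)) ->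
  frame_near xi c p (fun x => T x *m gr xi c x).
Proof.
move=> ac cp dxi sT fS.
have sg := distribution_near_smooth ac cp dxi.
have sa : smooth_at setT (cfun c p) (fun x => T x *m gr xi c x) by apply: smooth_at_mulmx.
split=> //.
have fn := smooth_at_nearP I sa (row_free_near fS).
apply: filterS2 fn (distribution_near_rank ac cp dxi) => x /(_ I) fx rk.
split=> //; apply: eqmx_trans (gr_eqmx xi c x); apply/eqmxP.
rewrite -(geq_leqif (mxrank_leqif_eq (submxMl _ _))) rk.
by move: fx; rewrite /row_free => /eqP ->.
Qed.

Lemma frame_change_at (xi : plane_field M) c d q x (A : 'M[R]_(3, n)) : atlas c -> atlas d ->
  cdom c q -> cdom d q -> x = cfun c q ->
  row_free A /\ (A :=: xi (cinv c x) *m tco c (cinv c x))%MS ->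
  row_free (A *m tjac c d x) /\ (A *m tjac c d x :=: xi q *m tco d q)%MS.
Proof.
move=> ac ad cq dq ->; rewrite (cfunK ac cq) => -[fA AE].
split; first by rewrite /row_free mxrankMfree // row_free_unit tjac_unit.
by rewrite (tcoE ac ad cq dq) mulmxA; exact: eqmxMr.
Qed.

Lemma frame_change xi c d p a : atlas c -> atlas d -> cdom c p -> cdom d p ->
  frame_near xi c p a ->
  frame_near xi d p (fun y => a (trans d c y) *m tjac c d (trans d c y)).
Proof.
move=> ac ad cp dp [sa na].
have st := trans_smooth ad ac dp cp.
have tE := trans_cfun c ad dp.
have cvt : trans d c y @[y --> cfun d p] --> cfun c p.
  rewrite -tE; apply: differentiable_continuous; exact: smooth_at_diff.
split.
  apply: smooth_at_mulmx.
    apply: (@smooth_at_comp _ _ _ _ (fdmx R 1 n) (fdmx R 3 n) setT setT) => //.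
      by near=> y.
    by rewrite tE.
  apply: (@smooth_at_comp _ _ _ _ (fdmx R 1 n) (fdmx R n n) setT setT) => //.
    by near=> y.
  by rewrite tE; exact: tjac_smooth.
have nc := near_cinv ad dp (cdom_nbhs ac cp).
apply: filterS2 nc (cvt _ na) => y [dy cy] H.
exact: (frame_change_at ac ad cy (cinv_dom ad dy) _ H).
Unshelve. all: by end_near. Qed.

Lemma frame_near_nbhs xi c p a : atlas c -> cdom c p -> frame_near xi c p a ->
  \forall q \near p, cdom c q /\ frame_near xi c q a.
Proof.
move=> ac cp [sa na].
have H : \forall x \near cfun c p, nbhs x [set y | smooth_at setT y a /\ (row_free (a y) /\
    (a y :=: xi (cinv c y) *m tco c (cinv c y))%MS)].
  by apply: nbhs_interior; apply: filterS2 (smooth_at_near sa) na => y; split.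
have := cfun_cvg ac cp H; rewrite nbhs_simpl /= => H'.
apply: filterS2 (cdom_nbhs ac cp) H' => q cq Hq; split=> //.
split; first by have [] := nbhs_singleton Hq.
by apply: filterS Hq => x [].
Qed.

Lemma frame_smooth_grcoord xi c p a : frame_near xi c p a ->
  smooth_at setT (cfun c p) (gr xi c).
Proof.
move=> fa; apply: (@smooth_at_ext _ _ _ _ _ (fun x => pr (a x))).
  by apply: filterS (frame_gr fa) => x ->.
by apply: smooth_at_pr => //; have [sa /nbhs_singleton[]] := fa.
Qed.

Lemma frame_distribution xi c p a : atlas c -> cdom c p -> frame_near xi c p a ->
  distribution_near 3 p xi.
Proof.
move=> ac cp fa; have [U [oU Up HU]] := nbhs_exists_open (frame_near_nbhs ac cp fa).
exists U; split=> //; split=> [q /HU[cq [_ /nbhs_singleton[fq]]]|d ad x [q [dq /HU[cq fq]] <-]].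
  rewrite cfunK // => aE; have <- : \rank (a (cfun c q)) = 3%N by apply/eqP.
  by rewrite aE mxrankMfree // row_free_unit tco_unit.
have s := frame_smooth_grcoord (frame_change ac ad cq dq fq).
by rewrite gr.unlock in s; apply: smooth_at_sub s; exact: filterE.
Qed.

End Charts.

HB.lock Definition pd (R : realType) n (W : normedModType R) (f : 'rV[R]_n -> W)
  (i : 'I_n) (x : 'rV[R]_n) : W := 'D_(delta_mx 0 i) f x.

HB.lock Definition dpr (R : realType) k n (A B : 'M[R]_(k, n)) : 'M[R]_n :=
  'D_B (@pr R k n) A.

Section Partial.
Variables (R : realType) (n : nat).
Implicit Types W : normedModType R.

Lemma pd_near W (f g : 'rV[R]_n -> W) i x : (\forall y \near x, f y = g y) ->
  pd f i x = pd g i x.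
Proof. by move=> fg; rewrite !pd.unlock; exact: near_eq_derive. Qed.

Lemma smooth_at_pd W (f : 'rV[R]_n -> W) i x : smooth_at setT x f ->
  smooth_at setT x (pd f i).
Proof.
move=> sf; have -> : pd f i = 'D_(delta_mx 0 i) f by rewrite pd.unlock.
by apply: smooth_at_derive => //; exact: filterT.
Qed.

Lemma derive_pd k W (f : 'rV[R]_k -> W) x v : differentiable f x ->
  'D_v f x = \sum_i v 0 i *: pd f i x.
Proof. by move=> df; rewrite (derive_rV v df) pd.unlock. Qed.

Lemma pd_mulmx m k p (F : 'rV[R]_n -> 'M[R]_(m, k)) (G : 'rV[R]_n -> 'M[R]_(k, p)) i x :
  smooth_at setT x F -> smooth_at setT x G ->
  pd (fun y => F y *m G y) i x = pd F i x *m G x + F x *m pd G i x.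
Proof.
by move=> sF sG; rewrite !pd.unlock; apply: derive_mulmx; exact: smooth_at_derivable.
Qed.

Lemma pd_mulmxl m k p (S : 'M[R]_(m, k)) (G : 'rV[R]_n -> 'M[R]_(k, p)) i x :
  smooth_at setT x G -> pd (fun y => S *m G y) i x = S *m pd G i x.
Proof.
by move=> sG; rewrite !pd.unlock; apply: derive_mulmxl; exact: smooth_at_derivable.
Qed.

Lemma pd_comp m W (f : 'rV[R]_n -> 'rV[R]_m) (g : 'rV[R]_m -> W) i x :
  smooth_at setT x f -> smooth_at setT (f x) g ->
  pd (fun y => g (f y)) i x = \sum_j (pd f i x) 0 j *: pd g j (f x).
Proof.
move=> /smooth_at_diff df /smooth_at_diff dg; rewrite -derive_pd // pd.unlock.
exact: derive_compE.
Qed.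

Lemma pd_sym m k (f : 'rV[R]_n -> 'M[R]_(m, k)) i j x : smooth_at setT x f ->
  pd (pd f i) j x = pd (pd f j) i x.
Proof.
move=> [U [h [oU Ux Ch fh]]].
have fhn y : U y -> \forall z \near y, f z = h z.
  by move=> Uy; apply: filterS (open_nbhs_nbhs (conj oU Uy)) => z; exact: fh.
have E a b : pd (pd f a) b x = pd (pd h a) b x.
  apply: pd_near; apply: filterS (open_nbhs_nbhs (conj oU Ux)) => y Uy.
  exact: pd_near (fhn y Uy).
rewrite !E pd.unlock; exact: (Schwarz _ _ oU Ux (Ch 2%N)).
Qed.

Lemma smooth_pr k (A : 'M[R]_(k, n)) : row_free A -> smooth_at setT A (@pr R k n).
Proof. by move=> fA; apply: smooth_at_pr => //; exact: smooth_at_id. Qed.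

Lemma pd_pr k (a : 'rV[R]_n -> 'M[R]_(k, n)) i x : row_free (a x) -> smooth_at setT x a ->
  pd (fun y => pr (a y)) i x = dpr (a x) (pd a i x).
Proof.
move=> fa sa; rewrite pd.unlock dpr.unlock; apply: derive_compE.
  exact: smooth_at_diff.
exact: smooth_at_diff (smooth_pr fa).
Qed.

Lemma smooth_at_dpr (V : normedModType R) k (D : set V) z (F G : V -> 'M[R]_(k, n)) :
  D z -> row_free (F z) -> smooth_at D z F -> smooth_at D z G ->
  smooth_at D z (fun y => dpr (F y) (G y)).
Proof.
move=> Dz fF sF sG.
have -> : (fun y => dpr (F y) (G y)) = (fun y => 'D_(G y) (@pr R k n) (F y)).
  by rewrite dpr.unlock.
apply: (@smooth_at_derive_along _ _ _ _ (fdmx R k n) (fdmx R n n) D setT) => //.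
- exact: filterT.
- by apply: filterE => y _; exact: filterT.
- exact: smooth_pr.
Qed.

End Partial.

(** * 1-jets, frames and curvature *)

Section Jets.
Variables (R : realType) (n : nat) (M : @manifold R n setT).
Implicit Types (c d : chart R n M) (p q : M) (xi eta : plane_field M).
Local Notation rV := 'rV[R]_n.

Lemma dgrcoordE xi c i x : dgrcoord xi c i x = pd (gr xi c) i x.
Proof. by rewrite /dgrcoord pd.unlock gr.unlock. Qed.

Lemma frame_gr_at xi c p a : frame_near xi c p a -> gr xi c (cfun c p) = pr (a (cfun c p)).
Proof. by move=> /frame_gr/nbhs_singleton. Qed.

Lemma frame_free xi c p a : frame_near xi c p a -> row_free (a (cfun c p)).
Proof. by move=> [_ /nbhs_singleton[]]. Qed.

Lemma frame_pd xi c p a i : frame_near xi c p a ->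
  pd (gr xi c) i (cfun c p) = dpr (a (cfun c p)) (pd a i (cfun c p)).
Proof.
move=> fa; rewrite (pd_near i (frame_gr fa)) pd_pr //; first exact: frame_free fa.
by case: fa.
Qed.

Lemma pd_trans c d p i : atlas c -> atlas d -> cdom c p -> cdom d p ->
  pd (trans c d) i (cfun c p) = row i (tjac c d (cfun c p)).
Proof.
move=> ac ad cp dp; rewrite pd.unlock tjac.unlock.
by rewrite (row_jacobian i (smooth_at_diff (trans_smooth ac ad cp dp))).
Qed.

Lemma frame_change_pd c d p (a : rV -> 'M[R]_(3, n)) i : atlas c -> atlas d -> cdom c p -> cdom d p ->
  smooth_at setT (cfun c p) a ->
  pd (fun y => a (trans d c y) *m tjac c d (trans d c y)) i (cfun d p) =
  \sum_j tjac d c (cfun d p) i j *: (pd a j (cfun c p) *m tjac c d (cfun c p) +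
     a (cfun c p) *m pd (tjac c d) j (cfun c p)).
Proof.
move=> ac ad cp dp sa.
have sJ := tjac_smooth ac ad cp dp.
have st := trans_smooth ad ac dp cp.
have tE := trans_cfun c ad dp.
have sm : smooth_at setT (cfun c p) (fun x => a x *m tjac c d x) by apply: smooth_at_mulmx.
have := @pd_comp R n n _ (trans d c) (fun x => a x *m tjac c d x) i (cfun d p) st.
rewrite tE => /(_ sm) ->; apply: eq_bigr => j _.
by rewrite pd_trans // mxE pd_mulmx.
Qed.

Definition same_jet xi eta c p : Prop :=
  gr xi c (cfun c p) = gr eta c (cfun c p) /\
  forall i, pd (gr xi c) i (cfun c p) = pd (gr eta c) i (cfun c p).

Lemma gr_idem xi c x : gr xi c x *m gr xi c x = gr xi c x.
Proof. by rewrite gr.unlock; exact: orthoproj_idem. Qed.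

Lemma gr_fix k (u : 'M[R]_(k, n)) xi c x : (u <= gr xi c x)%MS -> u *m gr xi c x = u.
Proof. by move=> /submxP[D ->]; rewrite -mulmxA gr_idem. Qed.

Lemma frame_pick xi c p : atlas c -> cdom c p -> distribution_near 3 p xi ->
  exists S : 'M[R]_(3, n), row_free (S *m gr xi c (cfun c p)).
Proof.
move=> ac cp dxi; apply: projector_frame; last exact: gr_idem.
exact: nbhs_singleton (distribution_near_rank ac cp dxi).
Qed.

(** One constant matrix is projected to both fields, so the frames inherit the agreement of the
    projectors. Changes of chart can then be computed on frames, where they are multiplication by a
    Jacobian; projectors have no such simple transformation law. *)
Lemma same_jet_frames xi eta c p : atlas c -> cdom c p ->
  distribution_near 3 p xi -> distribution_near 3 p eta -> same_jet xi eta c p ->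
  exists a a', [/\ frame_near xi c p a, frame_near eta c p a',
    a (cfun c p) = a' (cfun c p) & forall i, pd a i (cfun c p) = pd a' i (cfun c p)].
Proof.
move=> ac cp dxi deta [E0 E1]; have [S fS] := frame_pick ac cp dxi.
exists (fun x => S *m gr xi c x), (fun x => S *m gr eta c x); split.
- by apply: (frame_exists (T := fun=> S)) => //; exact: smooth_at_cst.
- by apply: (frame_exists (T := fun=> S)) => //; [exact: smooth_at_cst|rewrite -E0].
- by rewrite E0.
- by move=> i; rewrite !pd_mulmxl ?E1 //; exact: distribution_near_smooth.
Qed.

Lemma same_jet_change xi eta c d p : atlas c -> atlas d -> cdom c p -> cdom d p ->
  distribution_near 3 p xi -> distribution_near 3 p eta ->
  same_jet xi eta c p -> same_jet xi eta d p.
Proof.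
move=> ac ad cp dp dxi deta H.
have [a [a' [fa fa' E0 E1]]] := same_jet_frames ac cp dxi deta H.
have fb := frame_change ac ad cp dp fa; have fb' := frame_change ac ad cp dp fa'.
have [sa _] := fa; have [sa' _] := fa'.
split.
  by rewrite (frame_gr_at fb) (frame_gr_at fb') !trans_cfun // E0.
move=> i; rewrite (frame_pd i fb) (frame_pd i fb') !trans_cfun // E0.
congr (dpr _ _); rewrite !frame_change_pd //; apply: eq_bigr => j _.
by rewrite E0 E1.
Qed.

Lemma same_jet_sym xi eta c p : same_jet xi eta c p -> same_jet eta xi c p.
Proof. by move=> [E0 E1]; split. Qed.

Lemma same_jet_trans xi eta zeta c p :
  same_jet xi eta c p -> same_jet eta zeta c p -> same_jet xi zeta c p.
Proof.
move=> [E0 E1] [F0 F1]; split; first exact: etrans E0 F0.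
by move=> i; exact: etrans (E1 i) (F1 i).
Qed.

(** [j1] asks for first-order agreement in all charts around [p]; by [same_jet_change] a single one
    is enough. *)
Lemma j1P xi eta c p : atlas c -> cdom c p -> distribution_near 3 p xi ->
  j1 3 xi p eta <-> distribution_near 3 p eta /\ same_jet eta xi c p.
Proof.
move=> ac cp dxi; split=> [[deta H]|[deta H]].
  split=> //; have [E0 E1] := H _ ac cp; split; first by rewrite gr.unlock.
  by move=> i; rewrite -!dgrcoordE.
split; first exact: deta.
move=> d ad dp; have [E0 E1] := same_jet_change ac ad cp dp deta dxi H.
split; first by rewrite gr.unlock in E0.
by move=> i; rewrite !dgrcoordE.
Qed.

Lemma j1_eqP xi eta c p : atlas c -> cdom c p -> distribution_near 3 p xi ->
  distribution_near 3 p eta -> same_jet xi eta c p <-> j1 3 xi p = j1 3 eta p.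
Proof.
move=> ac cp dxi deta; split=> H.
  have sub X Y : distribution_near 3 p X -> distribution_near 3 p Y -> same_jet X Y c p ->
      j1 3 X p `<=` j1 3 Y p.
    move=> dX dY XY zeta HX; have [dz Hz] := (j1P zeta ac cp dX).1 HX.
    exact: (j1P zeta ac cp dY).2 (conj dz (same_jet_trans Hz XY)).
  apply/seteqP; split; first exact: sub.
  by apply: sub => //; exact: same_jet_sym.
have X : j1 3 xi p xi by exact: (j1P xi ac cp dxi).2 (conj dxi (conj erefl (fun=> erefl))).
by rewrite H in X; have [] := (j1P xi ac cp deta).1 X.
Qed.

Lemma j1_refl xi p : distribution_near 3 p xi -> j1 3 xi p xi.
Proof. by move=> dxi; apply/(j1P _ (chart_at_atlas p) (chart_at_dom p) dxi). Qed.

Lemma cross_linear : linear (@cross R).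
Proof.
move=> a u v; apply/matrixP => i j; rewrite !mxE.
by elim/ord3P: i; elim/ord3P: j; rewrite /=; ring.
Qed.

Lemma crossC (u v : 'cV[R]_3) : cross u *m v = - (cross v *m u).
Proof.
apply/colP => i; rewrite !mxE !sum3 /cross.
by elim/ord3P: i; rewrite !mxE /=; ring.
Qed.

Lemma cross0 : cross (0 : 'cV[R]_3) = 0.
Proof. by apply/matrixP => i j; elim/ord3P: i; elim/ord3P: j; rewrite !mxE /= ?oppr0. Qed.

Lemma cross_sum (I : finType) (F : I -> R) (G : I -> 'cV[R]_3) :
  cross (\sum_i F i *: G i) = \sum_i F i *: cross (G i).
Proof.
elim/big_rec2: _ => [|i x y _ <-]; first exact: cross0.
by rewrite cross_linear.
Qed.

Lemma col_mulmx_sum m k (A : 'M[R]_(3, m)) (P : 'M[R]_(m, k)) i :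
  col i (A *m P) = \sum_j P j i *: col j A.
Proof.
apply/colP => a; rewrite !mxE summxE; apply: eq_bigr => j _.
by rewrite !mxE mulrC.
Qed.

Lemma mulmx_col_row m k (A : 'M[R]_(3, m)) (P : 'M[R]_(m, k)) :
  A *m P = \sum_j col j A *m row j P.
Proof.
apply/matrixP => a b; rewrite !mxE summxE; apply: eq_bigr => j _.
by rewrite !mxE big_ord1 !mxE.
Qed.

(** [u]_x v is antisymmetric in u and v while the rows of [P] are symmetric in both indices, so the
    sum equals its own negative. In [brackets_change] the [P j] hold the second derivatives of a
    change of charts. *)
Lemma sym_cross_sum (A : 'M[R]_(3, n)) (P : 'I_n -> 'M[R]_n) :
  (forall j k, row k (P j) = row j (P k)) ->
  \sum_j cross (col j A) *m (A *m P j) = 0.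
Proof.
move=> sP; set X := \sum_j _.
have E : X = \sum_j \sum_k cross (col j A) *m (col k A *m row k (P j)).
  by apply: eq_bigr => j _; rewrite (mulmx_col_row A) mulmx_sumr.
have : X = - X.
  rewrite {2}E exchange_big /= -sumrN E; apply: eq_bigr => j _.
  rewrite -sumrN; apply: eq_bigr => k _.
  by rewrite !mulmxA crossC mulNmx sP.
move=> /eqP; rewrite -addr_eq0 -mulr2n => /eqP XX.
apply/matrixP => a b; have /matrixP/(_ a b) := XX; rewrite !mxE -mulr2n => /eqP.
by rewrite mulrn_eq0 /= => /eqP.
Qed.

Lemma tjac_row c d p j k : atlas c -> atlas d -> cdom c p -> cdom d p ->
  row k (pd (tjac c d) j (cfun c p)) = pd (pd (trans c d) k) j (cfun c p).
Proof.
move=> ac ad cp dp.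
have sJ := tjac_smooth ac ad cp dp.
have E : \forall x \near cfun c p, pd (trans c d) k x = delta_mx 0 k *m tjac c d x.
  have := near_cinv ac cp (cdom_nbhs ad dp); apply: filterS => x [cx dx].
  rewrite -rowE -{1 2}(cinvK ac cx); apply: pd_trans => //; exact: cinv_dom.
by rewrite (pd_near j E) pd_mulmxl // rowE.
Qed.

(** Invariance of the Lie bracket under a change of coordinates. The Jacobian from the columns of
    the frame cancels the inverse one from the partial derivatives, and the terms with second
    derivatives drop out by [sym_cross_sum]. *)
Lemma brackets_change c d p (a : rV -> 'M[R]_(3, n)) : atlas c -> atlas d -> cdom c p -> cdom d p ->
  smooth_at setT (cfun c p) a ->
  let b := fun y => a (trans d c y) *m tjac c d (trans d c y) in
  brackets (b (cfun d p)) (fun i => pd b i (cfun d p)) =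
  brackets (a (cfun c p)) (fun i => pd a i (cfun c p)) *m tjac c d (cfun c p).
Proof.
move=> ac ad cp dp sa b.
set A := a (cfun c p); set J := tjac c d (cfun c p); set J' := tjac d c (cfun d p).
have JJ : J *m J' = 1%:M by exact: jac_transK.
have bE : b (cfun d p) = A *m J by rewrite /b trans_cfun.
pose X j := pd a j (cfun c p) *m J + A *m pd (tjac c d) j (cfun c p).
have pbE i : pd b i (cfun d p) = \sum_j J' i j *: X j.
  by rewrite /b frame_change_pd.
rewrite /brackets bE.
have -> : \sum_i cross (col i (A *m J)) *m pd b i (cfun d p) =
    \sum_j cross (col j A) *m X j.
  have E i : cross (col i (A *m J)) *m pd b i (cfun d p) =
      \sum_k \sum_j (J k i * J' i j) *: (cross (col k A) *m X j).
    rewrite pbE col_mulmx_sum cross_sum mulmx_suml; apply: eq_bigr => k _.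
    rewrite mulmx_sumr; apply: eq_bigr => j _.
    by rewrite -scalemxAl -scalemxAr scalerA.
  rewrite (eq_bigr _ (fun i _ => E i)) exchange_big /=; apply: eq_bigr => k _.
  rewrite exchange_big /= (bigD1 k) //= [X in _ + X]big1 ?addr0.
    rewrite -scaler_suml.
    have -> : \sum_i J k i * J' i k = (J *m J') k k by rewrite mxE.
    by rewrite JJ mxE eqxx scale1r.
  move=> j jk; rewrite -scaler_suml.
  have -> : \sum_i J k i * J' i j = (J *m J') k j by rewrite mxE.
  by rewrite JJ mxE eq_sym (negbTE jk) scale0r.
rewrite /X mulmx_suml.
under eq_bigr do rewrite mulmxDr.
rewrite big_split /= [X in _ + X]sym_cross_sum ?addr0.
  by apply: eq_bigr => j _; rewrite mulmxA.
move=> j k; rewrite !tjac_row // pd_sym //; exact: trans_smooth.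
Qed.

Lemma step2_frame_change c d p (a : rV -> 'M[R]_(3, n)) : atlas c -> atlas d -> cdom c p -> cdom d p ->
  smooth_at setT (cfun c p) a ->
  let b := fun y => a (trans d c y) *m tjac c d (trans d c y) in
  step2_frame (b (cfun d p)) (fun i => pd b i (cfun d p)) =
  step2_frame (a (cfun c p)) (fun i => pd a i (cfun c p)).
Proof.
move=> ac ad cp dp sa b; rewrite /step2_frame brackets_change // /b trans_cfun //.
rewrite -mul_col_mx /row_full mxrankMfree //.
by rewrite row_free_unit; exact: tjac_unit.
Qed.

Definition rcross (u v : 'rV[R]_3) : 'rV[R]_3 := (cross u^T *m v^T)^T.

(** The vector triple product identity. It matches the cross product form of [brackets] with the
    antisymmetrized formula for a Lie bracket. *)
Lemma rcrossM (u v : 'rV[R]_3) (l : 'cV[R]_3) :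
  rcross u v *m cross l = (u *m l) 0 0 *: v - (v *m l) 0 0 *: u.
Proof.
apply/rowP => i; rewrite /rcross !mxE !sum3 !mxE !sum3 !mxE /=.
by elim/ord3P: i; rewrite /=; ring.
Qed.

Lemma curvatureE xi p u v : distribution_near 3 p xi ->
  let c := chart_at p in let x := cfun c p in
  (u <= xi p)%MS -> (v <= xi p)%MS ->
  curvature xi p u v = \sum_i (u 0 i *: (v *m pd (gr xi c) i x)
                              - v 0 i *: (u *m pd (gr xi c) i x)).
Proof.
move=> dxi c x uxi vxi.
have ac : atlas c := chart_at_atlas p; have cp : cdom c p := chart_at_dom p.
have sg := distribution_near_smooth ac cp dxi.
have sl (w : 'rV[R]_n) : smooth_at setT x (fun y => w *m gr xi c y).
  by apply: smooth_at_mulmx => //; exact: smooth_at_cst.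
have gE : (gr xi c x :=: xi p)%MS.
  apply: eqmx_trans (gr_eqmx xi c x) _; rewrite /x cfunK // tco_chart_at.
  by rewrite mulmx1.
have fix_ (w : 'rV[R]_n) : (w <= xi p)%MS -> w *m gr xi c x = w.
  by move=> wx; apply: gr_fix; rewrite gE.
rewrite /curvature /lie_bracket -/c -/x.
have -> : grcoord xi c = gr xi c by rewrite gr.unlock.
rewrite !fix_ //.
rewrite !derive_pd; try exact: smooth_at_diff (sl _).
by rewrite -sumrB; apply: eq_bigr => i _; rewrite !pd_mulmxl.
Qed.

(** Differentiating a = a P, with P the projector field, gives a dP = da - da P, and da P has rows
    in the plane. So modulo the plane the projected constant fields may be replaced by the frame
    fields. *)
Lemma curvature_mod xi p (a : rV -> 'M[R]_(3, n)) (al be : 'rV[R]_3) :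
  let c := chart_at p in let x := cfun c p in
  frame_near xi c p a ->
  (curvature xi p (al *m a x) (be *m a x) -
   rcross al be *m brackets (a x) (fun i => pd a i x) <= xi p)%MS.
Proof.
move=> c x fa; have [sa na] := fa.
have ac : atlas c := chart_at_atlas p; have cp : cdom c p := chart_at_dom p.
have dxi := frame_distribution ac cp fa.
have sg := distribution_near_smooth ac cp dxi.
have [fx aE] := nbhs_singleton na.
have axi : (a x :=: xi p)%MS.
  by apply: eqmx_trans aE _; rewrite cfunK // tco_chart_at mulmx1.
have sub w : (w *m a x <= xi p)%MS by rewrite -axi submxMl.
rewrite curvatureE //.
pose P := gr xi c x.
have Pxi : (P :=: xi p)%MS.
  apply: eqmx_trans (gr_eqmx xi c x) _; rewrite /x cfunK // tco_chart_at.
  by rewrite mulmx1.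
have E i : a x *m pd (gr xi c) i x = pd a i x - pd a i x *m P.
  have H : \forall y \near x, a y *m gr xi c y = a y.
    by apply: filterS na => y [_ ay]; apply: gr_fix; rewrite gr_eqmx ay.
  have := pd_near i H; rewrite pd_mulmx // => HH.
  by apply/esym/eqP; rewrite subr_eq addrC HH.
have EE (w : 'rV[R]_3) i : w *m a x *m pd (gr xi c) i x = w *m pd a i x - w *m pd a i x *m P.
  by rewrite -mulmxA E mulmxBr mulmxA.
rewrite /brackets mulmx_sumr -sumrB; apply: summx_sub => i _.
rewrite mulmxA rcrossM !EE.
have cE (w : 'rV[R]_3) : (w *m col i (a x)) 0 0 = (w *m a x) 0 i.
  by rewrite !mxE; apply: eq_bigr => k _; rewrite !mxE.
rewrite !cE mulmxBl -!scalemxAl.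
set u := (al *m a x) 0 i; set v := (be *m a x) 0 i.
set X := be *m pd a i x; set Y := al *m pd a i x.
have -> : u *: (X - X *m P) - v *: (Y - Y *m P) - (u *: X - v *: Y) =
    (v *: Y - u *: X) *m P.
  rewrite mulmxBl -!scalemxAl; move: X Y (X *m P) (Y *m P) => X Y XP YP.
  by apply/rowP => j; rewrite !mxE; ring.
by rewrite -Pxi submxMl.
Qed.

Lemma rcross_basis (g : 'rV[R]_3) :
  g = rcross (g 0 i30 *: delta_mx 0 i31) (delta_mx 0 i32)
    + rcross (g 0 i31 *: delta_mx 0 i32) (delta_mx 0 i30)
    + rcross (g 0 i32 *: delta_mx 0 i30) (delta_mx 0 i31).
Proof.
apply/rowP => i; rewrite /rcross !mxE !sum3 !mxE /=.
by elim/ord3P: i; rewrite /=; ring.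
Qed.

Lemma curvature_epi_frame_at xi p (a : rV -> 'M[R]_(3, n)) :
  let c := chart_at p in let x := cfun c p in
  frame_near xi c p a ->
  curvature_epi xi p <-> step2_frame (a x) (fun i => pd a i x).
Proof.
move=> c x fa; have [sa na] := fa.
have ac : atlas c := chart_at_atlas p; have cp : cdom c p := chart_at_dom p.
have [fx aE] := nbhs_singleton na.
have axi : (a x :=: xi p)%MS.
  by apply: eqmx_trans aE _; rewrite cfunK // tco_chart_at mulmx1.
have cm := curvature_mod _ _ fa.
set W := brackets _ _ in cm *; rewrite /curvature_epi.
move: (curvature xi p) cm => Om cm; split=> [epi|].
  rewrite /step2_frame -sub1mx; apply/row_subP => i; rewrite row1.
  set w : 'rV_n := delta_mx 0 i; have [s [Hs Hw]] := epi w.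
  rewrite -(subKr (\sum_(uv <- s) Om uv.1 uv.2) w).
  have subA (y : 'rV[R]_n) : (y <= xi p)%MS -> (y <= col_mx (a x) W)%MS.
    by rewrite -axi => /submx_trans; apply; rewrite -addsmxE addsmxSl.
  apply: addmx_sub; last by rewrite eqmx_opp; exact: subA.
  rewrite big_seq; apply: summx_sub => uv /Hs[]; rewrite -!axi.
  move=> /submxP[al ->] /submxP[be ->].
  rewrite -(subrK (rcross al be *m W) (Om _ _)).
  apply: addmx_sub; first by apply: subA; exact: cm.
  by apply: (submx_trans (submxMl _ _)); rewrite -addsmxE addsmxSr.
rewrite /step2_frame -sub1mx => full w.
have : (w <= col_mx (a x) W)%MS by apply: submx_trans (submx1 _) full.
rewrite -addsmxE => /sub_addsmxP[[y g] /= ->].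
pose e i : 'rV[R]_3 := delta_mx 0 i.
(* Every element of wedge^2 of a 3-space is a combination of the three products of basis vectors;
   the coefficients are those of [g] in [rcross_basis]. *)
exists [:: ((g 0 i30 *: e i31) *m a x, e i32 *m a x);
          ((g 0 i31 *: e i32) *m a x, e i30 *m a x);
          ((g 0 i32 *: e i30) *m a x, e i31 *m a x)]; split.
  by move=> uv; rewrite !inE => /or3P[]/eqP-> /=; rewrite -!axi !submxMl.
rewrite !big_cons big_nil addr0 /=.
have -> (X Y Z : 'rV[R]_n) : X + (Y + Z) - (y *m a x + g *m W) =
   (X - rcross (g 0 i30 *: e i31) (e i32) *m W) +
   ((Y - rcross (g 0 i31 *: e i32) (e i30) *m W) +
   (Z - rcross (g 0 i32 *: e i30) (e i31) *m W)) - y *m a x.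
  rewrite {1}(rcross_basis g) !mulmxDl -/e.
  move: (rcross _ _ *m W) (rcross _ _ *m W) (rcross _ _ *m W) (y *m a x) => G0 G1 G2 ya.
  by apply/rowP => j; rewrite !mxE; ring.
apply: addmx_sub; last by rewrite eqmx_opp -axi submxMl.
by apply: addmx_sub; [exact: cm|apply: addmx_sub; exact: cm].
Qed.

Lemma curvature_epi_frame xi c p (a : rV -> 'M[R]_(3, n)) : atlas c -> cdom c p ->
  frame_near xi c p a ->
  curvature_epi xi p <-> step2_frame (a (cfun c p)) (fun i => pd a i (cfun c p)).
Proof.
move=> ac cp fa.
have ad := chart_at_atlas p; have dp := chart_at_dom p.
have fb := frame_change ac ad cp dp fa.
have [sa _] := fa.
rewrite -(step2_frame_change ac ad cp dp sa).
exact: curvature_epi_frame_at fb.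
Qed.

Lemma curvature_epi_same_jet xi eta c p : atlas c -> cdom c p ->
  distribution_near 3 p xi -> distribution_near 3 p eta -> same_jet xi eta c p ->
  curvature_epi xi p -> curvature_epi eta p.
Proof.
move=> ac cp dxi deta H.
have [a [a' [fa fa' E0 E1]]] := same_jet_frames ac cp dxi deta H.
rewrite (curvature_epi_frame ac cp fa) (curvature_epi_frame ac cp fa').
rewrite E0 /step2_frame /brackets.
by under eq_bigr do rewrite E1.
Qed.

Lemma step2_j1 xi p : distribution_near 3 p xi ->
  step2 3 p (j1 3 xi p) <-> curvature_epi xi p.
Proof.
move=> dxi; split=> [[_]|epi]; first by apply; exact: j1_refl.
have ac := chart_at_atlas p; have cp := chart_at_dom p.
split; first by exists xi.
move=> eta /(j1P _ ac cp dxi)[deta H].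
exact: (curvature_epi_same_jet ac cp dxi deta (same_jet_sym H)).
Qed.

End Jets.

(** * Jets given by a frame and its formal derivatives *)

Section FrameJets.
Variables (R : realType) (n : nat) (M : @manifold R n setT).
Hypothesis n3 : (3 <= n)%N.
Implicit Types (c d : chart R n M) (p q : M) (xi eta : plane_field M) (J : jet M).
Local Notation rV := 'rV[R]_n.
Local Notation frm := 'M[R]_(3, n).

(** The zero field is a default for the empty set only; [J1_rep] shows that actual jets contain
    their representative. *)
Definition rep J : plane_field M := xget (fun=> 0) J.

Lemma J1_rep p J : J1 3 p J -> [/\ distribution_near 3 p (rep J), J (rep J) & J = j1 3 (rep J) p].
Proof.
move=> [xi dxi JE]; have Jxi : J xi by rewrite JE; exact: j1_refl.
have Jr : J (rep J) by exact: (xgetI (fun=> 0) Jxi).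
have ac := chart_at_atlas p; have cp := chart_at_dom p.
have Jr' : j1 3 xi p (rep J) by rewrite -JE.
have [dr H] := (j1P (rep J) ac cp dxi).1 Jr'.
split; [exact: dr|exact: Jr|apply: (etrans JE)].
exact: (j1_eqP ac cp dxi dr).1 (same_jet_sym H).
Qed.

(* J is the 1-jet at p of the plane fields spanned, in the chart c, by the rows
   of a frame with value A and i-th partial derivative B i. *)
Definition is_frame J c p (A : frm) (B : 'I_n -> frm) : Prop :=
  [/\ row_free A, J1 3 p J & forall xi, J xi ->
    gr xi c (cfun c p) = pr A /\ forall i, pd (gr xi c) i (cfun c p) = dpr A (B i)].

Lemma is_frame_uniq J J' c p A B : atlas c -> cdom c p ->
  is_frame J c p A B -> is_frame J' c p A B -> J = J'.
Proof.
move=> ac cp [fA JJ H] [_ JJ' H'].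
have [dr Jr ->] := J1_rep JJ; have [dr' Jr' ->] := J1_rep JJ'.
have [E0 E1] := H _ Jr; have [E0' E1'] := H' _ Jr'.
apply/(j1_eqP ac cp dr dr'); split; first exact: etrans E0 (esym E0').
by move=> i; exact: etrans (E1 i) (esym (E1' i)).
Qed.

Lemma is_frame_near xi c p a : atlas c -> cdom c p -> frame_near xi c p a ->
  is_frame (j1 3 xi p) c p (a (cfun c p)) (fun i => pd a i (cfun c p)).
Proof.
move=> ac cp fa; have dxi := frame_distribution ac cp fa.
split; [exact: frame_free fa|by exists xi|move=> eta Heta].
have [_ [E0 E1]] := (j1P eta ac cp dxi).1 Heta.
split; first by rewrite E0 (frame_gr_at fa).
by move=> i; rewrite E1 (frame_pd i fa).
Qed.

(** [pid_mx 3] pads the frame to a square matrix without changing its row space, as 3 <= n; the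
    inverse of [tco] moves it from the chart [c] to the preferred chart at [q]. *)
Definition cfield c (a : rV -> frm) : plane_field M :=
  fun q => (pid_mx 3 : 'M[R]_(n, 3)) *m a (cfun c q) *m invmx (tco c q).

Lemma cfield_frame c p (a : rV -> frm) : atlas c -> cdom c p ->
  smooth_at setT (cfun c p) a -> row_free (a (cfun c p)) -> frame_near (cfield c a) c p a.
Proof.
move=> ac cp sa fa; split=> //.
have fn := smooth_at_nearP I sa (row_free_near fa).
apply: filterS2 fn (cimg_nbhs ac (cimg_cfun cp)) => x /(_ I) fx cx.
split=> //; rewrite /cfield cinvK // mulmxKV; last by apply: tco_unit => //; exact: cinv_dom.
apply: eqmx_sym; apply: eqmxMfull.
by rewrite /row_full rank_pid_mx.
Qed.

(** Its value and first derivatives at [x] are arbitrary data, so each pair (A, B) with A free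
    represents a jet. This is what allows a family of jets to be defined by a frame together with
    unrelated formal derivatives. *)
Definition affine_frame (x : rV) (A : frm) (B : 'I_n -> frm) : rV -> frm :=
  fun y => A + \sum_i (y - x) 0 i *: B i.

Lemma smooth_affine_frame x A B z : smooth_at setT z (affine_frame x A B).
Proof.
apply: smooth_atD; first exact: smooth_at_cst.
apply: smooth_at_sum => i; apply: smooth_atZ; last exact: smooth_at_cst.
apply: smooth_at_entry; apply: smooth_atB; [exact: smooth_at_id|exact: smooth_at_cst].
Qed.

Lemma affine_frame_at x A B : affine_frame x A B x = A.
Proof.
rewrite /affine_frame big1 ?addr0 // => i _.
by rewrite subrr mxE scale0r.
Qed.

Lemma pd_affine_frame x A B i z : pd (affine_frame x A B) i z = B i.
Proof.
apply/matrixP => a b; rewrite pd.unlock.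
have sd := @smooth_at_derivable _ _ _ _ _ (delta_mx 0 i) (smooth_affine_frame x A B z).
rewrite (derivable_entry a b sd).
have E : (fun y => affine_frame x A B y a b) = (fun y => A a b + \sum_j (y 0 j - x 0 j) * B j a b).
  apply/funext => y; rewrite /affine_frame mxE; congr (_ + _).
  by rewrite summxE; apply: eq_bigr => j _; rewrite !mxE.
rewrite E.
have D : is_derive z (delta_mx 0 i) (fun y : rV => A a b + \sum_j (y 0 j - x 0 j) * B j a b)
   (0 + \sum_j B j a b *: (delta_mx 0 i : rV) 0 j).
  have E2 : (fun y : rV => A a b + \sum_j (y 0 j - x 0 j) * B j a b) =
     cst (A a b) + \sum_j (fun y : rV => (y 0 j - x 0 j) * B j a b).
    by apply/funext => y; rewrite !fctE fct_sumE.
  rewrite E2; apply: is_deriveD; apply: is_derive_sum => j.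
  have dj : is_derive z (delta_mx 0 i) (fun y : rV => y 0 j - x 0 j) ((delta_mx 0 i : rV) 0 j).
    have d1 : is_derive z (delta_mx 0 i) (fun y : rV => y 0 j) ((delta_mx 0 i : rV) 0 j).
      apply: DeriveDef; first exact/diff_derivable/differentiable_coord.
      rewrite -(derivable_entry 0 j (@derivable_id _ _ z (delta_mx 0 i))).
      by rewrite derive_id.
    by have := is_deriveB d1 (is_derive_cst (x 0 j) z (delta_mx 0 i)); rewrite subr0.
  have := is_deriveM dj (is_derive_cst (B j a b) z (delta_mx 0 i)).
  by rewrite scaler0 add0r.
case: D => _ ->; rewrite add0r (bigD1 i) //= big1 ?addr0.
  by rewrite mxE !eqxx /GRing.scale /= mulr1.
by move=> j ji; rewrite mxE (negbTE ji) andbF scaler0.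
Qed.

Definition fjet c p (A : frm) (B : 'I_n -> frm) : jet M :=
  j1 3 (cfield c (affine_frame (cfun c p) A B)) p.

Lemma fjet_frame_near c p A B : atlas c -> cdom c p -> row_free A ->
  frame_near (cfield c (affine_frame (cfun c p) A B)) c p (affine_frame (cfun c p) A B).
Proof.
move=> ac cp fA; apply: cfield_frame => //; first exact: smooth_affine_frame.
by rewrite affine_frame_at.
Qed.

Lemma fjet_is_frame c p A B : atlas c -> cdom c p -> row_free A ->
  is_frame (fjet c p A B) c p A B.
Proof.
move=> ac cp fA; have := is_frame_near ac cp (fjet_frame_near B ac cp fA).
rewrite affine_frame_at /fjet.
by under eq_fun do rewrite pd_affine_frame.
Qed.

Lemma is_frame_fjet J c p A B : atlas c -> cdom c p -> is_frame J c p A B ->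
  J = fjet c p A B.
Proof.
move=> ac cp H; have [fA _ _] := H.
exact: is_frame_uniq ac cp H (fjet_is_frame B ac cp fA).
Qed.

(** The chain and product rules for the transformed frame of [frame_change], with the formal
    derivatives [B] in place of actual ones. *)
Definition frame_changeB c d p (A : frm) (B : 'I_n -> frm) (i : 'I_n) : frm :=
  \sum_j tjac d c (cfun d p) i j *: (B j *m tjac c d (cfun c p) +
     A *m pd (tjac c d) j (cfun c p)).

Lemma is_frame_change J c d p A B : atlas c -> atlas d -> cdom c p -> cdom d p ->
  is_frame J c p A B ->
  is_frame J d p (A *m tjac c d (cfun c p)) (frame_changeB c d p A B).
Proof.
move=> ac ad cp dp H; have [fA _ _] := H.
rewrite (is_frame_fjet ac cp H) /fjet.
have fa := fjet_frame_near B ac cp fA.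
have := is_frame_near ad dp (frame_change ac ad cp dp fa).
rewrite trans_cfun // affine_frame_at.
have sa := smooth_affine_frame (cfun c p) A B (cfun c p).
have E : (fun i => pd (fun y => affine_frame (cfun c p) A B (trans d c y) *m
     tjac c d (trans d c y)) i (cfun d p)) = frame_changeB c d p A B.
  apply/funext => i; rewrite frame_change_pd // /frame_changeB affine_frame_at.
  by apply: eq_bigr => j _; rewrite pd_affine_frame.
by rewrite E.
Qed.

Lemma is_frame_step2 J c p A B : atlas c -> cdom c p -> is_frame J c p A B ->
  step2 3 p J <-> step2_frame A B.
Proof.
move=> ac cp H; have [fA _ _] := H.
rewrite (is_frame_fjet ac cp H) /fjet; have fa := fjet_frame_near B ac cp fA.
rewrite step2_j1; last exact: frame_distribution ac cp fa.
rewrite (curvature_epi_frame ac cp fa) affine_frame_at.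
by have -> : (fun i => pd (affine_frame (cfun c p) A B) i (cfun c p)) = B
  by apply/funext => i; rewrite pd_affine_frame.
Qed.

Lemma is_frame_eqmx J c p A B xi : atlas c -> cdom c p -> is_frame J c p A B -> J xi ->
  (A :=: xi p *m tco c p)%MS.
Proof.
move=> ac cp [fA _ H] /H[E _]; apply: eqmx_trans (eqmx_sym (pr_eqmx fA)) _.
by rewrite -E; apply: eqmx_trans (gr_eqmx xi c _) _; rewrite cfunK.
Qed.

End FrameJets.

Lemma near_fst (S T : topologicalType) (y : S) (x : T) (P : set S) :
  nbhs y P -> nbhs (y, x) [set w | P w.1].
Proof. by move=> nP; apply: (cvg_fst (F := nbhs y) (G := nbhs x)). Qed.

Lemma near_snd (S T : topologicalType) (y : S) (x : T) (P : set T) :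
  nbhs x P -> nbhs (y, x) [set w | P w.2].
Proof. by move=> nP; apply: (cvg_snd (F := nbhs y) (G := nbhs x)). Qed.

(** * Smooth families of jets *)

Section SmoothFamilies.
Variables (R : realType) (n : nat) (M : @manifold R n setT).
Hypothesis n3 : (3 <= n)%N.
Implicit Types (c d : chart R n M) (p q : M).
Local Notation rV := 'rV[R]_n.
Local Notation frm := 'M[R]_(3, n).

Section Param.
Variables (E : normedModType R) (bE : fdbasis E).
Implicit Types (D : set E) (G : E -> M -> jet M).

Definition jP G c (z : E * rV) : 'M[R]_n := gr (rep (G z.1 (cinv c z.2))) c z.2.
Definition jL G c i (z : E * rV) : 'M[R]_n := pd (gr (rep (G z.1 (cinv c z.2))) c) i z.2.

Definition smooth_jets_at D G c (z : E * rV) : Prop :=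
  smooth_at (D `*` cimg c) z (jP G c) /\ forall i, smooth_at (D `*` cimg c) z (jL G c i).

(** A local smooth lift from jets to pairs of a frame and formal derivatives. Changes of chart act
    on such pairs by explicit formulas, which is how smoothness passes from one chart to another. *)
Definition presentation D G c (z : E * rV) (Af : E * rV -> frm) (Bf : 'I_n -> E * rV -> frm) :=
  [/\ smooth_at (D `*` cimg c) z Af, forall i, smooth_at (D `*` cimg c) z (Bf i) &
    \forall w \near z, (D `*` cimg c) w ->
      is_frame (G w.1 (cinv c w.2)) c (cinv c w.2) (Af w) (fun i => Bf i w)].

Lemma presentation_smooth D G c z Af Bf : atlas c -> (D `*` cimg c) z ->
  presentation D G c z Af Bf -> smooth_jets_at D G c z.
Proof.
move=> ac Dz [sA sB H]; have [fA _ _] := nbhs_singleton H Dz.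
have Hw : \forall w \near z, (D `*` cimg c) w -> pr (Af w) = jP G c w /\
    forall i, dpr (Af w) (Bf i w) = jL G c i w.
  apply: filterS H => w Hw Dw; have [_ JJ Hr] := Hw Dw.
  have [_ Jr _] := J1_rep JJ; have [E0 E1] := Hr _ Jr.
  have [_ cw] := Dw; rewrite cinvK // in E0 E1.
  by split=> [|i]; rewrite /jP /jL ?E0 ?E1.
split=> [|i].
  by apply: smooth_at_ext (smooth_at_pr Dz fA sA); apply: filterS Hw => w Hw /Hw[].
by apply: smooth_at_ext (smooth_at_dpr Dz fA sA (sB i)); apply: filterS Hw => w Hw /Hw[].
Qed.

Lemma smooth_presentation D G c z : atlas c -> (D `*` cimg c) z ->
  (forall y q, D y -> J1 3 q (G y q)) -> smooth_jets_at D G c z ->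
  exists Af Bf, presentation D G c z Af Bf.
Proof.
move=> ac Dz GJ [sP sL].
have [Dy cx] := Dz.
have [dr _ _] := J1_rep (GJ _ (cinv c z.2) Dy).
have [S fS] := frame_pick ac (cinv_dom ac cx) dr; rewrite cinvK // in fS.
exists (fun w => S *m jP G c w), (fun i w => S *m jL G c i w).
have sc : smooth_at (D `*` cimg c) z (fun=> S) by exact: smooth_at_cst.
have sA : smooth_at (D `*` cimg c) z (fun w => S *m jP G c w) by exact: smooth_at_mulmx.
split=> [//|i|]; first exact: smooth_at_mulmx.
have fn := smooth_at_nearP Dz sA (row_free_near fS).
apply: filterS fn => w /[swap] Dw /(_ Dw) fw.
have [Dy' cx'] := Dw; have cq := cinv_dom ac cx'.
have JJ := GJ _ (cinv c w.2) Dy'.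
have [dr' _ JE] := J1_rep JJ.
have sS : smooth_at setT (cfun c (cinv c w.2)) (fun=> S) by exact: smooth_at_cst.
have fw' : row_free (S *m gr (rep (G w.1 (cinv c w.2))) c (cfun c (cinv c w.2))).
  by rewrite cinvK.
have := is_frame_near ac cq (frame_exists ac cq dr' sS fw').
rewrite -JE !cinvK //.
have -> : (fun i => pd (fun x => S *m gr (rep (G w.1 (cinv c w.2))) c x) i w.2) =
   (fun i => S *m jL G c i w).
  apply/funext => i; rewrite pd_mulmxl //.
  by have := distribution_near_smooth ac cq dr'; rewrite cinvK.
by [].
Qed.

Lemma presentation_change D G c d y p Af Bf : atlas c -> atlas d -> cdom c p -> cdom d p ->
  D y -> presentation D G c (y, cfun c p) Af Bf ->
  exists Af' Bf', presentation D G d (y, cfun d p) Af' Bf'.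
Proof.
move=> ac ad cp dp Dy [sA sB H].
pose tw (w : E * rV) := (w.1, trans d c w.2).
have Dz : (D `*` cimg d) (y, cfun d p) by split=> //=; exact: cimg_cfun.
have twz : tw (y, cfun d p) = (y, cfun c p) by rewrite /tw /= trans_cfun.
have st2 : smooth_at (D `*` cimg d) (y, cfun d p) (fun w => trans d c w.2).
  apply: (@smooth_at_comp _ _ _ _ (fdmx R 1 n) (fdmx R 1 n) _ setT _ snd) => //.
  - by near=> w.
  - exact: smooth_at_snd.
  - exact: trans_smooth.
have stw : smooth_at (D `*` cimg d) (y, cfun d p) tw.
  by apply: (smooth_at_pair bE (fdmx R 1 n)) => //; exact: smooth_at_fst.
have ndc : \forall w \near (y, cfun d p), (D `*` cimg d) w -> cdom c (cinv d w.2).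
  have := near_cinv ad dp (cdom_nbhs ac cp) => nd.
  by apply: filterS (near_snd y nd) => w [_ ?] _.
have ntw : \forall w \near (y, cfun d p), (D `*` cimg d) w -> (D `*` cimg c) (tw w).
  apply: filterS ndc => w /[swap] Dw /(_ Dw) cq; have [Dw1 dw2] := Dw.
  by split=> //=; exact: cimg_cfun.
have comp k l (f : E * rV -> 'M[R]_(k, l)) : smooth_at (D `*` cimg c) (y, cfun c p) f ->
    smooth_at (D `*` cimg d) (y, cfun d p) (fun w => f (tw w)).
  move=> sf; apply: (@smooth_at_comp _ _ _ _ (fdpair bE (fdmx R 1 n)) (fdmx R k l) _ (D `*` cimg c)) => //.
  by rewrite twz.
have compx k l (f : rV -> 'M[R]_(k, l)) : smooth_at setT (cfun c p) f ->
    smooth_at (D `*` cimg d) (y, cfun d p) (fun w => f (trans d c w.2)).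
  move=> sf; apply: (@smooth_at_comp _ _ _ _ (fdmx R 1 n) (fdmx R k l) _ setT) => //.
  - by near=> w.
  - by rewrite trans_cfun.
have compd k l (f : rV -> 'M[R]_(k, l)) : smooth_at setT (cfun d p) f ->
    smooth_at (D `*` cimg d) (y, cfun d p) (fun w => f w.2).
  move=> sf; apply: (@smooth_at_comp _ _ _ _ (fdmx R 1 n) (fdmx R k l) _ setT _ snd) => //.
  - by near=> w.
  - exact: smooth_at_snd.
have sJ := tjac_smooth ac ad cp dp; have sJ' := tjac_smooth ad ac dp cp.
exists (fun w => Af (tw w) *m tjac c d (trans d c w.2)).
exists (fun i w => \sum_j tjac d c w.2 i j *: (Bf j (tw w) *m tjac c d (trans d c w.2) +
     Af (tw w) *m pd (tjac c d) j (trans d c w.2))).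
split.
- by apply: smooth_at_mulmx; [exact: comp|exact: compx].
- move=> i; apply: smooth_at_sum => j; apply: smooth_atZ.
    by apply: smooth_at_entry; exact: compd.
  apply: smooth_atD; apply: smooth_at_mulmx; [exact: comp|exact: compx|exact: comp|].
  by apply: compx; exact: smooth_at_pd.
- have H' : \forall w \near (y, cfun d p), (D `*` cimg d) w -> (D `*` cimg c) (tw w) ->
      is_frame (G (tw w).1 (cinv c (tw w).2)) c (cinv c (tw w).2) (Af (tw w)) (fun i => Bf i (tw w)).
    have := smooth_at_nearP Dz stw; rewrite twz => /(_ _ H).
    by apply: filterS => w.
  apply: filterS3 H' ndc ntw => w H1 H2 H3 Dw.
  have cq := H2 Dw; have [_ dw] := Dw; have dq := cinv_dom ad dw.
  have := H1 Dw (H3 Dw); rewrite /tw /=.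
  have -> : cinv c (trans d c w.2) = cinv d w.2 by rewrite /trans /= cfunK.
  move=> /(is_frame_change n3 ac ad cq dq).
  by rewrite /frame_changeB cinvK.
Unshelve. all: by end_near. Qed.

End Param.

Lemma presentation_param (E E' : normedModType R) (bE : fdbasis E) (bE' : fdbasis E')
    (D : set E) (D' : set E')
    (f : E' -> E) G c (y : E') x Af Bf : D' y ->
  cimg c x ->
  (\forall w \near y, D' w -> D (f w)) -> smooth_at D' y f ->
  presentation D G c (f y, x) Af Bf ->
  presentation D' (fun w => G (f w)) c (y, x) (fun w => Af (f w.1, w.2)) (fun i w => Bf i (f w.1, w.2)).
Proof.
move=> Dy cx nD sf [sA sB H].
pose tw (w : E' * rV) := (f w.1, w.2).
have Dz : (D' `*` cimg c) (y, x) by [].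
have sf1 : smooth_at (D' `*` cimg c) (y, x) (fun w => f w.1).
  apply: (@smooth_at_comp _ _ _ _ bE' bE _ D' (y, x) fst f) => //.
    by apply: filterE => w [].
  exact: smooth_at_fst.
have stw : smooth_at (D' `*` cimg c) (y, x) tw.
  by apply: (smooth_at_pair bE (fdmx R 1 n)) => //; exact: smooth_at_snd.
have ntw : \forall w \near (y, x), (D' `*` cimg c) w -> (D `*` cimg c) (tw w).
  by apply: filterS (near_fst x nD) => w H1 [D1 D2]; split=> //; exact: H1.
have comp k l (g : E * rV -> 'M[R]_(k, l)) : smooth_at (D `*` cimg c) (f y, x) g ->
    smooth_at (D' `*` cimg c) (y, x) (fun w => g (tw w)).
  by move=> sg; apply: (@smooth_at_comp _ _ _ _ (fdpair bE (fdmx R 1 n)) (fdmx R k l) _ (D `*` cimg c)).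
split; [exact: comp|by move=> i; exact: comp|].
have := smooth_at_nearP Dz stw H.
by apply: filterS2 ntw => w H1 H2 Dw; exact: H2 Dw (H1 Dw).
Qed.

Section Homotopies.
Variables (m : nat) (K : @manifold R m (@halfspace R m)).
Local Notation par := (R * 'rV[R]_m)%type.
Local Notation pardom d := (`[0, 1] `*` cimg d : set par).

Definition bpar : fdbasis par := fdpair (fdR R) (fdmx R 1 m).

Definition in_chart (F : R -> K -> M -> jet M) (d : chart R m K) : par -> M -> jet M :=
  fun sy => F sy.1 (cinv d sy.2).

(* F is smooth near (s, k, p) in some charts, hence in all of them. *)
Definition smooth_family_at (F : R -> K -> M -> jet M) s (k : K) p : Prop :=
  exists (d : chart R m K) c, [/\ atlas d, atlas c, cdom d k, cdom c p &
    smooth_jets_at (pardom d) (in_chart F d) c ((s, cfun d k), cfun c p)].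

(** Smoothness in one pair of charts is lifted to a presentation, which is carried to the given
    chart of M by [presentation_change] and to the given chart of K by [presentation_param]; the
    change of parameter there is smooth only relative to the half-space. *)
Lemma formal_homotopy_smooth F : (forall s k p, s \in `[0, 1] -> J1 3 p (F s k p)) ->
  (forall s k p, s \in `[0, 1] -> smooth_family_at F s k p) ->
  forall d : chart R m K, atlas d -> smooth_jets (pardom d) (in_chart F d).
Proof.
move=> FJ H d ad c ac; exists (jP (in_chart F d) c), (jL (in_chart F d) c).
have S z : (pardom d `*` cimg c) z -> smooth_jets_at (pardom d) (in_chart F d) c z.
  case: z => -[s y] x [[/= s01 dy] cx].
  have [d' [c' [ad' ac' dk cp sj]]] := H s (cinv d y) (cinv c x) s01.
  have k1 := cinv_dom ad dy; have p1 := cinv_dom ac cx.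
  have D1 : (pardom d' `*` cimg c') ((s, cfun d' (cinv d y)), cfun c' (cinv c x)).
    by split; [split=> //=; exact: cimg_cfun|exact: cimg_cfun].
  have FJ' sy q : pardom d' sy -> J1 3 q (in_chart F d' sy q) by move=> [s1 _]; exact: FJ.
  have [Af [Bf pr1]] := smooth_presentation ac' D1 FJ' sj.
  have [Af' [Bf' pr2]] := presentation_change bpar ac' ac cp p1 D1.1 pr1.
  pose f (w : par) : par := (w.1, cfun d' (cinv d w.2)).
  have sf : smooth_at (pardom d) (s, y) f.
    apply: (smooth_at_pair (fdR R) (fdmx R 1 m)); first exact: smooth_at_fst.
    apply: (@smooth_at_comp _ _ _ _ (fdmx R 1 m) (fdmx R 1 m) _ (cimg d) (s, y) snd (cfun d' \o cinv d)) => //.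
    - by apply: filterE => w [].
    - exact: smooth_at_snd.
    - by rewrite /= -(cinvK ad dy); exact: trans_smooth_within.
  have nD : \forall w \near (s, y), pardom d w -> pardom d' (f w) /\ cdom d' (cinv d w.2).
    have nd := near_cinv_within ad k1 (cdom_nbhs ad' dk); rewrite cinvK // in nd.
    apply: filterS (near_snd s nd) => w H1 [w1 w2]; have H2 := H1 w2.
    by split=> //; split=> //=; exact: cimg_cfun.
  have nD1 : \forall w \near (s, y), pardom d w -> pardom d' (f w).
    by apply: filterS nD => w H1 /H1[].
  have pr2' : presentation (pardom d') (in_chart F d') c (f (s, y), x) Af' Bf'.
    by rewrite /f /= -[X in (_, X)](cinvK ac cx).
  have [sA sB Hp] := presentation_param bpar bpar (conj s01 dy : pardom d (s, y)) cx nD1 sf pr2'.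
  have Dz : (pardom d `*` cimg c) ((s, y), x) by [].
  refine (presentation_smooth ac Dz
    (_ : presentation _ _ _ _ (fun w => Af' (f w.1, w.2)) (fun i w => Bf' i (f w.1, w.2)))).
  split; [exact: sA|exact: sB|].
  apply: filterS2 (near_fst x nD) Hp => w H1 H2 Dw.
  have := H2 Dw; rewrite /in_chart /f /= cfunK //.
  by have [] := H1 Dw.1.
split=> [z Dz|i z Dz|sy x Dsy cx xi Fxi]; [exact: (S z Dz).1|exact: (S z Dz).2 i|].
have JJ : J1 3 (cinv c x) (in_chart F d sy (cinv c x)) by apply: FJ; case: Dsy.
have [dr Jr JE] := J1_rep JJ; rewrite JE in Fxi.
have [_ [E0 E1]] := (j1P xi ac (cinv_dom ac cx) dr).1 Fxi.
rewrite cinvK // in E0 E1; split; first by rewrite /jP /= -E0 gr.unlock.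
by move=> i; rewrite dgrcoordE E1.
Qed.

Lemma formal_homotopy_smooth_at F (d : chart R m K) c z : atlas d -> atlas c ->
  smooth_jets (pardom d) (in_chart F d) -> (pardom d `*` cimg c) z ->
  (forall s k p, s \in `[0, 1] -> J1 3 p (F s k p)) ->
  smooth_jets_at (pardom d) (in_chart F d) c z.
Proof.
move=> ad ac sj Dz FJ; have [P [L [sP sL HPL]]] := sj c ac.
have H w : (pardom d `*` cimg c) w -> P w = jP (in_chart F d) c w /\
    forall i, L i w = jL (in_chart F d) c i w.
  move=> [Dw1 Dw2]; have JJ : J1 3 (cinv c w.2) (in_chart F d w.1 (cinv c w.2)).
    by apply: FJ; case: Dw1.
  have [_ Jr _] := J1_rep JJ; have [E0 E1] := HPL _ _ Dw1 Dw2 _ Jr.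
  case: w {Dw1 Dw2 JJ Jr} E0 E1 => w1 w2 E0 E1; split; first by rewrite E0 /jP gr.unlock.
  by move=> i; rewrite E1 dgrcoordE.
split=> [|i].
  by apply: smooth_at_ext (sP z Dz); apply: filterE => w /H[].
by apply: smooth_at_ext (sL i z Dz); apply: filterE => w /H[].
Qed.

End Homotopies.
End SmoothFamilies.

(** * Corrugation of frames *)

Section PartialRules.
Variables (R : realType) (n : nat).
Local Notation rV := 'rV[R]_n.

Lemma pdD (W : normedModType R) (f g : rV -> W) i x :
  smooth_at setT x f -> smooth_at setT x g ->
  pd (fun y => f y + g y) i x = pd f i x + pd g i x.
Proof.
by move=> sf sg; rewrite pd.unlock; apply: deriveD; exact: smooth_at_derivable.
Qed.

Lemma pd_scale m k (f : rV -> R) (F : rV -> 'M[R]_(m, k)) i x :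
  smooth_at setT x f -> smooth_at setT x F ->
  pd (fun y => f y *: F y) i x = pd f i x *: F x + f x *: pd F i x.
Proof.
move=> sf sF.
have sfF : smooth_at setT x (fun y => f y *: F y) by exact: smooth_atZ.
apply/matrixP => a b; rewrite !mxE !pd.unlock.
rewrite (derivable_entry a b (smooth_at_derivable (v := delta_mx 0 i) sfF)).
rewrite (derivable_entry a b (smooth_at_derivable (v := delta_mx 0 i) sF)).
have -> : (fun y => (f y *: F y) a b) = f * (fun y => F y a b).
  by apply/funext => y; rewrite mxE.
rewrite deriveM; [|exact: smooth_at_derivable|].
  by rewrite addrC; congr (_ + _); exact: mulrC.
exact: smooth_at_derivable (smooth_at_entry a b sF).
Qed.

Lemma pd_comp1 (f : rV -> R) (g : R -> R) g' i x :
  smooth_at setT x f -> is_derive (f x) (1 : R) g g' ->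
  pd (fun y => g (f y)) i x = g' * pd f i x.
Proof.
move=> sf [dg dgE]; have df := smooth_at_diff sf.
have dg' : differentiable g (f x) by apply/derivable1_diffP.
rewrite pd.unlock -[LHS]/('D_(delta_mx 0 i) (g \o f) x) (derive_compE _ df dg').
set v := 'D_(delta_mx 0 i) f x.
have -> : v = v *: (1 : R) by rewrite /GRing.scale /= mulr1.
by rewrite (deriveE _ dg') linearZ /= -(deriveE _ dg') dgE /GRing.scale /= mulr1 mulrC.
Qed.

Lemma pd_coord (i0 i : 'I_n) (e : R) (x : rV) :
  pd (fun y : rV => y 0 i0 / e) i x = (i == i0)%:R / e.
Proof.
have d1 : is_derive x (delta_mx 0 i) (fun y : rV => y 0 i0) ((delta_mx 0 i : rV) 0 i0).
  apply: DeriveDef; first exact/diff_derivable/differentiable_coord.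
  rewrite -(derivable_entry 0 i0 (@derivable_id _ _ x (delta_mx 0 i))).
  by rewrite derive_id.
have := is_deriveM d1 (is_derive_cst (e^-1) x (delta_mx 0 i)).
rewrite scaler0 add0r => -[_]; rewrite pd.unlock => H.
by apply: (etrans H); rewrite mxE eqxx /= /GRing.scale /= mulrC eq_sym.
Qed.

End PartialRules.

Section Corrugation.
Variables (R : realType) (n : nat) (E : normedModType R) (bE : fdbasis E).
Local Notation rV := 'rV[R]_n.
Local Notation frm := 'M[R]_(3, n).
Local Notation Z := (E * rV)%type.
Variables (D : set E) (O : set rV) (oO : open O).
Local Notation X := (D `*` O : set Z).

Definition pdx m k (f : Z -> 'M[R]_(m, k)) i (z : Z) := pd (fun x => f (z.1, x)) i z.2.

Lemma smooth_pdx m k (f : Z -> 'M[R]_(m, k)) i z : X z -> smooth_at X z f ->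
  smooth_at X z (pdx f i).
Proof.
move=> [Dz Oz] sf.
have -> : pdx f i = (fun q => 'D_(delta_mx 0 i) (fun x => f (q.1, x)) q.2).
  by rewrite /pdx pd.unlock.
exact: smooth_at_slice_derive.
Qed.

Lemma smooth_slice m k (f : Z -> 'M[R]_(m, k)) z : X z -> smooth_at X z f ->
  smooth_at setT z.2 (fun x => f (z.1, x)).
Proof.
move=> [Dz Oz] sf; have := smooth_at_slice bE (fdmx R 1 n) (fdmx R m k) Dz Oz sf.
by apply: smooth_at_sub; apply: nbhs_setT_sub; exact: (open_nbhs_nbhs (conj oO Oz)).
Qed.

Variables (A : Z -> frm) (Ef : 'I_n -> Z -> frm) (chi tau : Z -> R) (i0 : 'I_n).
Hypothesis sA : forall z, X z -> smooth_at X z A.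
Hypothesis sE : forall i z, X z -> smooth_at X z (Ef i).
Hypothesis schi : forall z, X z -> smooth_at X z chi.
Hypothesis stau : forall z, X z -> smooth_at X z tau.
Hypothesis chi0 : forall z, 0 <= chi z.
Hypothesis chi1 : forall z, tau z != 0 -> chi z = 1.

Definition formalB i (z : Z) : frm := pdx A i z + Ef i z.
Definition lcol (z : Z) : 'cV[R]_3 := col i0 (A z).
Definition Wz (z : Z) : frm := brackets (A z) (fun i => formalB i z).

Variable Q : set Z.
Hypothesis cQ : compact Q.
Hypothesis QX : Q `<=` X.
Hypothesis fA : forall z, Q z -> row_free (A z).
Hypothesis relA : forall z, Q z -> step2_frame (A z) (fun i => formalB i z).

Lemma smooth_formalB i z : X z -> smooth_at X z (formalB i).
Proof. by move=> Xz; apply: smooth_atD; [apply: smooth_pdx => //; exact: sA|exact: sE]. Qed.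

Lemma smooth_cross (V : normedModType R) (S : set V) z (f : V -> 'cV[R]_3) :
  smooth_at S z f -> smooth_at S z (fun y => cross (f y)).
Proof.
move=> sf; have se i : smooth_at S z (fun y => f y i 0) by exact: smooth_at_entry.
have sn i : smooth_at S z (fun y => - f y i 0) by exact: smooth_atN.
have s0 : smooth_at S z (fun y => 0 : R) by exact: smooth_at_cst.
apply: smooth_at_mx => i j.
have T g a b : smooth_at S z g -> (forall y, g y = cross (f y) a b) ->
    smooth_at S z (fun y => cross (f y) a b).
  by move=> sg gE; apply: smooth_at_ext sg; apply: filterE => y _; exact: gE.
elim/ord3P: i; elim/ord3P: j;
  first [ by apply: (T _ _ _ s0) => y; rewrite /cross mxE
        | by apply: (T _ _ _ (se i30)) => y; rewrite /cross mxE
        | by apply: (T _ _ _ (se i31)) => y; rewrite /cross mxE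
        | by apply: (T _ _ _ (se i32)) => y; rewrite /cross mxE
        | by apply: (T _ _ _ (sn i30)) => y; rewrite /cross mxE
        | by apply: (T _ _ _ (sn i31)) => y; rewrite /cross mxE
        | by apply: (T _ _ _ (sn i32)) => y; rewrite /cross mxE ].
Qed.

Lemma smooth_col (V : normedModType R) (S : set V) z (f : V -> frm) i :
  smooth_at S z f -> smooth_at S z (fun y => col i (f y)).
Proof.
move=> sf; apply: smooth_at_mx => a b.
by apply: smooth_at_ext (smooth_at_entry a i sf); apply: filterE => y _; rewrite mxE.
Qed.

Lemma smooth_brackets (V : normedModType R) (S : set V) z (f : V -> frm) (h : 'I_n -> V -> frm) :
  smooth_at S z f -> (forall i, smooth_at S z (h i)) ->
  smooth_at S z (fun y => brackets (f y) (fun i => h i y)).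
Proof.
move=> sf sh; apply: smooth_at_sum => i; apply: smooth_at_mulmx => //.
by apply: smooth_cross; exact: smooth_col.
Qed.

Lemma smooth_lcol z : X z -> smooth_at X z lcol.
Proof. by move=> Xz; apply: smooth_col; exact: sA. Qed.

Lemma smooth_Wz z : X z -> smooth_at X z Wz.
Proof.
move=> Xz; apply: (@smooth_brackets _ _ _ _ formalB); first exact: sA.
by move=> i; exact: smooth_formalB.
Qed.

Lemma smooth_colmx (V : normedModType R) (S : set V) z (f h : V -> frm) :
  smooth_at S z f -> smooth_at S z h -> smooth_at S z (fun y => col_mx (f y) (h y)).
Proof.
move=> sf sh; apply: smooth_at_mx => i j.
case: (split_ordP i) => k ->.
  by apply: smooth_at_ext (smooth_at_entry k j sf); apply: filterE => y _; rewrite col_mxEu.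
by apply: smooth_at_ext (smooth_at_entry k j sh); apply: filterE => y _; rewrite col_mxEd.
Qed.

Lemma row_full_near k l (C : 'M[R]_(k, l)) : row_full C -> \forall C' \near C, row_full C'.
Proof.
rewrite row_full_gram unitmxE unitfE => dC.
have s : smooth_at [set: 'M[R]_(k, l)] C (fun C => \det (C^T *m C)).
  apply: smooth_at_det; apply: smooth_at_mulmx; last exact: smooth_at_id.
  by apply: smooth_at_trmx; exact: smooth_at_id.
have := smooth_at_nearP I s (open_nbhs_nbhs (conj (@open_neq _ 0) dC)).
by apply: filterS => C' /(_ I) /= dC'; rewrite row_full_gram unitmxE unitfE.
Qed.

(* Between the two canonical paths to the topology of a product of normed
   modules, which are expensive to unify on nested products. *)
Lemma nbhs_prod_normed (V W : normedModType R) (z : V) (w : W) (P : set (V * W)) :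
  (fun (U : normedModType R) (p : U) (A : set U) => nbhs p A) (V * W)%type (z, w) P ->
  nbhs (z, w) P.
Proof. by []. Qed.

(** The tube lemma. Each uniform claim over a compact set is reduced to the limiting value [w0],
    where it is an open condition. The guard [Y] is there because smooth functions are controlled
    only on their domain. *)
Lemma uniform_near (V W : normedModType R) (Y K : set V) (w0 : W) (P : V -> W -> Prop) :
  compact K -> K `<=` Y ->
  (forall z, K z -> \forall zw \near (z, w0), Y zw.1 -> P zw.1 zw.2) ->
  \forall w \near w0, forall z, K z -> P z w.
Proof.
move=> cK KY H.
have nc := (compact_near_coveringP K).1 cK.
have /(_ _) := nc W (nbhs w0) (fun w z => Y z -> P z w) _ => {}nc.
have : \forall w \near w0, K `<=` (fun z => Y z -> P z w).
  apply: nc => z Kz; have := H z Kz => -[[U1 U2] /= [n1 n2] U12].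
  exists (U1, U2) => //= -[z' w'] /= [h1 h2]; exact: (U12 (z', w')).
by apply: filterS => w Hw z Kz; apply: Hw => //; exact: KY.
Qed.

Lemma smooth_fst_comp (V W : normedModType R) (bV : fdbasis V) m k (S : set V) (z : V) (w : W) (f : V -> 'M[R]_(m, k)) :
  S z -> smooth_at S z f -> smooth_at (S `*` setT) (z, w) (fun zw : V * W => f zw.1).
Proof.
move=> Sz sf; apply: (@smooth_at_comp _ _ _ _ bV (fdmx R m k) _ S (z, w) fst f) => //.
  by apply: filterE => zw [].
exact: smooth_at_fst.
Qed.

Lemma smooth_fst_scalar (V W : normedModType R) (bV : fdbasis V) (S : set V) (z : V) (w : W) (f : V -> R) :
  S z -> smooth_at S z f -> smooth_at (S `*` setT) (z, w) (fun zw : V * W => f zw.1).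
Proof.
move=> Sz sf; apply: (@smooth_at_comp _ _ _ _ bV (fdR R) _ S (z, w) fst f) => //.
  by apply: filterE => zw [].
exact: smooth_at_fst.
Qed.

Definition bZ : fdbasis Z := fdpair bE (fdmx R 1 n).

(** With a free 3 x 3 matrix Y in place of [damp], the condition at Y = 0 is the hypothesis [relA].
    By compactness it persists for all Y in a ball of some radius r. *)
Lemma amplitude_exists : exists2 S : R, 2 <= S & forall z u, Q z ->
  row_full (col_mx (A z) (Wz z - tau z *: (damp (lcol z) u S *m Ef i0 z))).
Proof.
have H : \forall Y \near (0 : 'M[R]_3), forall z, Q z ->
    row_full (col_mx (A z) (Wz z - tau z *: (Y *m Ef i0 z))).
  apply: (@uniform_near Z 'M[R]_3 X Q 0 (fun z Y =>
    row_full (col_mx (A z) (Wz z - tau z *: (Y *m Ef i0 z))))) => // z Qz.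
  have Xz := QX Qz.
  have s : smooth_at (X `*` [set: 'M[R]_3]) (z, 0) (fun zw : Z * 'M[R]_3 =>
     col_mx (A zw.1) (Wz zw.1 - tau zw.1 *: (zw.2 *m Ef i0 zw.1))).
    apply: smooth_colmx; first by apply: (smooth_fst_comp bZ) => //; exact: sA.
    apply: smooth_atB; first by apply: (smooth_fst_comp bZ) => //; exact: smooth_Wz.
    apply: smooth_atZ; first by apply: (smooth_fst_scalar bZ) => //; exact: stau.
    apply: smooth_at_mulmx; first exact: smooth_at_snd.
    by apply: (smooth_fst_comp bZ) => //; exact: sE.
  have Xz0 : (X `*` [set: 'M[R]_3]) (z, 0) by [].
  have f0 : row_full (col_mx (A (z, 0 : 'M[R]_3).1) (Wz (z, 0 : 'M[R]_3).1 -
      tau (z, 0 : 'M[R]_3).1 *: ((z, 0 : 'M[R]_3).2 *m Ef i0 (z, 0 : 'M[R]_3).1))).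
    by rewrite /= mul0mx scaler0 subr0; exact: relA.
  have := smooth_at_nearP Xz0 s (row_full_near f0).
  by apply: filterS => zw h Xw; exact: (h (conj Xw I)).
have /nbhs_ballP[r /= r0 Hr] := H.
(* The summand 2 meets the hypothesis of [damp_bound], and 1/S < r^2 then brings the entries of
   [damp] below r. *)
pose S := 2 + (r ^- 2).
have S2 : 2 <= S by rewrite lerDl invr_ge0 exprn_ge0 // ltW.
exists S => // z u Qz; apply: Hr => //.
rewrite -ball_normE /= sub0r normrN [ltLHS]/Num.Def.normr /= mx_normrE.
apply: bigmax_lt => // -[i j] _ /=.
have := damp_bound (lcol z) u i j S2; set dd := damp _ _ _ _ _ => Hd.
rewrite -(@ltr_pXn2r _ 2) ?nnegrE ?normr_ge0 ?(ltW r0) // -normrX ger0_norm ?sqr_ge0 //.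
apply: le_lt_trans Hd _; rewrite invf_plt ?posrE ?exprn_gt0 //; last first.
  by rewrite (lt_le_trans _ S2).
by rewrite /S ltrDr.
Qed.

Variable S : R.

Definition V1 (z : Z) : frm := (chi z * S) *: (cross (lcol z) *m Wz z).
Definition V2 (z : Z) : frm := (chi z * S) *: Wz z.

Lemma smooth_V1 z : X z -> smooth_at X z V1.
Proof.
move=> Xz; apply: smooth_atZ.
  by apply: smooth_atM; [exact: schi|exact: smooth_at_cst].
by apply: smooth_at_mulmx; [apply: smooth_cross; exact: smooth_lcol|exact: smooth_Wz].
Qed.

Lemma smooth_V2 z : X z -> smooth_at X z V2.
Proof.
move=> Xz; apply: smooth_atZ; last exact: smooth_Wz.
by apply: smooth_atM; [exact: schi|exact: smooth_at_cst].
Qed.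

(* The corrugated frame and its formal derivatives, as functions of u = cos t,
   v = sin t and the wavelength e; the corrugation itself takes t = x_i0 / e. *)
Definition mA (z : Z) (u v e : R) : frm := A z + e *: ((u * v) *: V1 z + (2 * v) *: V2 z).

Definition mB (i : 'I_n) (z : Z) (u v e : R) : frm :=
  pdx A i z + e *: ((u * v) *: pdx V1 i z + (2 * v) *: pdx V2 i z)
  + (i == i0)%:R *: ((2 * u ^+ 2 - 1) *: V1 z + (2 * u) *: V2 z)
  + (1 - tau z * (i == i0)%:R) *: Ef i z.

Definition nA e (z : Z) : frm := mA z (cos (z.2 0 i0 / e)) (sin (z.2 0 i0 / e)) e.
Definition nB e i (z : Z) : frm := mB i z (cos (z.2 0 i0 / e)) (sin (z.2 0 i0 / e)) e.

Lemma smooth_phase e z : smooth_at X z (fun z => z.2 0 i0 / e).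
Proof.
apply: smooth_atM; last exact: smooth_at_cst.
by apply: (smooth_at_entry 0 i0); exact: smooth_at_snd.
Qed.

Lemma smooth_nA e z : X z -> smooth_at X z (nA e).
Proof.
move=> Xz; have sp := smooth_phase e z.
have sc := smooth_cos Xz sp; have ss := smooth_sin Xz sp.
apply: smooth_atD; first exact: sA.
apply: smooth_atZ; first exact: smooth_at_cst.
apply: smooth_atD; apply: smooth_atZ; [exact: smooth_atM|exact: smooth_V1| |exact: smooth_V2].
by apply: smooth_atM => //; exact: smooth_at_cst.
Qed.

Lemma smooth_nB e i z : X z -> smooth_at X z (nB e i).
Proof.
move=> Xz; have sp := smooth_phase e z.
have sc := smooth_cos Xz sp; have ss := smooth_sin Xz sp.
have c1 (r : R) : smooth_at X z (fun=> r) by exact: smooth_at_cst.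
apply: smooth_atD; last first.
  apply: smooth_atZ; last exact: sE.
  by apply: smooth_atB => //; apply: smooth_atM => //; exact: stau.
apply: smooth_atD.
  apply: smooth_atD; first by apply: smooth_pdx => //; exact: sA.
  apply: smooth_atZ => //.
  apply: smooth_atD; apply: smooth_atZ.
  - exact: smooth_atM.
  - by apply: smooth_pdx => //; exact: smooth_V1.
  - exact: smooth_atM.
  - by apply: smooth_pdx => //; exact: smooth_V2.
apply: smooth_atZ => //.
apply: smooth_atD; apply: smooth_atZ; [|exact: smooth_V1| |exact: smooth_V2].
  by apply: smooth_atB => //; apply: smooth_atM => //; rewrite /GRing.exp /=; exact: smooth_atM.
exact: smooth_atM.
Qed.

(** The wavelength [e] cancels against the 1/e from the phase, so in the direction [i0], and in no
    other, the oscillation contributes a term of order 1. The derivative of sin t cos t is written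
    as 2 cos^2 t - 1 to match [corr]. *)
Lemma pdx_nA e i z : e != 0 -> X z ->
  nB e i z = pdx (nA e) i z + (1 - tau z * (i == i0)%:R) *: Ef i z.
Proof.
move=> e0 Xz; congr (_ + _); rewrite /pdx /nA /mA /=.
have sA' := smooth_slice Xz (sA Xz).
have s1 := smooth_slice Xz (smooth_V1 Xz).
have s2 := smooth_slice Xz (smooth_V2 Xz).
have st : smooth_at setT z.2 (fun x : rV => x 0 i0 / e).
  apply: smooth_atM; last exact: smooth_at_cst.
  by apply: (smooth_at_entry 0 i0); exact: smooth_at_id.
have sc := smooth_cos I st; have ss := smooth_sin I st.
have c1 (r : R) : smooth_at setT z.2 (fun=> r) by exact: smooth_at_cst.
have sf1 : smooth_at setT z.2 (fun x : rV => cos (x 0 i0 / e) * sin (x 0 i0 / e)).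
  exact: smooth_atM.
have sf2 : smooth_at setT z.2 (fun x : rV => 2 * sin (x 0 i0 / e)) by exact: smooth_atM.
have sg1 := smooth_atZ sf1 s1; have sg2 := smooth_atZ sf2 s2.
have sg := smooth_atD sg1 sg2.
rewrite (pdD _ sA' (smooth_atZ (c1 e) sg)) (pd_scale _ (c1 e) sg) (pdD _ sg1 sg2).
rewrite (pd_scale _ sf1 s1) (pd_scale _ sf2 s2).
have pc (r : R) : pd (fun=> r) i z.2 = 0 by rewrite pd.unlock derive_cst.
have psin : pd (fun x : rV => sin (x 0 i0 / e)) i z.2 = cos (z.2 0 i0 / e) * ((i == i0)%:R / e).
  by rewrite -(pd_coord i0 i e z.2); apply: pd_comp1 => //; exact: is_derive_sin.
have pcos : pd (fun x : rV => cos (x 0 i0 / e)) i z.2 = - sin (z.2 0 i0 / e) * ((i == i0)%:R / e).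
  by rewrite -(pd_coord i0 i e z.2); apply: pd_comp1 => //; exact: is_derive_cos.
have pM (f h : rV -> R) : smooth_at setT z.2 f -> smooth_at setT z.2 h ->
    pd (fun x => f x * h x) i z.2 = f z.2 * pd h i z.2 + h z.2 * pd f i z.2.
  by move=> sf sh; rewrite pd.unlock; apply: deriveM; exact: smooth_at_derivable.
rewrite (pM _ _ sc ss) (pM _ _ (c1 2) ss) !pc psin pcos scale0r add0r mulr0 addr0.
case: z {Xz sA' s1 s2 st sc ss c1 sf1 sf2 sg1 sg2 sg pc psin pcos pM} => y x /=.
set co := cos _; set si := sin _.
have cs : si ^+ 2 = 1 - co ^+ 2 by apply/eqP; rewrite eq_sym subr_eq addrC -(cos2Dsin2 (x 0 i0 / e)).
move: (pd _ _ _) (pd _ _ _) (pd _ _ _) (V1 _) (V2 _) => PA P1 P2 v1 v2.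
apply/matrixP => a b; rewrite !mxE; have -> : 2 * co ^+ 2 - 1 = co ^+ 2 - si ^+ 2.
  by rewrite cs; ring.
by field.
Qed.

Lemma mA0 z u v : mA z u v 0 = A z.
Proof. by rewrite /mA scale0r addr0. Qed.

(** At [e = 0] the frame is not displaced, so only the summand of index [i0] changes, and the change
    is multiplied by [cross (lcol z)]. *)
Lemma brackets_mB0 z u v : brackets (mA z u v 0) (fun i => mB i z u v 0) =
  Wz z + cross (lcol z) *m ((chi z * S) *: (corr (lcol z) u *m Wz z) - tau z *: Ef i0 z).
Proof.
rewrite mA0 /Wz /brackets -[in RHS](eq_bigr _ (fun i _ => erefl)).
have -> : cross (lcol z) *m ((chi z * S) *: (corr (lcol z) u *m Wz z) - tau z *: Ef i0 z) =
    \sum_i cross (col i (A z)) *m ((i == i0)%:R *: ((chi z * S) *: (corr (lcol z) u *m Wz z) - tau z *: Ef i0 z)).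
  rewrite (bigD1 i0) //= eqxx scale1r big1 ?addr0 // => i /negbTE ->.
  by rewrite scale0r mulmx0.
rewrite -big_split /=; apply: eq_bigr => i _; rewrite -mulmxDr; congr (_ *m _).
rewrite /mB scale0r addr0 /formalB /corr /V1 /V2.
have -> : ((2 * u ^+ 2 - 1) *: cross (lcol z) + (2 * u)%:M) *m Wz z =
  (2 * u ^+ 2 - 1) *: (cross (lcol z) *m Wz z) + (2 * u) *: Wz z.
  by rewrite mulmxDl -scalemxAl mul_scalar_mx.
have [->|ii] := eqVneq i i0.
  move: (pdx A i0 z) (Ef i0 z) (Wz z) (cross (lcol z) *m Wz z) => PA Ez W cW.
  by rewrite /nat_of_bool mulr1n mulr1 !scale1r; apply/matrixP => a b; rewrite !mxE; ring.
by rewrite mulr0 subr0 !scale0r scale1r !addr0.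
Qed.

Hypothesis S2 : 2 <= S.
Hypothesis HS : forall z u, Q z ->
  row_full (col_mx (A z) (Wz z - tau z *: (damp (lcol z) u S *m Ef i0 z))).

Lemma step2_mB0 z u v : Q z -> step2_frame (mA z u v 0) (fun i => mB i z u v 0).
Proof.
move=> Qz; have S0 : 0 <= S by rewrite (le_trans _ S2).
rewrite /step2_frame brackets_mB0 mA0.
(* Where [tau] vanishes the formal derivative is only corrugated, and every amplitude [chi z * S] is
   admissible since the matrix N stays invertible. Where [tau] is nonzero the amplitude is the full
   [S], for which the defect is damped enough. *)
have [t0|t0] := eqVneq (tau z) 0.
  rewrite t0 scale0r subr0.
  have -> : Wz z + cross (lcol z) *m ((chi z * S) *: (corr (lcol z) u *m Wz z)) =
      (1%:M + (chi z * S) *: (cross (lcol z) *m corr (lcol z) u)) *m Wz z.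
    by rewrite mulmxDl mul1mx -scalemxAl -scalemxAr mulmxA.
  rewrite row_full_corr; first exact: relA.
  by apply: corr_unit; rewrite mulr_ge0.
rewrite (chi1 t0) mul1r.
have -> : Wz z + cross (lcol z) *m (S *: (corr (lcol z) u *m Wz z) - tau z *: Ef i0 z) =
   (1%:M + S *: (cross (lcol z) *m corr (lcol z) u)) *m
   (Wz z - tau z *: (damp (lcol z) u S *m Ef i0 z)).
  have dE : (1%:M + S *: (cross (lcol z) *m corr (lcol z) u)) *m (damp (lcol z) u S *m Ef i0 z) =
      cross (lcol z) *m Ef i0 z by rewrite mulmxA dampE.
  rewrite [in RHS]mulmxBr -[in RHS]scalemxAr dE [in LHS]mulmxBr -!scalemxAr (mulmxDl 1%:M) mul1mx -scalemxAl.
  by rewrite addrA mulmxA.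
by rewrite row_full_corr; [exact: HS|exact: corr_unit].
Qed.

Local Notation Y := (Z * (R * R))%type.
(** The phase x_i0 / e has no limit as e tends to 0. With its cosine and sine as free variables in
    [-1, 1], the model is smooth in e up to e = 0 and compactness provides one wavelength for all
    points and all phases. *)
Definition QY : set Y := Q `*` (`[-1, 1]%classic `*` `[-1, 1]%classic).
Definition XY : set Y := X `*` setT.
Definition bRR : fdbasis (R * R)%type := fdpair (fdR R) (fdR R).
Definition bY : fdbasis Y := fdpair bZ bRR.

Lemma compact_QY : compact QY.
Proof. by apply: compact_setX => //; apply: compact_setX; exact: segment_compact. Qed.

Lemma QYX : QY `<=` XY.
Proof. by move=> [z uv] [Qz _]; split=> //; exact: QX. Qed.

Section Model.
Variables (y : Y) (e0 : R).
Hypothesis Xy : XY y.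
Local Notation XR := (XY `*` [set: R] : set (Y * R)).

Lemma XR_y : XR (y, e0). Proof. by []. Qed.

Lemma smooth_lift m k (f : Z -> 'M[R]_(m, k)) : (forall z, X z -> smooth_at X z f) ->
  smooth_at XR (y, e0) (fun w => f w.1.1).
Proof.
move=> sf; have [Xz _] := Xy.
have H := @smooth_fst_comp Z (R * R)%type bZ m k X y.1 y.2 f Xz (sf _ Xz).
rewrite -surjective_pairing in H.
exact: (@smooth_fst_comp Y R bY m k XY y e0 (fun w => f w.1) Xy H).
Qed.

Lemma smooth_lift1 (f : Z -> R) : (forall z, X z -> smooth_at X z f) ->
  smooth_at XR (y, e0) (fun w => f w.1.1).
Proof.
move=> sf; have [Xz _] := Xy.
have H := @smooth_fst_scalar Z (R * R)%type bZ X y.1 y.2 f Xz (sf _ Xz).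
rewrite -surjective_pairing in H.
exact: (@smooth_fst_scalar Y R bY XY y e0 (fun w => f w.1) Xy H).
Qed.

Lemma smooth_uv (f : R * R -> R) : (forall q, smooth_at setT q f) ->
  smooth_at XR (y, e0) (fun w => f w.1.2).
Proof.
move=> sf.
have H : smooth_at XY y (fun q : Y => f q.2).
  apply: (@smooth_at_comp _ _ _ _ bRR (fdR R) XY setT y snd f) => //.
    exact: filterE.
  exact: smooth_at_snd.
exact: (@smooth_fst_scalar Y R bY XY y e0 (fun w => f w.2) Xy H).
Qed.

Lemma smooth_u : smooth_at XR (y, e0) (fun w => w.1.2.1).
Proof. by apply: (smooth_uv (f := fst)) => q; exact: smooth_at_fst. Qed.

Lemma smooth_v : smooth_at XR (y, e0) (fun w => w.1.2.2).
Proof. by apply: (smooth_uv (f := snd)) => q; exact: smooth_at_snd. Qed.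

Lemma smooth_mA : smooth_at XR (y, e0) (fun w => mA w.1.1 w.1.2.1 w.1.2.2 w.2).
Proof.
apply: smooth_atD; first exact: smooth_lift sA.
apply: smooth_atZ; first exact: smooth_at_snd.
apply: smooth_atD; apply: smooth_atZ.
- by apply: smooth_atM; [exact: smooth_u|exact: smooth_v].
- exact: smooth_lift smooth_V1.
- by apply: smooth_atM; [exact: smooth_at_cst|exact: smooth_v].
- exact: smooth_lift smooth_V2.
Qed.

Lemma smooth_mB i : smooth_at XR (y, e0) (fun w => mB i w.1.1 w.1.2.1 w.1.2.2 w.2).
Proof.
have c1 (r : R) : smooth_at XR (y, e0) (fun=> r) by exact: smooth_at_cst.
apply: smooth_atD; last first.
  apply: smooth_atZ; last exact: smooth_lift (sE i).
  by apply: smooth_atB => //; apply: smooth_atM => //; exact: smooth_lift1 stau.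
apply: smooth_atD.
  apply: smooth_atD; first by apply: smooth_lift => z Xz; apply: smooth_pdx => //; exact: sA.
  apply: smooth_atZ; first exact: smooth_at_snd.
  apply: smooth_atD; apply: smooth_atZ.
  - by apply: smooth_atM; [exact: smooth_u|exact: smooth_v].
  - by apply: smooth_lift => z Xz; apply: smooth_pdx => //; exact: smooth_V1.
  - by apply: smooth_atM => //; exact: smooth_v.
  - by apply: smooth_lift => z Xz; apply: smooth_pdx => //; exact: smooth_V2.
apply: smooth_atZ => //.
have su := smooth_u.
apply: smooth_atD; apply: smooth_atZ.
- apply: smooth_atB => //; apply: smooth_atM => //.
  exact: (smooth_atM su su).
- exact: smooth_lift smooth_V1.
- exact: smooth_atM.
- exact: smooth_lift smooth_V2.
Qed.

End Model.

Lemma corrugation_step2 : \forall e \near (0 : R), forall y, QY y ->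
  row_free (mA y.1 y.2.1 y.2.2 e) /\
  step2_frame (mA y.1 y.2.1 y.2.2 e) (fun i => mB i y.1 y.2.1 y.2.2 e).
Proof.
apply: (@uniform_near Y R XY QY 0 (fun y e => row_free (mA y.1 y.2.1 y.2.2 e) /\
  step2_frame (mA y.1 y.2.1 y.2.2 e) (fun i => mB i y.1 y.2.1 y.2.2 e))).
- exact: compact_QY.
- exact: QYX.
move=> y Qy; have Xy := QYX Qy; have XR0 := XR_y 0 Xy.
have sm := smooth_mA 0 Xy.
have f0 : row_free (mA (y, 0 : R).1.1 (y, 0 : R).1.2.1 (y, 0 : R).1.2.2 (y, 0 : R).2).
  by rewrite /= mA0; apply: fA; case: Qy.
have n1 := smooth_at_nearP XR0 sm (row_free_near f0).
have sb : smooth_at (XY `*` [set: R]) (y, 0) (fun w => col_mx (mA w.1.1 w.1.2.1 w.1.2.2 w.2)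
    (brackets (mA w.1.1 w.1.2.1 w.1.2.2 w.2) (fun i => mB i w.1.1 w.1.2.1 w.1.2.2 w.2))).
  apply: smooth_colmx => //.
  apply: (@smooth_brackets _ _ _ _ (fun i w => mB i w.1.1 w.1.2.1 w.1.2.2 w.2)) => // i.
  exact: smooth_mB.
have r0 := @step2_mB0 y.1 y.2.1 y.2.2 Qy.1.
have n2 := smooth_at_nearP XR0 sb (row_full_near r0).
by apply: filterS2 n1 n2 => w h1 h2 Xw; split; [apply: h1|apply: h2].
Qed.

Definition qform (G : 'M[R]_n) (u : 'rV[R]_n) : R := (u *m G *m u^T) 0 0.

Variables (P0 Gm : Z -> 'M[R]_n) (eb : Z -> R).
Hypothesis sP0 : forall z, X z -> smooth_at X z P0.
Hypothesis sGm : forall z, X z -> smooth_at X z Gm.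
Hypothesis eb0 : forall z, 0 < eb z.
Hypothesis Gm0 : forall z u, X z -> 0 <= qform (Gm z) u.
Hypothesis eb_lsc : forall z (r : R), X z -> r < eb z -> \forall z' \near z, X z' -> r < eb z'.

(** [planes_close] for the span of [B] and the row space of [P0], in terms of the coefficients [w]
    of a vector and with squared norms, so that no square root spoils smoothness. *)
Definition frame_close (z : Z) (B : frm) : Prop := forall w : 'rV[R]_3, w != 0 ->
  exists w0 : 'rV[R]_n, qform (Gm z) (w *m B - w0 *m P0 z) < eb z ^+ 2 * qform (Gm z) (w *m B).

Hypothesis clA : forall z, Q z -> frame_close z (A z).

Lemma corrugation_close : \forall e \near (0 : R), forall y, QY y ->
  frame_close y.1 (mA y.1 y.2.1 y.2.2 e).
Proof.
(* The condition is homogeneous in [w], so unit vectors suffice, and these form a compact set. *)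
pose Sph : set 'rV[R]_3 := [set w | `|w| = 1].
have cSph : compact Sph.
  apply: bounded_closed_compact.
    by exists 1; split => // r r1 w /= ->; exact: ltW.
  apply: (@closed_comp _ _ (fun w : 'rV[R]_3 => `|w|) [set r | r = 1]).
    by move=> w _; exact: norm_continuous.
  exact: closed_eq.
pose Q2 : set (Y * 'rV[R]_3) := QY `*` Sph.
pose X2 : set (Y * 'rV[R]_3) := XY `*` setT.
have cQ2 : compact Q2 by apply: compact_setX => //; exact: compact_QY.
have QX2 : Q2 `<=` X2 by move=> [y w] [Qy _]; split=> //; exact: QYX.
pose P (yw : Y * 'rV[R]_3) (e : R) := exists w0 : 'rV[R]_n,
  qform (Gm yw.1.1) (yw.2 *m mA yw.1.1 yw.1.2.1 yw.1.2.2 e - w0 *m P0 yw.1.1) <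
  eb yw.1.1 ^+ 2 * qform (Gm yw.1.1) (yw.2 *m mA yw.1.1 yw.1.2.1 yw.1.2.2 e).
have : \forall e \near (0 : R), forall yw, Q2 yw -> P yw e.
  apply: (@uniform_near _ _ X2) => // -[y w] [Qy /= w1].
  have Xy := QYX Qy.
  have wn : w != 0 by rewrite -normr_eq0 w1 oner_eq0.
  have [w0 Hw0] := clA Qy.1 wn.
  set G := Gm y.1 in Hw0; set q1 := qform G _ in Hw0; set q2 := qform G (w *m A y.1) in Hw0.
  (* [eb] is only semicontinuous, so it is replaced by a constant [r] slightly below its value; the
     strict inequality leaves room for this, and [eb] exceeds [r] nearby. *)
  have [r [r0 re rq]] : exists r, [/\ 0 < r, r < eb y.1 & q1 < r ^+ 2 * q2].
    have cf : (fun r : R => r ^+ 2 * q2) @ (eb y.1)^'- --> eb y.1 ^+ 2 * q2.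
      apply: cvg_at_left_filter; apply: cvgM; last exact: cvg_cst.
      exact: (cvgM (@cvg_id _ _) (@cvg_id _ _)).
    have H1 : \forall r \near (eb y.1)^'-, q1 < r ^+ 2 * q2.
      by apply: (cf (fun x => q1 < x)); exact: lt_nbhsr.
    have H2 : \forall r \near (eb y.1)^'-, 0 < r by exact: nbhs_left_gt.
    have H3 : \forall r \near (eb y.1)^'-, r < eb y.1 by exact: nbhs_left_lt.
    by have [r [h1 [h2 h3]]] := filter_ex (filterI H1 (filterI H2 H3)); exists r.
  pose Wm (v : (Y * 'rV[R]_3) * R) := v.1.2 *m mA v.1.1.1 v.1.1.2.1 v.1.1.2.2 v.2.
  pose pi1 (v : (Y * 'rV[R]_3) * R) : Y * R := (v.1.1, v.2).
  have sA2 : smooth_at (X2 `*` setT) ((y, w), 0 : R) (fun v => mA v.1.1.1 v.1.1.2.1 v.1.1.2.2 v.2).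
    apply: (@smooth_at_comp _ _ _ _ (fdpair bY (fdR R)) (fdmx R 3 n) _ (XY `*` setT)
      ((y, w), 0 : R) pi1 (fun v => mA v.1.1 v.1.2.1 v.1.2.2 v.2)) => //.
    - by apply: filterE => v [[]].
    - apply: (smooth_at_pair bY (fdR R)); last exact: smooth_at_snd.
      apply: (@smooth_at_comp _ _ _ _ (fdpair bY (fdmx R 1 3)) bY _ setT ((y, w), 0 : R) fst fst) => //.
      + exact: filterE.
      + exact: smooth_at_fst.
      + exact: smooth_at_fst.
    - exact: smooth_mA.
  have lf m k (f : Z -> 'M[R]_(m, k)) : (forall z, X z -> smooth_at X z f) ->
      smooth_at (X2 `*` setT) ((y, w), 0 : R) (fun v => f v.1.1.1).
    move=> sf.
    apply: (@smooth_at_comp _ _ _ _ (fdpair bY (fdR R)) (fdmx R m k) _ (XY `*` setT)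
      ((y, w), 0 : R) pi1 (fun v => f v.1.1)) => //.
    - by apply: filterE => v [[]].
    - apply: (smooth_at_pair bY (fdR R)); last exact: smooth_at_snd.
      apply: (@smooth_at_comp _ _ _ _ (fdpair bY (fdmx R 1 3)) bY _ setT ((y, w), 0 : R) fst fst) => //.
      + exact: filterE.
      + exact: smooth_at_fst.
      + exact: smooth_at_fst.
    - exact: smooth_lift.
  have sw : smooth_at (X2 `*` setT) ((y, w), 0 : R) (fun v => v.1.2).
    apply: (@smooth_at_comp _ _ _ _ (fdpair bY (fdmx R 1 3)) (fdmx R 1 3) _ setT ((y, w), 0 : R) fst snd) => //.
    + exact: filterE.
    + exact: smooth_at_fst.
    + exact: smooth_at_snd.
  have sWm : smooth_at (X2 `*` setT) ((y, w), 0 : R) Wm by exact: smooth_at_mulmx.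
  have sq f : smooth_at (X2 `*` setT) ((y, w), 0 : R) f ->
      smooth_at (X2 `*` setT) ((y, w), 0 : R) (fun v => qform (Gm v.1.1.1) (f v)).
    move=> sf; apply: smooth_at_entry; apply: smooth_at_mulmx; last exact: smooth_at_trmx.
    by apply: smooth_at_mulmx => //; exact: (lf _ _ Gm).
  have c1 (a : R) : smooth_at (X2 `*` setT) ((y, w), 0 : R) (fun=> a) by exact: smooth_at_cst.
  have sd : smooth_at (X2 `*` setT) ((y, w), 0 : R) (fun v => r ^+ 2 * qform (Gm v.1.1.1) (Wm v)
      - qform (Gm v.1.1.1) (Wm v - w0 *m P0 v.1.1.1)).
    apply: smooth_atB; first by apply: smooth_atM => //; exact: sq.
    apply: (sq (fun v => Wm v - w0 *m P0 v.1.1.1)).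
    apply: smooth_atB => //; apply: smooth_at_mulmx; first exact: smooth_at_cst.
    exact: (lf _ _ P0).
  have X0 : (X2 `*` setT) ((y, w), 0 : R) by [].
  have p0 : 0 < r ^+ 2 * qform (Gm y.1) (Wm ((y, w), 0))
      - qform (Gm y.1) (Wm ((y, w), 0) - w0 *m P0 y.1).
    by rewrite subr_gt0 /Wm /= mA0.
  have n1 := smooth_at_nearP X0 sd (lt_nbhsr p0).
  have sz : smooth_at (X2 `*` setT) ((y, w), 0 : R) (fun v => v.1.1.1).
    apply: (@smooth_at_comp _ _ _ _ bY bZ _ setT ((y, w), 0 : R) (fun v => v.1.1) fst) => //.
    - exact: filterE.
    - apply: (@smooth_at_comp _ _ _ _ (fdpair bY (fdmx R 1 3)) bY _ setT ((y, w), 0 : R) fst fst) => //.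
      + exact: filterE.
      + exact: smooth_at_fst.
      + exact: smooth_at_fst.
    - exact: smooth_at_fst.
  have n2 := smooth_at_nearP X0 sz (eb_lsc Xy.1 re).
  apply: nbhs_prod_normed; apply: filterS2 n1 n2 => v h1 h2 Xv.
  exists w0; have := h1 (conj Xv I); rewrite subr_gt0 => {}h1; apply: lt_le_trans h1 _.
  have [Xy' _] := (Xv.1); apply: ler_wpM2r; first exact: Gm0.
  by apply: lerXn2r; rewrite ?nnegrE ?(ltW r0) ?(ltW (eb0 _)) ?(ltW (h2 (conj Xv I) Xy')).
apply: filterS => e He y Qy w wn.
have Nw : `|w| != 0 by rewrite normr_eq0.
have Sw : Sph (`|w|^-1 *: w) by rewrite /Sph /= normrZ normfV normr_id mulVf.
have [w0] := He (y, `|w|^-1 *: w) (conj Qy Sw).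
rewrite /P /= => H; exists (`|w| *: w0).
have qZ G c (u : 'rV[R]_n) : qform G (c *: u) = c ^+ 2 * qform G u.
  by rewrite /qform linearZ /= -!scalemxAl -scalemxAr !mxE mulrA.
have wE : w = `|w| *: (`|w|^-1 *: w) by rewrite scalerA divff // scale1r.
move: (`|w|^-1 *: w) H wE => u H wE.
have -> : w *m mA y.1 y.2.1 y.2.2 e = `|w| *: (u *m mA y.1 y.2.1 y.2.2 e).
  by rewrite scalemxAl -wE.
have cp : 0 < `|w| ^+ 2 by rewrite exprn_gt0 // normr_gt0.
rewrite -!scalemxAl -scalerBr !qZ.
by rewrite (mulrCA (eb _ ^+ 2) (`|w| ^+ 2)) (ltr_pM2l cp).
Qed.

End Corrugation.

Section CorrugationSummary.
Variables (R : realType) (n : nat) (E : normedModType R) (bE : fdbasis E).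
Local Notation rV := 'rV[R]_n.
Local Notation frm := 'M[R]_(3, n).
Local Notation Z := (E * rV)%type.

Lemma corrugation_off (A : Z -> frm) (Ef : 'I_n -> Z -> frm) (chi tau : Z -> R) i0 S e i z :
  (forall z, tau z != 0 -> chi z = 1) -> (\forall x \near z.2, chi (z.1, x) = 0) ->
  nA A Ef chi i0 S e z = A z /\ nB A Ef chi tau i0 S e i z = formalB A Ef i z.
Proof.
case: z => y x chi1 /= chi0; have c0 := nbhs_singleton chi0.
have t0 : tau (y, x) = 0.
  by apply/eqP/negPn/negP => /chi1; rewrite c0 => /eqP; rewrite eq_sym oner_eq0.
have V10 : V1 A Ef chi i0 S (y, x) = 0 by rewrite /V1 c0 mul0r scale0r.
have V20 : V2 A Ef chi S (y, x) = 0 by rewrite /V2 c0 mul0r scale0r.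
have p1 : pdx (V1 A Ef chi i0 S) i (y, x) = 0.
  rewrite /pdx (@pd_near _ _ _ _ (fun=> 0)); first by rewrite pd.unlock derive_cst.
  by apply: filterS chi0 => x' c0'; rewrite /V1 c0' mul0r scale0r.
have p2 : pdx (V2 A Ef chi S) i (y, x) = 0.
  rewrite /pdx (@pd_near _ _ _ _ (fun=> 0)); first by rewrite pd.unlock derive_cst.
  by apply: filterS chi0 => x' c0'; rewrite /V2 c0' mul0r scale0r.
rewrite /nA /nB /mA /mB /formalB p1 p2 V10 V20 t0 !scaler0 addr0 !scaler0 !addr0.
by rewrite mul0r subr0 scale1r.
Qed.

(** The interface to the geometric part, with amplitude and wavelength eliminated. By the last
    clause the defects in directions other than [i0] are unchanged, so directions that are already
    holonomic remain so. *)
Theorem corrugation (D : set E) (O : set rV) (A : Z -> frm) (Ef : 'I_n -> Z -> frm)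
    (chi tau : Z -> R) (i0 : 'I_n) (Q : set Z) (P0 Gm : Z -> 'M[R]_n) (eb : Z -> R) :
  let X := D `*` O : set Z in
  open O ->
  (forall z, X z -> smooth_at X z A) -> (forall i z, X z -> smooth_at X z (Ef i)) ->
  (forall z, X z -> smooth_at X z chi) -> (forall z, X z -> smooth_at X z tau) ->
  (forall z, 0 <= chi z) -> (forall z, tau z != 0 -> chi z = 1) ->
  compact Q -> Q `<=` X -> (forall z, Q z -> row_free (A z)) ->
  (forall z, Q z -> step2_frame (A z) (formalB A Ef ^~ z)) ->
  (forall z, X z -> smooth_at X z P0) -> (forall z, X z -> smooth_at X z Gm) ->
  (forall z, 0 < eb z) -> (forall z u, X z -> 0 <= qform (Gm z) u) ->
  (forall z r, X z -> r < eb z -> \forall z' \near z, X z' -> r < eb z') ->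
  (forall z, Q z -> frame_close P0 Gm eb z (A z)) ->
  exists (a : Z -> frm) (B : 'I_n -> Z -> frm),
  [/\ forall z, X z -> smooth_at X z a /\ forall i, smooth_at X z (B i),
      forall z, Q z -> [/\ row_free (a z), step2_frame (a z) (B ^~ z) & frame_close P0 Gm eb z (a z)],
      forall z i, (\forall x \near z.2, chi (z.1, x) = 0) ->
        a z = A z /\ B i z = formalB A Ef i z &
      forall z i, X z -> B i z = pdx a i z + (1 - tau z * (i == i0)%:R) *: Ef i z].
Proof.
move=> X oO sA sE schi stau chi0 chi1 cQ QX fA relA sP0 sGm eb0 Gm0 ebl clA.
have [S S2 HS] := amplitude_exists bE oO i0 sA sE stau cQ QX relA.
have N1 := corrugation_step2 bE oO sA sE schi stau chi0 chi1 cQ QX fA relA S2 HS.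
have N2 := corrugation_close bE oO i0 sA sE schi cQ QX S sP0 sGm eb0 Gm0 ebl clA.
have [r /= r0 Hr] := (nbhs_ballP _ _).1 (filterI N1 N2).
pose e := r / 2; have e0 : e != 0 by rewrite gt_eqF // divr_gt0.
have re : ball (0 : R) r e.
  rewrite -ball_normE /= sub0r normrN gtr0_norm ?divr_gt0 //.
  by rewrite ltr_pdivrMr // mulr_natr mulr2n ltrDl.
have [H1 H2] := Hr _ re.
exists (nA A Ef chi i0 S e), (nB A Ef chi tau i0 S e); split.
- by move=> z Xz; split=> [|i]; [exact: (smooth_nA oO)|exact: (smooth_nB oO)].
- move=> z Qz.
  have Qy : QY Q (z, (cos (z.2 0 i0 / e), sin (z.2 0 i0 / e))).
    by split=> //; split=> /=; rewrite in_itv /= ?cos_geN1 ?cos_le1 ?sin_geN1 ?sin_le1.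
  by have [h1 h2] := H1 _ Qy; split=> //; exact: (H2 _ Qy).
- by move=> z i c0; exact: corrugation_off.
- by move=> z i Xz; exact: (pdx_nA bE oO tau i0 sA sE schi S i e0 Xz).
Qed.

End CorrugationSummary.

(** * One corrugation in a patch *)

Section Boxes.
Variables (R : realType) (n : nat) (H : set 'rV[R]_n) (M : manifold H).
Hypothesis cH : closed H.

Definition cbox (c : chart R n M) a r : set M := [set p | cdom c p /\ `|cfun c p - a| <= r].

Lemma cimg_sub (c : chart R n M) : atlas c -> cimg c `<=` H.
Proof. by move=> /chart_img[Q _ ->] x []. Qed.

Lemma compact_cball a r : compact [set x | H x /\ `|x - a| <= r].
Proof.
apply: bounded_closed_compact.
  exists (r + `|a|); split; first by rewrite num_real.
  move=> t rt x [_ xa]; apply: le_trans (ltW rt).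
  by rewrite -[x](subrK a) (le_trans (ler_normD _ _)) // lerD2r.
apply: closedI => //.
apply: (@closed_comp _ _ (fun x : 'rV[R]_n => `|x - a|) [set t | t <= r]); last exact: closed_le.
move=> x _; apply: (@continuous_comp _ _ _ (fun x : 'rV[R]_n => x - a) (fun x : 'rV[R]_n => `|x|)).
  exact: (cvgB (@cvg_id _ _) (@cvg_cst _ _ _ _ _)).
exact: norm_continuous.
Qed.

Lemma compact_cbox (c : chart R n M) a r : atlas c ->
  (forall x, H x -> `|x - a| <= r -> cimg c x) -> compact (cbox c a r).
Proof.
move=> ac Hc.
have -> : cbox c a r = cinv c @` [set x | H x /\ `|x - a| <= r].
  apply/seteqP; split=> [p [cp pa]|_ [x [Hx xa] <-]].
    exists (cfun c p); last by rewrite (chart_cancel ac) ?inE.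
    by split=> //; apply: (cimg_sub ac); exists p.
  have [p cp px] := Hc _ Hx xa; rewrite -px (chart_cancel ac) ?inE //.
  by split=> //; rewrite px.
apply: continuous_compact; last exact: compact_cball.
apply: continuous_subspaceW (chart_inv_continuous ac) => x [Hx xa]; exact: Hc.
Qed.

Lemma closed_cbox (c : chart R n M) a r : atlas c ->
  (forall x, H x -> `|x - a| <= r -> cimg c x) -> closed (cbox c a r).
Proof.
move=> ac Hc; apply: compact_closed; first exact: manifold_hausdorff.
exact: compact_cbox.
Qed.

End Boxes.

Lemma closed_halfspace (R : realType) m : closed (@halfspace R m).
Proof.
have -> : @halfspace R m = \bigcap_(i in [set i : 'I_m | nat_of_ord i = 0%N])
    [set x : 'rV[R]_m | 0 <= x 0 i].
  by apply/seteqP; split=> x Hx i; exact: Hx.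
apply: closed_bigI => i _.
apply: (@closed_comp _ _ (fun x : 'rV[R]_m => x 0 i) [set t | 0 <= t]); last exact: closed_ge.
by move=> x _; exact: coord_continuous.
Qed.

(** * The metric and closeness of planes in charts *)

Section Metric.
Variables (R : realType) (n : nat) (M : @manifold R n setT).
Hypothesis n3 : (3 <= n)%N.
Variable g : M -> 'M[R]_n.
Hypothesis rg : riemannian_metric g.
Implicit Types (c d : chart R n M) (p q : M).
Local Notation rV := 'rV[R]_n.
Local Notation frm := 'M[R]_(3, n).

Lemma qform_gt0 p (u : rV) : u != 0 -> 0 < qform (g p) u.
Proof. by move=> u0; have [_ H _] := rg; exact: H. Qed.

Lemma qform_ge0 p (u : rV) : 0 <= qform (g p) u.
Proof.
have [->|u0] := eqVneq u 0; first by rewrite /qform mul0mx mul0mx mxE.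
exact: ltW (qform_gt0 p u0).
Qed.

Definition chart_metric c (x : rV) : 'M[R]_n :=
  invmx (tco c (cinv c x)) *m g (cinv c x) *m (invmx (tco c (cinv c x)))^T.

Lemma chart_metric_smooth c x : atlas c -> cimg c x -> smooth_at (cimg c) x (chart_metric c).
Proof.
move=> ac cx; case: rg => _ _ /(_ c ac x cx).
by rewrite /chart_metric tco.unlock.
Qed.

Lemma chart_metricE c x (u : rV) :
  qform (chart_metric c x) u = qform (g (cinv c x)) (u *m invmx (tco c (cinv c x))).
Proof. by rewrite /qform /chart_metric trmx_mul !mulmxA. Qed.

Lemma chart_metric_ge0 c x (u : rV) : 0 <= qform (chart_metric c x) u.
Proof. by rewrite chart_metricE qform_ge0. Qed.

Lemma gnorm_lt p e (u v : rV) : 0 < e ->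
  (gnorm (g p) u < e * gnorm (g p) v) = (qform (g p) u < e ^+ 2 * qform (g p) v).
Proof.
move=> e0; rewrite /gnorm -!/(qform _ _).
rewrite -[LHS](@ltr_pXn2r _ 2) ?nnegrE ?sqrtr_ge0 ?mulr_ge0 ?sqrtr_ge0 ?(ltW e0) //.
by rewrite exprMn !sqr_sqrtr ?qform_ge0.
Qed.

Lemma J1_gr c p (J : jet M) xi eta : atlas c -> cdom c p -> J1 3 p J -> J xi -> J eta ->
  gr xi c (cfun c p) = gr eta c (cfun c p).
Proof.
move=> ac cp [z dz ->] /(j1P _ ac cp dz)[_ [E1 _]] /(j1P _ ac cp dz)[_ [E2 _]].
exact: etrans E1 (esym E2).
Qed.

Lemma planes_close_frame c p (J J0 : jet M) e (A : frm) B :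
  atlas c -> cdom c p -> 0 < e -> is_frame J c p A B -> J1 3 p J0 ->
  (forall xi eta, J xi -> J0 eta -> planes_close (g p) e (xi p) (eta p)) <->
  (forall w : 'rV[R]_3, w != 0 -> exists w0 : rV,
    qform (chart_metric c (cfun c p)) (w *m A - w0 *m gr (rep J0) c (cfun c p)) <
    e ^+ 2 * qform (chart_metric c (cfun c p)) (w *m A)).
Proof.
move=> ac cp e0 fr JJ0; have [fA JJ _] := fr.
have U := tco_unit ac cp; have [_ J0r _] := J1_rep JJ0; have [_ Jr _] := J1_rep JJ.
set P0 := gr _ _ _; split=> [H w w0|H xi eta Jxi J0eta u uxi u0].
  have AE := is_frame_eqmx ac cp fr Jr.
  pose u := w *m A *m invmx (tco c p).
  have uxi : (u <= rep J p)%MS.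
    rewrite -(mulmxK U (rep J p)) submxMr //.
    by rewrite -AE submxMl.
  have uE : u *m tco c p = w *m A by rewrite mulmxKV.
  have un : u != 0.
    apply: contraNneq w0 => u0; rewrite u0 mul0mx in uE.
    by rewrite -(mulmx1 w) -(mulmxVp fA) mulmxA -uE mul0mx.
  have [v vW] := H _ _ Jr J0r u uxi un.
  have vP : (v *m tco c p <= P0)%MS.
    by rewrite /P0 (gr_eqmx (rep J0) c (cfun c p)) cfunK // submxMr.
  have /submxP[D DE] := vP; rewrite gnorm_lt // => h; exists D.
  by rewrite !chart_metricE cfunK // -DE -uE -mulmxBl !mulmxK.
have AE := is_frame_eqmx ac cp fr Jxi.
have : (u *m tco c p <= A)%MS by rewrite AE submxMr.
move=> /submxP[w wE]; have wn : w != 0.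
  apply: contraNneq u0 => w0; rewrite -(mulmxK U u) wE w0 !mul0mx; exact: eqxx.
have [w0 h] := H w wn; exists (w0 *m P0 *m invmx (tco c p)).
  rewrite -(mulmxK U (eta p)) submxMr //.
  have := gr_eqmx eta c (cfun c p); rewrite cfunK // => <-.
  by rewrite -(J1_gr ac cp JJ0 J0r J0eta) submxMl.
rewrite gnorm_lt //; move: h; rewrite !chart_metricE cfunK // -wE mulmxK // mulmxBl mulmxK //.
Qed.

End Metric.

Section CloseFree.
Variables (R : realType) (n : nat).
Local Notation frm := 'M[R]_(3, n).

(* Row spaces at distance at most 1 are not orthogonal: if v in the span of A1
   is orthogonal to the span of A0, then |v - w|^2 = |v|^2 + |w|^2 for all w in
   the span of A0. *)
Lemma row_free_close (G P0 P : 'M[R]_n) (A0 A1 : frm) e : G^T = G ->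
  (forall u : 'rV[R]_n, 0 <= qform G u) -> 0 < e <= 1 ->
  (P0 <= A0)%MS -> A1 *m P = A1 -> P^T = P ->
  (forall w : 'rV[R]_3, w != 0 -> exists w0 : 'rV[R]_n,
    qform G (w *m A1 - w0 *m P0) < e ^+ 2 * qform G (w *m A1)) ->
  row_free (A0 *m G *m P).
Proof.
move=> Gs G0 /andP[e0 e1] PA A1P Ps H.
have U : row_free (A1 *m G *m A0^T).
  rewrite -kermx_eq0; apply/negPn/negP => /rowV0Pn[w wK wn].
  have wk : w *m (A1 *m G *m A0^T) = 0 by apply/sub_kermxP.
  have [w0] := H w wn; have [T TE] : exists T, w0 *m P0 = T *m A0.
    by apply/submxP; apply: submx_trans PA; exact: submxMl.
  rewrite TE; set v := w *m A1.
  have vA : v *m G *m (T *m A0)^T = 0.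
    rewrite /v trmx_mul mulmxA (_ : w *m A1 *m G *m A0^T = 0) ?mul0mx //.
    by rewrite -[RHS]wk !mulmxA.
  have vA' : T *m A0 *m G *m v^T = 0.
    by apply: trmx_inj; rewrite trmx0 -vA !trmx_mul !trmxK Gs !mulmxA.
  have -> : qform G (v - T *m A0) = qform G v + qform G (T *m A0).
    rewrite /qform linearB /= !mulmxBl !mulmxBr vA vA' subr0 sub0r opprK.
    by rewrite mxE.
  rewrite ltNge => /negP; apply.
  rewrite (@le_trans _ _ (qform G v)) ?lerDl //.
  by rewrite ler_piMl // expr_le1 // ltW.
have : row_free (A0 *m G *m P *m A1^T).
  have -> : A0 *m G *m P *m A1^T = (A1 *m G *m A0^T)^T.
    by rewrite !trmx_mul trmxK Gs -(mulmxA _ P) -{1}Ps -trmx_mul A1P mulmxA.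
  by rewrite row_free_unit unitmx_tr -row_free_unit.
rewrite /row_free => /eqP r3; rewrite eqn_leq rank_leq_row /=.
by have := mxrankM_maxl (A0 *m G *m P) A1^T; rewrite r3.
Qed.

End CloseFree.

Section Step.
Variables (R : realType) (n : nat) (M : @manifold R n setT).
Hypothesis n3 : (3 <= n)%N.
Variable g : M -> 'M[R]_n.
Hypothesis rg : riemannian_metric g.
Variable eps : M -> R.
Hypothesis ceps : continuous eps.
Hypothesis eps01 : forall p, 0 < eps p <= 1.
Variables (m : nat) (K : @manifold R m (@halfspace R m)).
Local Notation rV := 'rV[R]_n.
Local Notation frm := 'M[R]_(3, n).
Local Notation par := (R * 'rV[R]_m)%type.
Local Notation pardom d := (`[0, 1] `*` cimg d : set par).
Local Notation Z := (par * rV)%type.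
Implicit Types (F : R -> K -> M -> jet M) (c : chart R n M) (d : chart R m K).

Definition good F : Prop := formal_homotopy (@step2 R n M 3) F /\
  forall s k, s \in `[0, 1] -> C0_close g eps (F s k) (F 0 k).

(* In the direction j, the formal derivative is the derivative of the underlying
   planes. *)
Definition hol_dir F c s k p j : Prop :=
  pd (fun x => gr (rep (F s k (cinv c x))) c x) j (cfun c p) =
  pd (gr (rep (F s k p)) c) j (cfun c p).

Record patch := Patch {
  pc : chart R n M; pk : chart R m K; pa : rV; pb : 'rV[R]_m; ra : R; rb : R; pS : frm }.

(** The factor 4 between box and core: a bump of width r is 1 on the core and vanishes from distance
    2r on; one of width 2r is 1 up to there and vanishes from distance 4r on. *)
Definition box (P : patch) k p :=
  cbox (pk P) (pb P) (4 * rb P) k /\ cbox (pc P) (pa P) (4 * ra P) p.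
Definition core (P : patch) k p := cbox (pk P) (pb P) (rb P) k /\ cbox (pc P) (pa P) (ra P) p.

(** Only the value of [F] at time 0 occurs, so a patch survives all modifications that keep this
    value. *)
Definition is_patch F (P : patch) : Prop :=
  [/\ atlas (pc P) /\ atlas (pk P), 0 < ra P /\ 0 < rb P,
      forall x, `|x - pa P| <= 4 * ra P -> cimg (pc P) x,
      forall y, halfspace y -> `|y - pb P| <= 4 * rb P -> cimg (pk P) y &
      forall k p, box P k p -> row_free (pS P *m gr (rep (F 0 k p)) (pc P) (cfun (pc P) p))].

Lemma good_step2 F s k p : good F -> s \in `[0, 1] -> step2 3 p (F s k p).
Proof. by move=> [[_ H] _] s01; exact: H. Qed.

Lemma good_J1 F s k p : good F -> s \in `[0, 1] -> J1 3 p (F s k p).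
Proof. by move=> gF s01; case: (good_step2 k p gF s01). Qed.

Lemma good_smooth F d c z : good F -> atlas d -> atlas c -> (pardom d `*` cimg c : set Z) z ->
  smooth_jets_at (pardom d) (in_chart F d) c z.
Proof.
move=> gF ad ac Xz; have [[sj _] _] := gF.
apply: (formal_homotopy_smooth_at ad ac (sj _ ad) Xz) => s k p; exact: good_J1.
Qed.

Lemma zero01 : (0 : R) \in `[0, 1].
Proof. by rewrite in_itv /= lexx ler01. Qed.

Lemma chart_point d c s k p : s \in `[0, 1] -> cdom d k -> cdom c p ->
  (pardom d `*` cimg c : set Z) ((s, cfun d k), cfun c p).
Proof. by move=> s01 dk cp; split; [split=> //; exact: cimg_cfun|exact: cimg_cfun]. Qed.

Lemma smooth_family_local F F' s k p (U : set M) (V : set K) : good F' -> s \in `[0, 1] ->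
  nbhs p U -> nbhs k V ->
  (forall t k' q, t \in `[0, 1] -> V k' -> U q -> F t k' q = F' t k' q) ->
  smooth_family_at F s k p.
Proof.
move=> gF s01 Up Vk E; pose d := chart_at k; pose c := chart_at p.
have ad : atlas d := chart_at_atlas k; have ac : atlas c := chart_at_atlas p.
have dk : cdom d k := chart_at_dom k; have cp : cdom c p := chart_at_dom p.
exists d, c; split=> //.
have [s1 s2] := good_smooth gF ad ac (chart_point s01 dk cp).
have nE : \forall w \near ((s, cfun d k), cfun c p), (pardom d `*` cimg c : set Z) w ->
    in_chart F' d w.1 (cinv c w.2) = in_chart F d w.1 (cinv c w.2).
  have nU := near_snd (s, cfun d k) (near_cinv ac cp Up).
  have nV := near_fst (cfun c p) (near_snd s (near_cinv_within ad dk Vk)).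
  apply: filterS2 nU nV => w [_ h1] h2 [[w1 w2] w3].
  by rewrite /in_chart E //; exact: h2.
split=> [|i].
  by apply: smooth_at_ext s1; apply: filterS nE => w h Xw; rewrite /jP h.
by apply: smooth_at_ext (s2 i); apply: filterS nE => w h Xw; rewrite /jL h.
Qed.

Section Patch.
Variables (F : R -> K -> M -> jet M) (P : patch) (i0 : 'I_n).
Hypothesis gF : good F.
Hypothesis HP : is_patch F P.
Local Notation c := (pc P).
Local Notation d := (pk P).
Local Notation a := (pa P).
Local Notation b := (pb P).
Local Notation ra := (ra P).
Local Notation rb := (rb P).
Local Notation S := (pS P).
Local Notation X := (pardom d `*` cimg c : set Z).

Lemma pac : atlas c. Proof. by case: HP => -[]. Qed.
Lemma pad : atlas d. Proof. by case: HP => -[]. Qed.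
Lemma ra0 : 0 < ra. Proof. by case: HP => _ []. Qed.
Lemma rb0 : 0 < rb. Proof. by case: HP => _ []. Qed.

Let Pz : Z -> 'M[R]_n := jP (in_chart F d) c.
Let Lz : 'I_n -> Z -> 'M[R]_n := jL (in_chart F d) c.
Let P0 (z : Z) : 'M[R]_n := Pz ((0, z.1.2), z.2).
Let Gm (z : Z) : 'M[R]_n := chart_metric g c z.2.
(* A is a frame of the plane of F at time s, obtained by projecting the frame
   S *m P0 of the plane at time 0; Ef i is the difference between the formal and
   the actual derivative of A. *)
Let T (z : Z) : frm := S *m P0 z *m Gm z.
Let A (z : Z) : frm := T z *m Pz z.
Let Ef i (z : Z) : frm := T z *m (Lz i z - pdx Pz i z).
(* tau is 1 on the core at s = 1; chi is 1 where tau is nonzero; both vanish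
   outside the box and at s = 0. *)
Let chi (z : Z) : R := bump1 (2 * (z.1.1 - 1)) * bump b (2 * rb) z.1.2 * bump a (2 * ra) z.2.
Let tau (z : Z) : R := bump1 (4 * (z.1.1 - 1)) * bump b rb z.1.2 * bump a ra z.2.
Let Q : set Z := (`[0, 1] `*` [set y | halfspace y /\ `|y - b| <= 4 * rb]) `*`
  [set x | setT x /\ `|x - a| <= 4 * ra].
Let eb (z : Z) : R := eps (cinv c z.2).

Let oO : open (cimg c). Proof. exact: cimg_open pac. Qed.

Let sPL z : X z -> smooth_at X z Pz /\ forall i, smooth_at X z (Lz i).
Proof.
exact: good_smooth gF pad pac.
Qed.

Let sP z : X z -> smooth_at X z Pz. Proof. by case/sPL. Qed.
Let sL i z : X z -> smooth_at X z (Lz i). Proof. by case/sPL => _; apply. Qed.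

Let X0 z : X z -> X ((0, z.1.2), z.2).
Proof. by move=> [[s01 dy] cx]; split=> //; split=> //; exact: zero01. Qed.

Let sP0 z : X z -> smooth_at X z P0.
Proof.
move=> Xz; apply: (@smooth_at_comp _ _ _ _ (fdpair (bpar R m) (fdmx R 1 n)) (fdmx R n n) X X z
  (fun z : Z => (((0, z.1.2), z.2) : Z)) Pz) => //.
- by apply: filterE => w; exact: X0.
- apply: (smooth_at_pair (bpar R m) (fdmx R 1 n)); last exact: smooth_at_snd.
  apply: (smooth_at_pair (fdR R) (fdmx R 1 m)); first exact: smooth_at_cst.
  apply: (@smooth_at_comp _ _ _ _ (bpar R m) (fdmx R 1 m) X setT z fst snd) => //.
  + exact: filterE.
  + exact: smooth_at_fst.
  + exact: smooth_at_snd.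
- by apply: sP; exact: X0.
Qed.

Let sGm z : X z -> smooth_at X z Gm.
Proof.
move=> Xz; apply: (@smooth_at_comp _ _ _ _ (fdmx R 1 n) (fdmx R n n) X (cimg c) z snd (chart_metric g c)) => //.
- by apply: filterE => w [].
- exact: smooth_at_snd.
- by apply: chart_metric_smooth => //; [exact: pac|case: Xz].
Qed.

Let sT z : X z -> smooth_at X z T.
Proof.
move=> Xz; apply: smooth_at_mulmx; last exact: sGm.
by apply: smooth_at_mulmx; [exact: smooth_at_cst|exact: sP0].
Qed.

Let sA z : X z -> smooth_at X z A.
Proof. by move=> Xz; apply: smooth_at_mulmx; [exact: sT|exact: sP]. Qed.

Let sE i z : X z -> smooth_at X z (Ef i).
Proof.
move=> Xz; apply: smooth_at_mulmx; first exact: sT.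
by apply: smooth_atB; [exact: sL|apply: smooth_pdx => //; exact: sP].
Qed.

Let smooth_cutoff z (t r1 r2 : R) : X z ->
  smooth_at X z (fun z : Z => bump1 (t * (z.1.1 - 1)) * bump b r1 z.1.2 * bump a r2 z.2).
Proof.
move=> Xz.
have s1 : smooth_at X z (fun z : Z => z.1.1).
  apply: (@smooth_at_comp _ _ _ _ (bpar R m) (fdR R) X setT z fst fst) => //.
  - exact: filterE.
  - exact: smooth_at_fst.
  - exact: smooth_at_fst.
have s2 : smooth_at X z (fun z : Z => z.1.2).
  apply: (@smooth_at_comp _ _ _ _ (bpar R m) (fdmx R 1 m) X setT z fst snd) => //.
  - exact: filterE.
  - exact: smooth_at_fst.
  - exact: smooth_at_snd.
apply: smooth_atM; last by apply: smooth_bump => //; exact: smooth_at_snd.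
apply: smooth_atM; last exact: smooth_bump.
apply: smooth_bump1 => //; apply: smooth_atM; first exact: smooth_at_cst.
by apply: smooth_atB => //; exact: smooth_at_cst.
Qed.

Let chi0 z : 0 <= chi z.
Proof. by apply: mulr_ge0; [apply: mulr_ge0; [exact: bump1_ge0|exact: bump_ge0]|exact: bump_ge0]. Qed.

Let chi1 z : tau z != 0 -> chi z = 1.
Proof.
rewrite /tau /chi => t0.
have h1 : bump1 (4 * (z.1.1 - 1)) != 0 by apply: contraNneq t0 => ->; rewrite !mul0r.
have h2 : bump b rb z.1.2 != 0 by apply: contraNneq t0 => ->; rewrite mulr0 mul0r.
have h3 : bump a ra z.2 != 0 by apply: contraNneq t0 => ->; rewrite mulr0.
rewrite bump1_eq1; last first.
  (* In the time variable, [tau] is supported in s >= 1/2 and [chi] is 1 from s = 1/2 on: the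
     corrugation has reached full amplitude before the formal derivative starts to move. *)
  have : `|4 * (z.1.1 - 1)| < 2 by rewrite ltNge; apply/negP => /bump1_eq0 E; rewrite E eqxx in h1.
  have -> : 4 * (z.1.1 - 1) = 2 * (2 * (z.1.1 - 1)) :> R by ring.
  by rewrite normrM ger0_norm // -ltr_pdivlMl // mulVf // => /ltW.
rewrite bump_eq1 ?mul1r; [|by rewrite mulr_gt0 // rb0|]; last first.
  by apply: ltW; rewrite ltNge; apply/negP => /(bump_eq0 rb0) E; rewrite E eqxx in h2.
rewrite bump_eq1 //; first by rewrite mulr_gt0 // ra0.
by apply: ltW; rewrite ltNge; apply/negP => /(bump_eq0 ra0) E; rewrite E eqxx in h3.
Qed.

Let cQ : compact Q.
Proof.
apply: compact_setX; last by apply: compact_cball; exact: closedT.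
by apply: compact_setX; [exact: segment_compact|apply: compact_cball; exact: closed_halfspace].
Qed.

Let QX : Q `<=` X.
Proof.
move=> [[s y] x] [[s01 [hy yb]] [_ xa]]; have [_ _ H1 H2 _] := HP.
by split; [split=> //; exact: H2|exact: H1].
Qed.

Let Qbox z : Q z -> box P (cinv d z.1.2) (cinv c z.2).
Proof.
move=> Qz; have [[_ dy] cx] := QX Qz; case: Qz => [[_ [_ yb]] [_ xa]].
split; split; [exact: cinv_dom pad dy| |exact: cinv_dom pac cx|].
  by rewrite (cinvK pad dy).
by rewrite (cinvK pac cx).
Qed.

Let F_frame z : X z -> row_free (A z) ->
  is_frame (in_chart F d z.1 (cinv c z.2)) c (cinv c z.2) (A z) (formalB A Ef ^~ z).
Proof.
move=> Xz fA; have [[s01 dy] cx] := Xz; have ac := pac.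
have JJ : J1 3 (cinv c z.2) (in_chart F d z.1 (cinv c z.2)) by exact: good_J1.
have [dr _ JE] := J1_rep JJ; have cq := cinv_dom ac cx.
have xE := cinvK ac cx.
have sT' := smooth_slice (bpar R m) oO Xz (sT Xz).
have sP' := smooth_slice (bpar R m) oO Xz (sP Xz).
have := @frame_exists _ _ _ _ _ _ (fun x => T (z.1, x)) ac cq dr.
rewrite xE => /(_ sT') H.
have zE : z = (z.1, z.2) by rewrite -surjective_pairing.
have fr := is_frame_near ac cq (H _).
rewrite -JE xE in fr.
have AE : T (z.1, z.2) *m gr (rep (in_chart F d z.1 (cinv c z.2))) c z.2 = A z by rewrite -zE.
rewrite AE in fr; have {}fr := fr fA.
have BE : (pd (fun x => T (z.1, x) *m gr (rep (in_chart F d z.1 (cinv c z.2))) c x))^~ z.2 =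
   formalB A Ef ^~ z.
  apply/funext => i; rewrite /formalB /pdx /A pd_mulmx //; last first.
    by rewrite -[X in smooth_at _ X]xE; exact: distribution_near_smooth.
  rewrite (pd_mulmx _ sT' sP') -zE /Ef mulmxBr /pdx addrA addrAC.
  by rewrite addrK.
by rewrite BE in fr.
Qed.

Let closeF z (A1 : frm) B : X z ->
  is_frame (in_chart F d z.1 (cinv c z.2)) c (cinv c z.2) A1 B -> frame_close P0 Gm eb z A1.
Proof.
move=> Xz fr; have [[s01 dy] cx] := Xz; have ac := pac.
have cq := cinv_dom ac cx; have xE := cinvK ac cx.
have JJ0 : J1 3 (cinv c z.2) (F 0 (cinv d z.1.2) (cinv c z.2)) by exact: (good_J1 _ _ gF zero01).
have [e0 _] := andP (eps01 (cinv c z.2)).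
have [H _] := planes_close_frame rg ac cq e0 fr JJ0.
rewrite xE in H; apply: H => xi eta Fxi Feta.
by have [_ cl] := gF; exact: (cl _ _ s01 _ _ _ Fxi Feta).
Qed.

(** The factor [Gm] in [T] is what makes this true: closeness is measured in the metric, whereas
    [Pz] is a Euclidean projector. The tolerance, at most 1, prevents a vector of the plane at time
    s from being metrically orthogonal to the plane at time 0, and [row_free_close] concludes. *)
Let fA z : Q z -> row_free (A z).
Proof.
move=> Qz; have Xz := QX Qz; have [[s01 dy] cx] := Xz; have ac := pac.
have cq := cinv_dom ac cx; have xE := cinvK ac cx.
have JJ : J1 3 (cinv c z.2) (in_chart F d z.1 (cinv c z.2)) by exact: good_J1.
have JJ0 : J1 3 (cinv c z.2) (F 0 (cinv d z.1.2) (cinv c z.2)) by exact: (good_J1 _ _ gF zero01).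
have [dr _ JE] := J1_rep JJ; have [dr0 _ _] := J1_rep JJ0.
have [S1 fS1] := frame_pick ac cq dr.
have sS1 : smooth_at setT (cfun c (cinv c z.2)) (fun=> S1) by exact: smooth_at_cst.
have fr := is_frame_near ac cq (frame_exists ac cq dr sS1 fS1).
rewrite -JE xE in fr; have cl := closeF Xz fr.
have [_ _ _ _ HS] := HP; have fS := HS _ _ (Qbox Qz); rewrite xE in fS.
have rP0 : \rank (P0 z) = 3%N.
  by have := nbhs_singleton (distribution_near_rank ac cq dr0); rewrite xE.
have PA : (P0 z <= S *m P0 z)%MS.
  have rS : \rank (S *m P0 z) = 3%N by apply/eqP.
  by have [_ <-] := mxrank_leqif_sup (submxMl S (P0 z)); rewrite rS rP0.
have [e0 e1] := andP (eps01 (cinv c z.2)).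
apply: (@row_free_close _ _ (Gm z) (P0 z) (Pz z) (S *m P0 z) (S1 *m Pz z) (eb z)) => //.
- rewrite /Gm /chart_metric !trmx_mul trmxK mulmxA; congr (_ *m _ *m _).
  by case: rg => ->.
- by move=> u; rewrite chart_metric_ge0.
- by rewrite /eb e0 e1.
- by rewrite -mulmxA /Pz /jP gr_idem.
- by rewrite /Pz /jP gr.unlock; exact: orthoproj_sym.
Qed.

Lemma corrugated_frame : exists (a1 : Z -> frm) (B1 : 'I_n -> Z -> frm),
  [/\ forall z, X z -> smooth_at X z a1 /\ forall i, smooth_at X z (B1 i),
      forall z, Q z -> [/\ row_free (a1 z), step2_frame (a1 z) (B1 ^~ z) & frame_close P0 Gm eb z (a1 z)],
      forall z i, (\forall x \near z.2, chi (z.1, x) = 0) ->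
        a1 z = A z /\ B1 i z = formalB A Ef i z &
      forall z i, X z -> B1 i z = pdx a1 i z + (1 - tau z * (i == i0)%:R) *: Ef i z].
Proof.
refine (@corrugation R n _ (bpar R m) (pardom d) (cimg c) A Ef chi tau i0 Q P0 Gm eb oO sA sE _ _ chi0 chi1 cQ QX fA _ sP0 sGm _ _ _ _).
- by move=> z Xz; exact: smooth_cutoff.
- by move=> z Xz; exact: smooth_cutoff.
- move=> z Qz; have Xz := QX Qz; have [[s01 dy] cx] := Xz.
  apply/(is_frame_step2 n3 pac (cinv_dom pac cx) (F_frame Xz (fA Qz))).
  exact: good_step2.
- by move=> z; rewrite /eb; case/andP: (eps01 (cinv c z.2)).
- by move=> z u Xz; exact: chart_metric_ge0.
- move=> z r [_ cx] re.
  have h : \forall x \near z.2, r < eps (cinv c x).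
    have ne : \forall q \near cinv c z.2, r < eps q.
      by apply: (@ceps (cinv c z.2) (fun t => r < t)); exact: lt_nbhsr.
    have := near_cinv pac (cinv_dom pac cx) ne; rewrite (cinvK pac cx).
    by apply: filterS => x [].
  have := near_snd z.1 h; rewrite -surjective_pairing.
  by apply: filterS => w hw _.
- by move=> z Qz; exact: closeF (QX Qz) (F_frame (QX Qz) (fA Qz)).
Qed.

Local Notation inbox s k p := (s \in `[0, 1] /\ box P k p).
Local Notation pt s k p := (((s, cfun d k), cfun c p) : Z).

Let near_bump (n' : nat) (a' : 'rV[R]_n') r x : 0 < r -> 4 * r < `|x - a'| ->
  \forall x' \near x, bump a' (2 * r) x' = 0.
Proof.
move=> r0 h.
have : \forall x' \near x, 4 * r < `|x' - a'|.
  have cf : `|x' - a'| @[x' --> x] --> `|x - a'|.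
    exact: (cvg_norm (cvgB (@cvg_id _ (nbhs x)) (@cvg_cst _ a' _ _ _))).
  by apply: (cf (fun t => 4 * r < t)); exact: lt_nbhsr.
apply: filterS => x' h'; apply: bump_eq0; first by rewrite mulr_gt0.
by apply: le_trans (ltW h'); rewrite mulrA -natrM.
Qed.

Let chi_off z : X z -> ~ Q z \/ z.1.1 = 0 -> \forall x \near z.2, chi (z.1, x) = 0.
Proof.
case: z => -[s y] x [[s01 dy] cx] /= [nQ|->]; last first.
  apply: filterE => x'; rewrite /chi /= bump1_eq0 ?mul0r //.
  by rewrite sub0r mulrN1 normrN ger0_norm.
have [yb|yb] := lerP `|y - b| (4 * rb); last first.
  apply: filterE => x'; rewrite /chi /=.
  by rewrite (nbhs_singleton (near_bump rb0 yb)) mulr0 mul0r.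
have [xa|xa] := lerP `|x - a| (4 * ra).
  by exfalso; apply: nQ; split=> //; split=> //; split=> //; exact: (cimg_sub pad dy).
by apply: filterS (near_bump ra0 xa) => x' h; rewrite /chi /= h mulr0.
Qed.

Let box_Q s k p : inbox s k p -> Q (pt s k p).
Proof.
move=> [s01 [[dk kb] [cp pa]]]; split=> //; split=> //; split=> //.
by apply: (cimg_sub pad); exact: cimg_cfun.
Qed.

Lemma corrugation_step : exists F' : R -> K -> M -> jet M,
  [/\ good F' /\ (forall k p, F' 0 k p = F 0 k p),
      forall s k p, s \in `[0, 1] -> ~ box P k p -> F' s k p = F s k p,
      forall k p j, box P k p -> hol_dir F c 1 k p j -> hol_dir F' c 1 k p j &
      forall k p, core P k p -> hol_dir F' c 1 k p i0].
Proof.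
have [a1 [B1 [sa1 HQ Hoff HB]]] := corrugated_frame.
pose F' s k p : jet M := if `[< inbox s k p >] then
  fjet c p (a1 (pt s k p)) (B1 ^~ (pt s k p)) else F s k p.
have F'_in s k p : inbox s k p -> F' s k p = fjet c p (a1 (pt s k p)) (B1 ^~ (pt s k p)).
  by move=> H; rewrite /F' asboolT.
have F'_out s k p : ~ inbox s k p -> F' s k p = F s k p.
  by move=> H; rewrite /F' asboolF.
have ac := pac; have ad := pad.
(* Stated on the whole chart domains, not only in the box: outside the box [chi] vanishes nearby, so
   the corrugated frame is the frame of [F] from [F_frame]. One presentation thus covers both
   branches of [F'], which is therefore smooth across the boundary of the box. *)
have fr_pt s k p : s \in `[0, 1] -> cdom d k -> cdom c p -> row_free (a1 (pt s k p)) ->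
    is_frame (F' s k p) c p (a1 (pt s k p)) (B1 ^~ (pt s k p)).
  move=> s01 dk cp fa; have [H|H] := EM (inbox s k p).
    by rewrite F'_in //; exact: fjet_is_frame.
  have Xz : X (pt s k p) by split; [split=> //; exact: cimg_cfun|exact: cimg_cfun].
  have nQ : ~ Q (pt s k p).
    by move=> /Qbox /=; rewrite cfunK // cfunK // => hb; apply: H.
  have off := chi_off Xz (or_introl nQ).
  have E i := Hoff (pt s k p) i off.
  have E0 : a1 (pt s k p) = A (pt s k p) by case: (E i0).
  have E1 : B1 ^~ (pt s k p) = formalB A Ef ^~ (pt s k p).
    by apply/funext => i; case: (E i).
  rewrite E0 in fa *; rewrite E1 F'_out //.
  by have := F_frame Xz fa; rewrite /in_chart /= cfunK // cfunK.
have fr_box s k p : inbox s k p ->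
    is_frame (F' s k p) c p (a1 (pt s k p)) (B1 ^~ (pt s k p)).
  move=> H; have [s01 [[dk _] [cp _]]] := H; apply: fr_pt => //.
  by have [] := HQ _ (box_Q H).
have pres s k p : inbox s k p ->
    presentation (pardom d) (in_chart F' d) c (pt s k p) a1 B1.
  move=> H; have [s01 [[dk _] [cp _]]] := H.
  have Qz := box_Q H; have Xz := QX Qz; have [sa sB] := sa1 _ Xz.
  split=> //; have [fa _ _] := HQ _ Qz.
  apply: filterS (smooth_at_nearP Xz sa (row_free_near fa)) => w h Xw.
  have [[w1 w2] w3] := Xw.
  have := fr_pt w.1.1 (cinv d w.1.2) (cinv c w.2) w1 (cinv_dom ad w2) (cinv_dom ac w3).
  rewrite (cinvK ad w2) (cinvK ac w3) -!surjective_pairing /in_chart.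
  by apply; exact: h.
have J1' s k p : s \in `[0, 1] -> J1 3 p (F' s k p).
  move=> s01; have [H|H] := EM (inbox s k p); first by have [] := fr_box _ _ _ H.
  by rewrite F'_out //; exact: good_J1.
have F'0 k p : F' 0 k p = F 0 k p.
  have [H|H] := EM (inbox (0 : R) k p); last by rewrite F'_out.
  have [s01 [[dk _] [cp _]]] := H; have Xz := QX (box_Q H).
  have off := chi_off Xz (or_intror (erefl _)).
  have E i := Hoff (pt 0 k p) i off.
  have E0 : a1 (pt 0 k p) = A (pt 0 k p) by case: (E i0).
  have E1 : B1 ^~ (pt 0 k p) = formalB A Ef ^~ (pt 0 k p).
    by apply/funext => i; case: (E i).
  rewrite F'_in // E0 E1; apply/esym; apply: is_frame_fjet => //.
  have fa : row_free (A (pt 0 k p)) by apply: fA; exact: box_Q.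
  by have := F_frame Xz fa; rewrite /in_chart /= cfunK // cfunK.
have cboxM : closed (cbox c a (4 * ra)).
  by apply: (closed_cbox closedT ac); case: HP => _ _ h _ _ x _; exact: h.
have cboxK : closed (cbox d b (4 * rb)).
  by apply: (closed_cbox (@closed_halfspace R m) ad); case: HP.
have off_near k p : ~ box P k p -> (exists2 U : set M, nbhs p U & exists2 V : set K, nbhs k V &
    forall p' k', U p' -> V k' -> ~ box P k' p').
  move=> nb; have [hk|hk] := EM (cbox d b (4 * rb) k); last first.
    exists setT; first exact: filterT.
    exists (~` cbox d b (4 * rb)); last by move=> p' k' _ h [].
    by apply: open_nbhs_nbhs; split=> //; exact: closed_openC.
  exists (~` cbox c a (4 * ra)); last by exists setT; [exact: filterT|move=> p' k' h _ []].
  apply: open_nbhs_nbhs; split; first exact: closed_openC.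
  by move=> hp; apply: nb.
have off_hol k p c' j : atlas c' -> cdom c' p -> ~ box P k p ->
    hol_dir F' c' 1 k p j <-> hol_dir F c' 1 k p j.
  move=> ac' cp nb; have [U Up [V Vk H]] := off_near _ _ nb.
  have E : \forall x \near cfun c' p, gr (rep (F' 1 k (cinv c' x))) c' x = gr (rep (F 1 k (cinv c' x))) c' x.
    apply: filterS (near_cinv ac' cp Up) => x [_ Ux].
    rewrite F'_out // => -[_]; exact: H _ _ Ux (nbhs_singleton Vk).
  by rewrite /hol_dir (pd_near j E) F'_out // => -[].
(* The hypothesis says that no defect remains in the direction [j]. This happens for two reasons:
   [Ef j] is zero where [F] is holonomic in that direction, and for [j = i0] the factor is zero on
   the core, where [tau] is 1 at s = 1. *)
have key k p j : box P k p -> (1 - tau (pt 1 k p) * (j == i0)%:R) *: Ef j (pt 1 k p) = 0 ->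
    hol_dir F' c 1 k p j.
  move=> bp E0; have one01 : (1 : R) \in `[0, 1] by rewrite in_itv /= lexx ler01.
  have H : inbox (1 : R) k p by split; [exact: one01|exact: bp].
  have [[dk _] [cp _]] := bp.
  have Xz := QX (box_Q H); have [sa sB] := sa1 _ Xz.
  have sl := smooth_slice (bpar R m) oO Xz sa.
  have fr := fr_box _ _ _ H; have [fa JJ Hr] := fr.
  have [_ Jr _] := J1_rep JJ; have [_ E1] := Hr _ Jr.
  rewrite /hol_dir (E1 j) HB // E0 addr0 /pdx -(pd_pr j fa sl).
  apply: pd_near.
  have n1 := smooth_at_nearP I sl (row_free_near fa).
  apply: filterS2 n1 (cimg_nbhs ac (cimg_cfun cp)) => x /(_ I) /= fx cx.
  have cq := cinv_dom ac cx.
  have := fr_pt 1 k (cinv c x) one01 dk cq; rewrite (cinvK ac cx) => /(_ fx) [_ JJx Hx].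
  have [_ Jx _] := J1_rep JJx; have [E _] := Hx _ Jx; rewrite (cinvK ac cx) in E.
  exact: E.
have Ef0 k p j : cdom d k -> cdom c p -> hol_dir F c 1 k p j -> Ef j (pt 1 k p) = 0.
  move=> dk cp h; rewrite /Ef /Lz /pdx /Pz /jL /jP /in_chart /=.
  by move: h; rewrite /hol_dir cfunK // cfunK // => ->; rewrite subrr mulmx0.
exists F'; split.
- split=> //; split; first split.
  + move=> d' ad'; apply: (formal_homotopy_smooth n3 J1' _ ad') => s k p s01.
    have [H|H] := EM (box P k p).
      have [[dk _] [cp _]] := H; exists d, c; split=> //.
      have Hs : inbox s k p by [].
      exact: (presentation_smooth ac (QX (box_Q Hs)) (pres _ _ _ Hs)).
    have [U Up [V Vk HUV]] := off_near _ _ H.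
    apply: (smooth_family_local gF s01 Up Vk) => t k' q t01 Vk' Uq.
    by rewrite F'_out // => -[_]; exact: HUV.
  + move=> s k p s01; have [H|H] := EM (inbox s k p); last by rewrite F'_out //; exact: good_step2.
    have [_ [[dk _] [cp _]]] := H.
    apply/(is_frame_step2 n3 ac cp (fr_box _ _ _ H)).
    by have [] := HQ _ (box_Q H).
  + move=> s k s01 p xi eta; have [H|H] := EM (inbox s k p); last first.
      rewrite F'_out // F'0; have [_ cl] := gF; exact: cl.
    have [_ [[dk _] [cp _]]] := H.
    rewrite F'0 => Fxi Feta.
    have [e0 _] := andP (eps01 p).
    have JJ0 : J1 3 p (F 0 k p) by exact: (good_J1 _ _ gF zero01).
    have [_ H2] := planes_close_frame rg ac cp e0 (fr_box _ _ _ H) JJ0.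
    apply: H2 Fxi Feta => w wn.
    have [_ _ cl] := HQ _ (box_Q H); have [w0] := cl w wn.
    rewrite /P0 /Pz /jP /in_chart /eb /Gm /= cfunK // cfunK // => hw.
    by exists w0.
- by move=> s k p s01 nb; rewrite F'_out // => -[].
- move=> k p j bp hF; apply: key => //; have [[dk _] [cp _]] := bp.
  by rewrite Ef0 // scaler0.
- move=> k p [[dk kb] [cp pa]]; apply: key.
    split; split=> //.
      by apply: le_trans kb _; rewrite ler_peMl ?(ltW rb0) // ler1n.
    by apply: le_trans pa _; rewrite ler_peMl ?(ltW ra0) // ler1n.
  rewrite eqxx mulr1 /tau /= bump1_eq1; last by rewrite subrr mulr0 normr0 ler01.
  by rewrite mul1r !bump_eq1 ?ra0 ?rb0 // mulr1 subrr scale0r.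
Qed.

End Patch.
End Step.

(** * Holonomy over compact sets *)

Lemma compact_cover_nbhs (T : topologicalType) (A : set T) (f : T -> set T) : compact A ->
  (forall x, A x -> nbhs x (f x)) ->
  exists2 l : seq T, forall x, x \in l -> A x & forall y, A y -> exists2 x, x \in l & f x y.
Proof.
move=> /compact_near_coveringP cA Hf.
(* Compactness is used in its near-covering form. The filter consists of finite lists of points of
   [A] ordered by inclusion, so what holds eventually holds for one finite list. *)
pose B (l : seq T) := [set l' : seq T | {subset l <= l'} /\ forall x, x \in l' -> A x].
pose FF := filter_from [set l : seq T | forall x, x \in l -> A x] B.
have fF : Filter FF.
  apply: filter_from_filter; first by exists [::].
  move=> i j Ai Aj; exists (i ++ j).
    by move=> x; rewrite mem_cat => /orP[/Ai|/Aj].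
  move=> l [sl Al]; split; split=> // x xi; apply: sl; rewrite mem_cat xi ?orbT //.
have /(_ _) := cA _ FF (fun l y => exists2 x, x \in l & f x y) fF.
case=> [x Ax|l Al Hl].
  exists (f x, B [:: x]); first split=> /=.
  - exact: Hf.
  - by exists [:: x] => // z; rewrite inE => /eqP ->.
  by move=> [y l] /= [fy [sl _]]; exists x => //; apply: sl; rewrite inE.
by exists l => //; apply: Hl; split.
Qed.

Section Stage.
Variables (R : realType) (n : nat) (M : @manifold R n setT).
Hypothesis n3 : (3 <= n)%N.
Variable g : M -> 'M[R]_n.
Hypothesis rg : riemannian_metric g.
Variable eps : M -> R.
Hypothesis ceps : continuous eps.
Hypothesis eps01 : forall p, 0 < eps p <= 1.
Variables (m : nat) (K : @manifold R m (@halfspace R m)).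
Local Notation rV := 'rV[R]_n.
Local Notation frm := 'M[R]_(3, n).
Local Notation par := (R * 'rV[R]_m)%type.
Local Notation pardom d := (`[0, 1] `*` cimg d : set par).
Local Notation Z := (par * rV)%type.
Local Notation good := (@good R n M g eps m K).
Local Notation one01 := (ltac:(by rewrite in_itv /= lexx ler01) : (1 : R) \in `[0, 1]).
Implicit Types (F : R -> K -> M -> jet M) (c : chart R n M) (d : chart R m K).

(** The underlying section j^0 G: at each point, the plane of a representative of the jet there. *)
Definition jbase (G : M -> jet M) : plane_field M := fun q => rep (G q) q.

Definition hol F s k p : Prop := F s k p = j1 3 (jbase (F s k)) p.

Lemma gr_jbase G c x : gr (jbase G) c x = gr (rep (G (cinv c x))) c x.
Proof. by rewrite gr.unlock. Qed.

(** Representatives are chosen independently at each point, but the jet determines their planes. At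
    a fixed parameter [jP] is the projector field of [jbase], so smoothness of the family passes to
    it. *)
Lemma jbase_frame F s k p : good F -> s \in `[0, 1] ->
  exists a, frame_near (jbase (F s k)) (chart_at p) p a.
Proof.
move=> gF s01; have FJ s0 k0 p0 := @good_J1 R n M g eps m K F s0 k0 p0 gF.
set c := chart_at p; have ac : atlas c := chart_at_atlas p.
have cp : cdom c p := chart_at_dom p.
set d := chart_at k; have ad : atlas d := chart_at_atlas k.
have dk : cdom d k := chart_at_dom k.
have Xz : (pardom d `*` cimg c : set Z) ((s, cfun d k), cfun c p).
  by split; [split=> //; exact: cimg_cfun|exact: cimg_cfun].
have [sP _] := good_smooth gF ad ac Xz.
have sl := smooth_slice (bpar R m) (cimg_open ac) Xz sP.
have E : (fun x => jP (in_chart F d) c ((s, cfun d k), x)) = gr (jbase (F s k)) c.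
  by apply/funext => x; rewrite gr_jbase /jP /in_chart /= cfunK.
rewrite /= E in sl.
have [dr _ _] := J1_rep (FJ s k p s01).
have [S fS] := frame_pick ac cp dr.
have sS : smooth_at setT (cfun c p) (fun x => S *m gr (jbase (F s k)) c x).
  by apply: smooth_at_mulmx => //; exact: smooth_at_cst.
exists (fun x => S *m gr (jbase (F s k)) c x); split=> //.
have fS' : row_free (S *m gr (jbase (F s k)) c (cfun c p)) by rewrite gr_jbase cfunK.
apply: filterS2 (smooth_at_nearP I sS (row_free_near fS')) (cimg_nbhs ac (cimg_cfun cp)).
move=> x /(_ I) /= fx cx; split=> //.
have [dx _ _] := J1_rep (FJ s k (cinv c x) s01).
have rx := nbhs_singleton (distribution_near_rank ac (cinv_dom ac cx) dx).
rewrite (cinvK ac cx) -gr_jbase in rx.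
apply: eqmx_trans (gr_eqmx _ _ _); apply/eqmxP.
have rS : \rank (S *m gr (jbase (F s k)) c x) = 3%N by apply/eqP.
have [_ /esym h] := mxrank_leqif_sup (submxMl S (gr (jbase (F s k)) c x)).
by rewrite submxMl /=  h rS rx.
Qed.

Lemma jbase_near F s k p : good F -> s \in `[0, 1] -> distribution_near 3 p (jbase (F s k)).
Proof.
move=> gF s01; have [a fa] := jbase_frame k p gF s01.
exact: frame_distribution (chart_at_atlas p) (chart_at_dom p) fa.
Qed.

(** [hol_dir] depends on the chart, its conjunction over all directions does not. Directions can
    thus be treated in the chart of a patch while the outcome is independent of it. *)
Lemma holP F k p c : good F -> atlas c -> cdom c p ->
  hol F 1 k p <-> forall j, hol_dir F c 1 k p j.
Proof.
move=> gF ac cp; have FJ s0 k0 p0 := @good_J1 R n M g eps m K F s0 k0 p0 gF.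
have [dr _ JE] := J1_rep (FJ 1 k p one01).
have db := jbase_near k p gF one01.
have H := j1_eqP ac cp dr db.
have E : (fun x => gr (rep (F 1 k (cinv c x))) c x) = gr (jbase (F 1 k)) c.
  by apply/funext => x; rewrite gr_jbase.
rewrite /hol JE -H /same_jet gr_jbase cfunK // /hol_dir E.
by split=> [[_ h] j|h]; [|split=> // j]; exact: esym.
Qed.

Lemma hol_local F F' k p : good F -> good F' -> F' 1 k p = F 1 k p ->
  (\forall q \near p, F' 1 k q = F 1 k q) -> hol F 1 k p -> hol F' 1 k p.
Proof.
move=> gF gF' Ep nE; have ac := chart_at_atlas p; have cp := chart_at_dom p.
move=> /(holP k gF ac cp) h; apply/(holP k gF' ac cp) => j.
have E : \forall x \near cfun (chart_at p) p, gr (rep (F' 1 k (cinv (chart_at p) x))) (chart_at p) x =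
    gr (rep (F 1 k (cinv (chart_at p) x))) (chart_at p) x.
  by apply: filterS (near_cinv ac cp nE) => x [_ ->].
by rewrite /hol_dir (pd_near j E) Ep; exact: h.
Qed.

Lemma is_patch_base F F' P : (forall k p, F' 0 k p = F 0 k p) -> is_patch F P -> is_patch F' P.
Proof.
by move=> E [h1 h2 h3 h4 h5]; split=> // k p b; rewrite E; exact: h5.
Qed.

Lemma closed_boxes F P : is_patch F P ->
  closed (cbox (pc P) (pa P) (4 * ra P)) /\ closed (cbox (pk P) (pb P) (4 * rb P)).
Proof.
move=> [[ac ad] _ h1 h2 _]; split.
  by apply: (closed_cbox closedT ac) => x _; exact: h1.
by apply: (closed_cbox (@closed_halfspace R m) ad).
Qed.

Lemma patch_step F P : good F -> is_patch F P -> exists F' : R -> K -> M -> jet M,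
  [/\ good F' /\ (forall k p, F' 0 k p = F 0 k p),
      forall s k p, s \in `[0, 1] -> ~ box P k p -> F' s k p = F s k p,
      forall k p, hol F 1 k p -> hol F' 1 k p &
      forall k p, core P k p -> hol F' 1 k p].
Proof.
move=> gF HP.
have [[ac ad] [ra0 rb0] _ _ _] := HP.
have H (l : seq 'I_n) : exists F' : R -> K -> M -> jet M,
  [/\ good F' /\ (forall k p, F' 0 k p = F 0 k p),
      forall s k p, s \in `[0, 1] -> ~ box P k p -> F' s k p = F s k p,
      forall k p j, box P k p -> hol_dir F (pc P) 1 k p j -> hol_dir F' (pc P) 1 k p j &
      forall k p j, core P k p -> j \in l -> hol_dir F' (pc P) 1 k p j].
  elim: l => [|i l [F1 [[g1 E1] o1 h1 c1]]]; first by exists F.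
  have HP1 := is_patch_base E1 HP.
  have [F2 [[g2 E2] o2 h2 c2]] := corrugation_step n3 rg ceps eps01 i g1 HP1.
  exists F2; split.
  - by split=> // k p; rewrite E2.
  - by move=> s k p s01 nb; rewrite o2 // o1.
  - by move=> k p j bp /(h1 _ _ _ bp); exact: h2.
  - move=> k p j cp; rewrite inE => /orP[/eqP ->|jl]; first exact: c2.
    apply: h2; last exact: c1.
    case: cp => -[dk kb] [cp pa]; split; split=> //.
      by apply: le_trans kb _; rewrite ler_peMl ?(ltW rb0) // ler1n.
    by apply: le_trans pa _; rewrite ler_peMl ?(ltW ra0) // ler1n.
have [F' [[g' E'] o' h' c']] := H (enum 'I_n).
exists F'; split; [split; [exact: g'|exact: E']|exact: o'| |].
  move=> k p hF; have [b|nb] := EM (box P k p).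
    have [_ [cp _]] := b; apply/(holP k g' ac cp) => j; apply: h' => //.
    by apply: (holP k gF ac cp).1.
  apply: hol_local hF => //; first by apply: o' => //; exact: one01.
  have [cM cK] := closed_boxes HP.
  have [bk|nbk] := EM (cbox (pk P) (pb P) (4 * rb P) k).
    have no : open_nbhs p (~` cbox (pc P) (pa P) (4 * ra P)).
      by split; [exact: closed_openC|move=> bp; apply: nb].
    apply: filterS (open_nbhs_nbhs no) => q hq; apply: o' => [|[_ /hq]//]; exact: one01.
  by apply: filterE => q; apply: o' => [|[/nbk]//]; exact: one01.
move=> k p cr; have [_ [cp _]] := cr; apply/(holP k g' ac cp) => j.
by apply: c' => //; rewrite mem_enum.
Qed.

Definition stage_result (F F' : R -> K -> M -> jet M) (D : set M) (Kbad : set K) (H : set (K * M)) :=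
  [/\ good F' /\ (forall k p, F' 0 k p = F 0 k p),
      forall s k p, s \in `[0, 1] -> ~ D p \/ Kbad k -> F' s k p = F s k p,
      forall k p, hol F 1 k p -> hol F' 1 k p &
      forall k p, H (k, p) -> hol F' 1 k p].

Lemma patch_exists F k p (Kbad : set K) (Mbad : set M) : good F ->
  closed Kbad -> closed Mbad -> ~ Kbad k -> ~ Mbad p ->
  exists P, [/\ is_patch F P, nbhs (k, p) [set kp | core P kp.1 kp.2] &
    (forall k', cbox (pk P) (pb P) (4 * rb P) k' -> ~ Kbad k') /\
    (forall p', cbox (pc P) (pa P) (4 * ra P) p' -> ~ Mbad p')].
Proof.
move=> gF cKb cMb nk np; have FJ s0 k0 p0 := @good_J1 R n M g eps m K F s0 k0 p0 gF.
have z01 := zero01 R.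
set c := chart_at p; have ac : atlas c := chart_at_atlas p.
have cp : cdom c p := chart_at_dom p.
set d := chart_at k; have ad : atlas d := chart_at_atlas k.
have dk : cdom d k := chart_at_dom k.
have Xz : (pardom d `*` cimg c : set Z) ((0, cfun d k), cfun c p).
  by split; [split=> //; exact: cimg_cfun|exact: cimg_cfun].
have [sP _] := good_smooth gF ad ac Xz.
have [dr _ _] := J1_rep (FJ 0 k p z01).
have [S fS] := frame_pick ac cp dr.
have sS : smooth_at (pardom d `*` cimg c : set Z) ((0, cfun d k), cfun c p)
    (fun z => S *m jP (in_chart F d) c z).
  by apply: smooth_at_mulmx => //; exact: smooth_at_cst.
have fS' : row_free (S *m jP (in_chart F d) c ((0, cfun d k), cfun c p)).
  by rewrite /jP /in_chart /= cfunK // cfunK.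
have n1 := smooth_at_nearP Xz sS (row_free_near fS').
have nM : nbhs p (~` Mbad) by apply: open_nbhs_nbhs; split=> //; exact: closed_openC.
have nK : nbhs k (~` Kbad) by apply: open_nbhs_nbhs; split=> //; exact: closed_openC.
have n2 := near_snd ((0, cfun d k) : par) (near_cinv ac cp nM).
(* If [k] is a boundary point, the image of [d] contains only the half-space part of a
   neighbourhood; the open set [Q] ensures that all half-space points of the box lie in this
   image. *)
have [Q oO cO] := chart_img ad.
have Ok : Q (cfun d k) by have := cimg_cfun dk; rewrite cO => -[].
have nO : nbhs (cfun d k) (fun y => (cimg d y -> ~ Kbad (cinv d y)) /\ Q y).
  by apply: filterI; [exact: near_cinv_within ad dk nK|exact: open_nbhs_nbhs (conj oO Ok)].
have n3' := near_fst (cfun c p) (near_snd (0 : R) nO).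
have nA : nbhs (((0, cfun d k), cfun c p) : Z) (fun w =>
    ((pardom d `*` cimg c : set Z) w -> row_free (S *m jP (in_chart F d) c w)) /\
    ((cimg c w.2 /\ ~ Mbad (cinv c w.2)) /\
    ((cimg d w.1.2 -> ~ Kbad (cinv d w.1.2)) /\ Q w.1.2))).
  by apply: filterI; [exact: n1|apply: filterI; [exact: n2|exact: n3']].
have [r /= r0 Hr] := (nbhs_ballP _ _).1 nA.
have in_r y x : `|y - cfun d k| < r -> `|x - cfun c p| < r ->
    ball (((0, cfun d k), cfun c p) : Z) r ((0, y), x).
  move=> hy hx; split=> /=; last by rewrite -ball_normE /= distrC.
  by split=> /=; [exact: ballxx|rewrite -ball_normE /= distrC].
(* The box has radius 4 (r/8) = r/2 and so lies inside the ball on which all requirements hold. *)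
have r8 : 0 < r / 8 by rewrite divr_gt0.
have r48 : 4 * (r / 8) < r.
  have -> : 4 * (r / 8) = r / 2 by field.
  by rewrite ltr_pdivrMr // mulr_natr mulr2n ltrDl.
have in_r' y x : `|y - cfun d k| <= 4 * (r / 8) -> `|x - cfun c p| <= 4 * (r / 8) ->
    ball (((0, cfun d k), cfun c p) : Z) r ((0, y), x).
  by move=> hy hx; apply: in_r; exact: le_lt_trans r48.
have cen q l (u : 'rV[R]_l) : 0 < q -> `|u - u| <= 4 * q :> R.
  by move=> q0; rewrite subrr normr0 mulr_ge0 // ltW.
pose P := @Patch R n M m K c d (cfun c p) (cfun d k) (r / 8) (r / 8) S.
have HM x : `|x - cfun c p| <= 4 * (r / 8) -> cimg c x /\ ~ Mbad (cinv c x).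
  by move=> hx; have [_ [/= h _]] := Hr _ (in_r' _ _ (cen _ _ (cfun d k) r8) hx).
have HK y : `|y - cfun d k| <= 4 * (r / 8) -> (cimg d y -> ~ Kbad (cinv d y)) /\ Q y.
  by move=> hy; have [_ [_ /= h]] := Hr _ (in_r' _ _ hy (cen _ _ (cfun c p) r8)).
exists P; split.
- split=> //.
  + by move=> x /HM[].
  + by move=> y hy /HK[_ Oy]; rewrite cO.
  + move=> k' p' [[dk' kb] [cp' pa']].
    have [h _] := Hr _ (in_r' _ _ kb pa').
    have Xz' : (pardom d `*` cimg c : set Z) ((0, cfun d k'), cfun c p').
      by split; [split=> //; exact: cimg_cfun|exact: cimg_cfun].
    by have := h Xz'; rewrite /jP /in_chart /= cfunK // cfunK.
- have near_le (T : topologicalType) l (f : T -> 'rV[R]_l) (t : T) :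
      f x @[x --> t] --> f t -> \forall x \near t, `|f x - f t| <= r / 8.
    move=> cf; have : nbhs (f t) [set y | `|y - f t| <= r / 8].
      apply/nbhs_ballP; exists (r / 8) => //= y; rewrite -ball_normE /= distrC; exact: ltW.
    exact: cf.
  have h1 : \forall k' \near k, cbox d (cfun d k) (r / 8) k'.
    by apply: filterI; [exact: cdom_nbhs ad dk|exact: near_le (cfun_cvg ad dk)].
  have h2 : \forall p' \near p, cbox c (cfun c p) (r / 8) p'.
    by apply: filterI; [exact: cdom_nbhs ac cp|exact: near_le (cfun_cvg ac cp)].
  by apply: filterI; [exact: near_fst h1|exact: near_snd h2].
- split=> [k' [dk' kb]|p' [cp' pa']].
    have [h _] := HK _ kb; have := h (cimg_cfun dk'); by rewrite cfunK.
  by have [_] := HM _ pa'; rewrite cfunK.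
Qed.

Lemma patches_step F (I : eqType) (f : I -> patch M K) (l : seq I) (Kbad : set K) (Mbad : set M) :
  good F ->
  (forall i, i \in l -> [/\ is_patch F (f i),
    forall k', cbox (pk (f i)) (pb (f i)) (4 * rb (f i)) k' -> ~ Kbad k' &
    forall p', cbox (pc (f i)) (pa (f i)) (4 * ra (f i)) p' -> ~ Mbad p']) ->
  exists F' D, [/\ closed D, forall p, D p -> ~ Mbad p &
    stage_result F F' D Kbad [set kp | exists2 i, i \in l & core (f i) kp.1 kp.2]].
Proof.
move=> gF; elim: l => [|i l IH] Hl.
  exists F, set0; split=> //; first exact: closed0.
  by split=> // k p [].
have [|F1 [D1 [cD1 D1M [[g1 E1] o1 h1 c1]]]] := IH.
  by move=> j jl; apply: Hl; rewrite inE jl orbT.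
have [HP bK bM] := Hl i (mem_head i l).
have HP1 := is_patch_base E1 HP.
have [F2 [[g2 E2] o2 h2 c2]] := patch_step g1 HP1.
have [cM _] := closed_boxes HP.
exists F2, (D1 `|` cbox (pc (f i)) (pa (f i)) (4 * ra (f i))); split.
- exact: closedU.
- by move=> p [/D1M|/bM].
- split.
  + by split; [exact: g2|move=> k p; rewrite E2 E1].
  + move=> s k p s01 H; rewrite o2 ?o1 //.
      by case: H => [nD|]; [left=> h; apply: nD; left|right].
    by move=> [/bK nk bp]; case: H => [nD|//]; apply: nD; right.
  + by move=> k p /h1; exact: h2.
  + move=> k p [j]; rewrite inE => /orP[/eqP ->|jl] cr; first exact: c2.
    by apply: h2; apply: c1; exists j.
Qed.

Lemma stage F (A : set M) (L : set K) (Mbad : set M) (Kbad : set K) : good F ->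
  compact A -> compact L -> closed Kbad -> closed Mbad ->
  (forall k, L k -> ~ Kbad k) -> (forall p, A p -> ~ Mbad p) ->
  exists F' D, [/\ closed D, forall p, D p -> ~ Mbad p & stage_result F F' D Kbad (L `*` A)].
Proof.
move=> gF cA cL cK cM LK AM.
have /choice[f Hf] : forall kp : K * M, exists P : patch M K, (L `*` A) kp ->
    [/\ is_patch F P, nbhs kp [set kp | core P kp.1 kp.2] &
    (forall k', cbox (pk P) (pb P) (4 * rb P) k' -> ~ Kbad k') /\
    (forall p', cbox (pc P) (pa P) (4 * ra P) p' -> ~ Mbad p')].
  move=> [k p]; have [[Lk Ap]|H] := EM ((L `*` A) (k, p)); last first.
    (* A dummy patch: the finite cover only uses points of the product of [L] and [A]. *)
    by exists (@Patch R n M m K (chart_at p) (chart_at k) 0 0 0 0 0).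
  by have [P HP] := patch_exists gF cK cM (LK _ Lk) (AM _ Ap); exists P.
have cLA : compact (L `*` A) := compact_setX cL cA.
have [kp /Hf[]//|l lLA cov] := @compact_cover_nbhs _ (L `*` A) (fun i => [set kp : K * M | core (f i) kp.1 kp.2]) cLA.
have [|F' [D [cD DM [gE o h c]]]] := @patches_step F _ f l Kbad Mbad gF.
  by move=> i il; have [h1 _ [h2 h3]] := Hf i (lLA i il).
exists F', D; split=> //; split=> // k p LA; apply: c.
exact: cov.
Qed.

End Stage.

(** * Globalization *)

Section Exhaustion.
Variables (R : realType) (n : nat) (M : @manifold R n setT).

Lemma compact_nbhd (p : M) : exists2 Q : set M, compact Q & nbhs p Q.
Proof.
set c := chart_at p; have ac : atlas c := chart_at_atlas p.
have cp : cdom c p := chart_at_dom p.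
have [r /= r0 Hr] := (nbhs_ballP _ _).1 (cimg_nbhs ac (cimg_cfun cp)).
exists (cbox c (cfun c p) (r / 2)).
  apply: (compact_cbox closedT ac) => x _ hx; apply: Hr.
  rewrite -ball_normE /= distrC; apply: le_lt_trans hx _.
  by rewrite ltr_pdivrMr // mulr_natr mulr2n ltrDl.
apply: filterI; first exact: cdom_nbhs ac cp.
have : nbhs (cfun c p) [set y | `|y - cfun c p| <= r / 2].
  apply/nbhs_ballP; exists (r / 2) => /=; first by rewrite divr_gt0.
  by move=> y; rewrite -ball_normE /= distrC; exact: ltW.
exact: cfun_cvg ac cp _.
Qed.

Lemma compact_enlarge (C : set M) : compact C -> exists2 C' : set M, compact C' & C `<=` C'^°.
Proof.
move=> cC; have /choice[f Hf] : forall p : M, exists Q : set M, compact Q /\ nbhs p Q.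
  by move=> p; have [Q] := compact_nbhd p; exists Q.
have [p _|l _ Hl] := @compact_cover_nbhs _ C (fun p => (f p)^°) cC.
  by apply: nbhs_interior; case: (Hf p).
exists (\big[setU/set0]_(p <- l) f p).
  by apply: bigsetU_compact => p _; case: (Hf p).
move=> q /Hl[p pl]; apply: filterS => y fy.
by rewrite -bigcup_seq; exists p.
Qed.

Lemma exhaustion : exists C : nat -> set M,
  [/\ C 0%N = set0, forall i, compact (C i), forall i, C i `<=` (C i.+1)^° & forall p, exists i, C i p].
Proof.
have [B /countable_injP[f fI] [Bo Bb]] := @manifold_second_countable _ _ _ M.
(* [Q i] is a compact set containing the basic open set of index [i], if that one is contained in a
   compact set at all. Such basic sets cover M by local compactness. *)
have /choice[Q HQ] : forall i : nat, exists Q : set M, compact Q /\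
    forall Q1, B Q1 -> f Q1 = i -> (exists2 Q2 : set M, compact Q2 & Q1 `<=` Q2) -> Q1 `<=` Q.
  move=> i; have [[Q1 [BQ1 fQ1 [Q2 cQ2 Q12]]]|H] :=
    EM (exists Q1, [/\ B Q1, f Q1 = i & exists2 Q2 : set M, compact Q2 & Q1 `<=` Q2]).
    exists Q2; split=> // Q1' BQ1' fQ1' _.
    by rewrite (fI Q1' Q1) ?inE // fQ1' fQ1.
  exists set0; split; first exact: compact0.
  by move=> Q1 BQ1 fQ1 e; exfalso; apply: H; exists Q1.
have /choice[e He] : forall C : set M, exists C' : set M, compact C -> compact C' /\ C `<=` C'^°.
  move=> C; have [cC|nC] := EM (compact C); last by exists C => /nC.
  by have [C' h1 h2] := compact_enlarge cC; exists C'.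
pose C := fix C (i : nat) : set M := if i is j.+1 then e (C j `|` Q j) else set0.
have cC i : compact (C i).
  elim: i => [|i IH]; first exact: compact0.
  by have [|h _] := He (C i `|` Q i); first by apply: compactU => //; case: (HQ i).
have CS i : C i `|` Q i `<=` (C i.+1)^°.
  by have [|_ h] := He (C i `|` Q i); first by apply: compactU => //; case: (HQ i).
exists C; split=> //.
  by move=> i p Cp; apply: CS; left.
move=> p; have [Q1 cQ1 nQ1] := compact_nbhd p.
have [U /= [BU Up] UQ1] := Bb p _ nQ1.
exists (f U).+1; apply: interior_subset; apply: CS; right.
have [_ h] := HQ (f U); apply: h BU erefl _ _ Up.
by exists Q1.
Qed.

End Exhaustion.

(** * The limit along a compact exhaustion *)

Section Limit.
Variables (R : realType) (n : nat) (M : @manifold R n setT).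
Hypothesis n3 : (3 <= n)%N.
Variable g : M -> 'M[R]_n.
Hypothesis rg : riemannian_metric g.
Variable eps : M -> R.
Hypothesis ceps : continuous eps.
Hypothesis eps01 : forall p, 0 < eps p <= 1.
Variables (m : nat) (K : @manifold R m (@halfspace R m)).
Local Notation rV := 'rV[R]_n.
Local Notation par := (R * 'rV[R]_m)%type.
Local Notation pardom d := (`[0, 1] `*` cimg d : set par).
Local Notation Z := (par * rV)%type.
Local Notation good := (@good R n M g eps m K).
Local Notation one01 := (ltac:(by rewrite in_itv /= lexx ler01) : (1 : R) \in `[0, 1]).
Implicit Types (F : R -> K -> M -> jet M) (c : chart R n M) (d : chart R m K).

Theorem holonomic_limit F (U M' : set M) (W Kbad : set K) : good F -> compact [set: K] ->
  open U -> closed M' -> M' `<=` U -> (forall k p, U p -> hol F 1 k p) ->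
  open W -> closed Kbad -> Kbad `<=` W -> (forall k p, W k -> hol F 1 k p) ->
  exists G : R -> K -> M -> jet M,
  [/\ good G /\ (forall k p, G 0 k p = F 0 k p), forall k p, hol G 1 k p,
      exists U' : set M, [/\ open U', M' `<=` U' &
        forall s k p, s \in `[0, 1] -> U' p -> G s k p = F s k p] &
      forall s k p, s \in `[0, 1] -> Kbad k -> G s k p = F s k p].
Proof.
move=> gF cK oU cM' M'U hU oW cKb KbW hW.
have [C [C0 cC CS Ccov]] := exhaustion M.
have Cle i j : (i <= j)%N -> C i `<=` C j.
  elim: j => [|j IH]; first by rewrite leqn0 => /eqP ->.
  rewrite leq_eqVlt => /orP[/eqP -> //|]; rewrite ltnS => /IH h p /h /CS; exact: interior_subset.
have hM : hausdorff_space M by exact: manifold_hausdorff.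
(* Stage [i] makes the shell between [C i] and [C i.+1] holonomic, outside [U], without touching M'
   or [C i.-1]. The shell avoids [C i.-1] because this lies in the interior of [C i]; for i = 0 the
   set in question is [C 0], which is empty. *)
pose L := ~` W; pose A i := C i.+1 `&` (~` (C i)^° `&` ~` U).
pose Mb i := M' `|` C i.-1.
have cL : compact L.
  by apply: subclosed_compact cK _ => //; exact: open_closedC.
have cA i : compact (A i).
  apply: compact_closedI => //; apply: closedI; apply: open_closedC => //; exact: open_interior.
have cMb i : closed (Mb i) by apply: closedU => //; exact: compact_closed.
have AMb i p : A i p -> ~ Mb i p.
  move=> [_ [nC nU]] [/M'U //|]; case: i nC => [|i] nC /=; first by rewrite C0.
  by move=> /CS.
have LKb k : L k -> ~ Kbad k by move=> nW /KbW.
have /choice[st Hst] : forall x : nat * {F | good F}, exists y : {F | good F} * set M,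
    [/\ closed y.2, forall p, y.2 p -> ~ Mb x.1 p &
      stage_result g eps (sval x.2) (sval y.1) y.2 Kbad (L `*` A x.1)].
  move=> [i [F0 g0]]; have [F' [D [cD DM sr]]] :=
    stage n3 rg ceps eps01 g0 (cA i) cL cKb (cMb i) LKb (@AMb i).
  by have [[g' _] _ _ _] := sr; exists (exist _ F' g', D).
pose Gs := fix Gs (i : nat) : {F | good F} :=
  if i is j.+1 then (st (j, Gs j)).1 else exist _ F gF.
pose G_ i := sval (Gs i); pose Ds i := (st (i, Gs i)).2.
have gG i : good (G_ i) by exact: svalP (Gs i).
have stG i : [/\ closed (Ds i), forall p, Ds i p -> ~ Mb i p &
    stage_result g eps (G_ i) (G_ i.+1) (Ds i) Kbad (L `*` A i)].
  exact: Hst (i, Gs i).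
have G0 i k p : G_ i 0 k p = F 0 k p.
  by elim: i => [//|i IH]; have [_ _ [[_ ->] _ _ _]] := stG i.
have Gstep i s k p : s \in `[0, 1] -> ~ Ds i p \/ Kbad k -> G_ i.+1 s k p = G_ i s k p.
  by move=> s01 H; have [_ _ [_ o _ _]] := stG i; exact: o.
(* Stage [j] leads from [G_ j] to [G_ j.+1] and spares [C j.-1]. Hence on [C i] nothing changes from
   stage i + 1 on, and [G_ i.+1] is final there. *)
have stable i j s k p : s \in `[0, 1] -> C i p -> (i < j)%N -> G_ j s k p = G_ i.+1 s k p.
  move=> s01 Cp; elim: j => [//|j IH]; rewrite ltnS leq_eqVlt => /orP[/eqP -> //|ij].
  rewrite Gstep ?IH //; left => Dp; have [_ DM _] := stG j; apply: (DM p Dp); right.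
  by apply: Cle Cp; case: j ij {IH Dp DM}.
(* The interior matters: the limit then agrees with one term of the sequence on a whole
   neighbourhood of [p], and so inherits smoothness and holonomy from it. *)
have /choice[nu Hnu] : forall p, exists i, (C i)^° p.
  by move=> p; have [i Cp] := Ccov p; exists i.+1; exact: CS.
pose G s k p := G_ (nu p).+1 s k p.
have GE q i j s k : s \in `[0, 1] -> C i q -> (i < j)%N -> G s k q = G_ j s k q.
  move=> s01 Ciq ij; have Cnq := interior_subset (Hnu q).
  rewrite (stable _ _ _ _ _ s01 Ciq ij) /G.
  pose N := maxn i.+1 (nu q).+1.
  have iN : (i < N)%N by rewrite leq_max leqnn.
  have nN : (nu q < N)%N by rewrite leq_max leqnn orbT.
  by rewrite -(stable _ _ _ _ _ s01 Ciq iN) -(stable _ _ _ _ _ s01 Cnq nN).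
have Gnear p : \forall q \near p, forall s k, s \in `[0, 1] -> G s k q = G_ (nu p).+1 s k q.
  apply: filterS (Hnu p) => q Cq s k s01; exact: GE s01 Cq (leqnn _).
have FJG s k p : s \in `[0, 1] -> J1 3 p (G s k p).
  by move=> s01; exact: (good_J1 k p (gG (nu p).+1) s01).
have gGl : good G.
  split; first split.
  - move=> d ad; apply: (formal_homotopy_smooth n3 FJG _ ad) => s k p s01.
    apply: (smooth_family_local (gG (nu p).+1) s01 (Gnear p) filterT) => t k' q t01 _ h.
    exact: h.
  - by move=> s k p s01; exact: (good_step2 k p (gG (nu p).+1) s01).
  - by move=> s k s01 p; have [_ cl] := gG (nu p).+1; exact: cl s01 p.
have holS i j k p : (i <= j)%N -> hol (G_ i) 1 k p -> hol (G_ j) 1 k p.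
  move=> ij h; elim: j ij => [|j IH]; first by rewrite leqn0 => /eqP <-.
  rewrite leq_eqVlt => /orP[/eqP <- //|]; rewrite ltnS => /IH h1.
  by have [_ _ [_ _ hp _]] := stG j; exact: hp.
exists G; split.
- by split=> [//|k p]; exact: G0.
- move=> k p.
  have [i hi] : exists i, hol (G_ i) 1 k p.
    have [Wk|nW] := EM (W k); first by exists 0%N; exact: hW.
    have [Up|nU] := EM (U p); first by exists 0%N; exact: hU.
    (* Outside [U] and over [L], the first [C i.+1] that contains [p] places it in the shell treated
       at stage [i]; later stages preserve holonomy. *)
    have : exists i, `[< C i p >] by have [i Cp] := Ccov p; exists i; exact/asboolP.
    move=> /ex_minnP[[|i]]; first by rewrite C0 => /asboolP.
    move=> /asboolP Cp mi; exists i.+1; have [_ _ [_ _ _ hA]] := stG i; apply: hA.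
    split=> //; split=> //; split=> // /interior_subset Cip.
    by have := mi i; rewrite ltnn => h; have := h (introT (asboolP _) Cip).
  pose j := maxn i (nu p).+1.
  have hj : hol (G_ j) 1 k p by apply: holS hi; rewrite leq_max leqnn.
  have nj : (nu p < j)%N by rewrite leq_max leqnn orbT.
  apply: (hol_local (gG j) gGl) hj.
    by apply: GE nj; [exact: one01|exact: interior_subset (Hnu p)].
  by apply: filterS (Hnu p) => q Cq; apply: GE nj => //; exact: one01.
- have Foff s k p j : s \in `[0, 1] -> (forall i, ~ Ds i p) -> G_ j s k p = F s k p.
    by move=> s01 nD; elim: j => [//|j IH]; rewrite Gstep ?IH //; left; exact: nD.
  exists [set p | forall i, ~ Ds i p]; split.
  (* The supports [Ds i] are locally finite: those with i > nu p avoid [C i.-1], hence the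
     neighbourhood of [p] inside [C (nu p)]. Only finitely many closed sets remain to be avoided. *)
  + rewrite openE => p Hp.
    have H1 : \forall q \near p, forall i : 'I_(nu p).+1, ~ Ds i q.
      apply: filter_forall => i; apply: open_nbhs_nbhs; split; last exact: Hp.
      by apply: closed_openC; have [] := stG i.
    apply: filterS2 H1 (Hnu p) => q h1 Cq i Dq.
    have [ip|ip] := leqP i (nu p); first by apply: (h1 (Ordinal (n := (nu p).+1) (m := i) _)) Dq.
    have [_ DM _] := stG i; apply: (DM q Dq); right.
    by apply: Cle Cq; case: i ip {Dq DM}.
  + by move=> p M'p i Dp; have [_ DM _] := stG i; apply: (DM p Dp); left.
  + by move=> s k p s01 nD; exact: Foff.
- move=> s k p s01 Kk; rewrite /G.
  by elim: (nu p).+1 => [//|j IH]; rewrite Gstep ?IH //; right.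
Qed.

Lemma solution_hol F (V : set M) k p : good F -> open V -> V p -> solution_on 3 V (F 1 k) ->
  hol F 1 k p.
Proof.
move=> gF oV Vp [xi dxi Fxi]; set c := chart_at p.
have ac : atlas c := chart_at_atlas p; have cp : cdom c p := chart_at_dom p.
have dn q : V q -> distribution_near 3 q xi by move=> Vq; exists V.
apply/(holP k gF ac cp) => j; rewrite /hol_dir.
have E : \forall x \near cfun c p, gr (rep (F 1 k (cinv c x))) c x = gr xi c x.
  apply: filterS (near_cinv ac cp (open_nbhs_nbhs (conj oV Vp))) => x [cx Vx].
  have JJ : J1 3 (cinv c x) (F 1 k (cinv c x)) by rewrite Fxi //; exists xi => //; exact: dn.
  have [_ Jr _] := J1_rep JJ.
  have Jx : F 1 k (cinv c x) xi by rewrite Fxi //; exact: j1_refl (dn _ Vx).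
  by have := J1_gr ac (cinv_dom ac cx) JJ Jr Jx; rewrite cinvK.
rewrite (pd_near j E).
have JJ : J1 3 p (F 1 k p) by rewrite Fxi //; exists xi => //; exact: dn.
have [_ Jr _] := J1_rep JJ; rewrite {1}Fxi // in Jr.
by have [_ [_ ->]] := (j1P _ ac cp (dn _ Vp)).1 Jr.
Qed.

Lemma hol_solution F k : good F -> (forall p, hol F 1 k p) -> solution_on 3 setT (F 1 k).
Proof.
move=> gF hF; exists (jbase (F 1 k)); last by move=> p _; exact: hF.
split=> [p _|c ac x [p [cp _] <-]].
  by have [V [_ Vp [rk _]]] := jbase_near k p gF one01; exact: rk.
have := distribution_near_smooth ac cp (jbase_near k p gF one01); rewrite gr.unlock.
by apply: smooth_at_sub; exact: filterE.
Qed.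

Lemma constant_good (F : K -> M -> jet M) : formal_family (@step2 R n M 3) F ->
  good (fun=> F).
Proof.
move=> [sF rF]; have FJ k p : J1 3 p (F k p) by case: (rF k p).
split; first split.
- move=> d ad c ac; have [P [L [sP sL H]]] := sF d ad c ac.
  pose f (z : Z) : 'rV[R]_m * rV := (z.1.2, z.2).
  have sf (B : set Z) z : B z -> smooth_at B z f.
    move=> Bz; apply: (smooth_at_pair (fdmx R 1 m) (fdmx R 1 n)); last exact: smooth_at_snd.
    apply: (@smooth_at_comp _ _ _ _ (bpar R m) (fdmx R 1 m) B setT z fst snd) => //.
    + exact: filterE.
    + exact: smooth_at_fst.
    + exact: smooth_at_snd.
  have cmp k (h : 'rV[R]_m * rV -> 'M[R]_k) : smooth_on (cimg d `*` cimg c) h ->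
      smooth_on (pardom d `*` cimg c) (fun z => h (f z)).
    move=> sh z Xz.
    apply: (@smooth_at_comp _ _ _ _ (fdpair (fdmx R 1 m) (fdmx R 1 n)) (fdmx R k k) _ (cimg d `*` cimg c) z f h) => //.
    + by apply: filterE => w [[_ w2] w3].
    + exact: sf.
    + by apply: sh; case: Xz => -[_ z2] z3.
  exists (fun z => P (f z)), (fun i z => L i (f z)); split.
  + exact: cmp.
  + by move=> i; exact: cmp.
  + by move=> [s y] x [_ dy] cx xi Fxi; exact: H.
- by move=> s k p _; exact: rF.
- move=> s k _ p xi eta Fxi Feta u uxi u0.
  set c := chart_at p; have ac : atlas c := chart_at_atlas p.
  have cp : cdom c p := chart_at_dom p.
  have [e0 _] := andP (eps01 p).
  exists u; last first.
    rewrite gnorm_lt // subrr {1}/qform mul0mx mul0mx mxE mulr_gt0 ?exprn_gt0 //.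
    exact: qform_gt0.
  have E := J1_gr ac cp (FJ k p) Fxi Feta.
  have U := tco_unit ac cp.
  have Ex := gr_eqmx xi c (cfun c p); have Ee := gr_eqmx eta c (cfun c p).
  rewrite cfunK // in Ex Ee.
  rewrite -(mulmxK U (eta p)) -(mulmxK U u) submxMr // -Ee -E Ex submxMr //.
Qed.

End Limit.

Theorem theorem1p7 (R : realType) (n : nat) (hn : n = 5%N \/ n = 6%N)
    (M : @manifold R n setT) :
  complete_C0_close_hprinciple 3 (@step2 R n M 3).
Proof.
have n3 : (3 <= n)%N by case: hn => ->.
move=> m K F M' K' g eps cK fF cM' cK' [U [oU M'U sU]] [W [oW K'W sW]] rg ceps eps0.
(* Capping the tolerance at 1 keeps all planes of a homotopy non-orthogonal to those at time 0, as
   the projected frames require. *)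
pose e p := Num.min (eps p) 1.
have ce : continuous e.
  move=> p; apply: continuous_min; [exact: ceps|exact: cst_continuous].
have e01 p : 0 < e p <= 1 by rewrite /e lt_min eps0 ltr01 /= ge_min lexx orbT.
have gF := constant_good rg e01 fF.
have hK : hausdorff_space K by exact: manifold_hausdorff.
(* The homotopy has to be constant on a neighbourhood of K', while cutoffs in K need room between
   the parameters that are frozen and those still to be corrected. Normality supplies the closed set
   [closure V] between K' and [W]. *)
have [V K'V VW] : exists2 V, set_nbhs K' V & closure V `<=` W.
  apply: (compact_normal hK cK cK') => k K'k.
  by apply: open_nbhs_nbhs; split=> //; exact: K'W.
have hU k p : U p -> hol (fun=> F) 1 k p.
  by move=> Up; exact: solution_hol gF oU Up (sU k).
have hW k p : W k -> hol (fun=> F) 1 k p.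
  by move=> Wk; exact: solution_hol gF openT I (sW k Wk).
have [G [[gG G0] hG [U' [oU' M'U' HU']] HK]] :=
  holonomic_limit n3 rg ce e01 gF cK oU cM' M'U hU oW (@closed_closure _ V) VW hW.
have [fG cG] := gG.
exists G; split=> //.
- by move=> k; exact: hol_solution gG (hG k).
- split; first by exists U'.
  exists (V^°); split; [exact: open_interior|by move=> k /K'V|].
  move=> s k p s01 Vk; apply: HK => //; apply: subset_closure; exact: interior_subset.
- move=> s k s01 p xi eta Gxi Feta u uxi u0.
  have [|w wE h] := cG s k s01 p xi eta Gxi _ u uxi u0; first by rewrite G0.
  exists w => //; apply: lt_le_trans h _; apply: ler_wpM2r; first exact: sqrtr_ge0.
  by rewrite /e ge_min lexx.
Qed.
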